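(* Let $f\in\mathcal H_0^*$. Then $$c(f)^2=\max_{\nu\in\mathcal E^+}\Bigl\{2\int f\,d\nu-\|\nu\|^2\Bigr\}<+\infty,\qquad (1)$$ $$c(f)^2=\max\Bigl\{\int f\,d\nu:\ \nu\in\mathcal E^+,\ G\nu\le f\ \ \nu\text{-a.e.}\Bigr\}.\qquad (2)$$ The maximizing measures are the same in (1) and (2). They form a nonempty vaguely compact subset $\mathrm M(f)$ of $\mathcal E^+$ which depends only on the $c^*$-equivalence class of $f$. Each $\mu\in\mathrm M(f)$ is carried by $\{f>0\}$ and satisfies: (a) $G\mu\ge f$ q.e.; (b) $G\mu=f$ $\mu$-a.e.; (c) $\int f\,d\mu=\|\mu\|^2=c(f)^2$.
   Context: $X$ is a nonempty locally compact Hausdorff space, $\mathcal M^+$ the set of positive Radon measures on $X$ with the vague topology (coarsest topology making $\mu\mapsto\int\varphi\,d\mu$ continuous for every continuous compactly supported $\varphi$). $G:X\times X\to[0,+\infty]$ is a kernel: lower semicontinuous (l.s.c.), symmetric, and $G(x,x)>0$ for all $x$. For $\mu\in\mathcal M^+$: $G\mu(x)=\int G(x,y)\,d\mu(y)$, $\|\mu\|=(\int G\mu\,d\mu)^{1/2}\in[0,+\infty]$; $\mathcal E^+=\{\mu\in\mathcal M^+:\|\mu\|<+\infty\}$, $\mathcal E^+_1=\{\mu\in\mathcal M^+:\|\mu\|\le1\}$. $\mathcal F^+$: all functions $X\to[0,+\infty]$. $\mathcal G$: l.s.c. functions in $\mathcal F^+$. $\mathcal H_0$: finite-valued upper semicontinuous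 (u.s.c.) functions $X\to[0,+\infty[$ of compact support. $\mathcal C_0^+=\mathcal G\cap\mathcal H_0$. Energy capacity: $c(\varphi)=\max\{\int\varphi\,d\mu:\mu\in\mathcal E_1^+\}$ for $\varphi\in\mathcal C_0^+$; $c(h)=\inf\{c(\varphi):\varphi\in\mathcal C_0^+,\varphi\ge h\}$ for $h\in\mathcal H_0$; $c(g)=\sup\{c(\varphi):\varphi\in\mathcal C_0^+,\varphi\le g\}$ for $g\in\mathcal G$. For $f\in\mathcal F^+$: $c_*(f)=\sup\{c(h):h\in\mathcal H_0,h\le f\}$, $c^*(f)=\inf\{c(g):g\in\mathcal G,g\ge f\}$. For $E\subset X$, $c^*(E)=c^*(1_E)$. When $c_*(f)=c^*(f)$ the common value is written $c(f)$; this holds for all $f$ in $\mathcal G$, $\mathcal H_0$ and $\mathcal H_0^*$. q.e. (quasi-everywhere): everywhere except on a set $E$ with $c^*(E)=0$. Two functions in $\mathcal F^+$ are $c^*$-equivalent if they are equal q.e. $\mathcal H_0^*$: the set of $f\in\mathcal F^+$ with $\inf\{c^*(f-h):h\in\mathcal H_0,h\le f\}=0$. Functions in $\mathcal H_0^*$ are integrable for every $\nu\in\mathcal E^+$. A measure $\mu$ is carried by $A\subset X$ if $X\setminus A$ is locally $\mu$-negligible. *)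

(* Defs.v *)
From HB Require Import structures.
From mathcomp Require Import all_boot all_order all_algebra.
From mathcomp Require Import all_classical all_reals all_analysis.

Set Implicit Arguments.
Unset Strict Implicit.
Unset Printing Implicit Defensive.

Import Order.TTheory GRing.Theory Num.Theory.
Import numFieldNormedType.Exports.

Local Open Scope classical_set_scope.
Local Open Scope ring_scope.
Local Open Scope ereal_scope.

Definition maximum (R : realType) (A : set (\bar R)) (m : \bar R) : Prop :=
  A m /\ ubound A m.

Definition argmax (R : realType) (T : Type) (D : set T) (J : T -> \bar R) :
    set T :=
  [set t | D t /\ forall s, D s -> J s <= J t].

Section Functions.
Context {R : realType} {X : topologicalType}.
Implicit Types f : X -> \bar R.

Definition upper_semicontinuous f := lower_semicontinuous (fun x => - f x).

Definition Fplus : set (X -> \bar R) := [set f | forall x, 0 <= f x].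

Definition Gplus : set (X -> \bar R) :=
  [set g | Fplus g /\ lower_semicontinuous g].

Definition H0 : set (X -> \bar R) :=
  [set h | [/\ Fplus h, forall x, h x < +oo, upper_semicontinuous h &
               compact (closure [set x | h x != 0])]].

Definition C0plus : set (X -> \bar R) := Gplus `&` H0.

End Functions.

Definition Cc (R : realType) (X : topologicalType) : Type :=
  {phi : X -> R | continuous phi /\
                  compact (closure [set x | phi x != 0%R])}.

(* The point of X only records that X is nonempty; g_sigma_algebraType asks for
   it. *)
Definition borel (X : ptopologicalType) := g_sigma_algebraType (@open X).

Section Radon.
Context (R : realType) (X : ptopologicalType).

(* Radon measures in Bourbaki's sense, through the Riesz representation that is
   outer regular on Borel sets and inner regular on open sets: null sets are
   then Bourbaki's negligible sets, which may be smaller than the locally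
   negligible ones when X is not sigma-compact.
   A {measure set _ -> _} is a function on all sets, unconstrained outside the
   sigma-algebra. Outer regularity is required of every set E, which makes
   mu E the outer measure of E, so that a Radon measure has exactly one
   representative. *)
Definition is_radon (mu : {measure set (borel X) -> \bar R}) : Prop :=
  [/\ forall K : set X, compact K -> mu K < +oo,
      forall E : set X,
        mu E = ereal_inf [set mu U | U in [set U : set X | open U /\ E `<=` U]]
    & forall U : set X, open U ->
        mu U = ereal_sup
          [set mu K | K in [set K : set X | compact K /\ K `<=` U]]].

Record radon := Radon {
  radon_measure :> {measure set (borel X) -> \bar R};
  radonP : is_radon radon_measure }.

HB.instance Definition _ := gen_eqMixin radon.
HB.instance Definition _ := gen_choiceMixin radon.

Definition vague_eval (mu : radon) : prod_topology (fun _ : Cc R X => R) :=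
  fun phi => (\int[mu]_x sval phi x)%R.

Definition vague : topologicalType := initial_topology vague_eval.

End Radon.

Section Measures.
Context {R : realType} {X : ptopologicalType}.
Implicit Types mu : radon R X.

Definition locally_negligible mu (N : set X) : Prop :=
  forall K : set X, compact K -> mu.-negligible (K `&` N).

Definition carried_by mu (A : set X) : Prop := locally_negligible mu (~` A).

End Measures.

Section Kernel.
Context {R : realType} {X : ptopologicalType}.

Definition is_kernel (G : X * X -> \bar R) : Prop :=
  [/\ forall z, 0 <= G z, lower_semicontinuous G,
      forall x y, G (x, y) = G (y, x) & forall x, 0 < G (x, x)].

Variable G : X * X -> \bar R.
Implicit Types (mu : radon R X) (f g h phi : X -> \bar R) (E : set X).

Definition potential mu (x : X) : \bar R := \int[mu]_y G (x, y).

Definition norm mu : \bar R := sqrte (\int[mu]_x potential mu x).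

Definition Eplus : set (radon R X) := [set mu | norm mu < +oo].

Definition Eplus1 : set (radon R X) := [set mu | norm mu <= 1].

(* c is given by three formulas, on C0plus, H0 and Gplus; they agree on
   C0plus, the intersection of H0 and Gplus, since cap_C0 is monotone. *)
Definition cap_C0 phi : \bar R := ereal_sup [set \int[mu]_x phi x | mu in Eplus1].

Definition cap_H0 h : \bar R :=
  ereal_inf [set cap_C0 phi | phi in
              [set phi | C0plus phi /\ forall x, h x <= phi x]].

Definition cap_G g : \bar R :=
  ereal_sup [set cap_C0 phi | phi in
              [set phi | C0plus phi /\ forall x, phi x <= g x]].

Definition cap_lower f : \bar R :=
  ereal_sup [set cap_H0 h | h in [set h | H0 h /\ forall x, h x <= f x]].

Definition cap_upper f : \bar R :=
  ereal_inf [set cap_G g | g in [set g | Gplus g /\ forall x, f x <= g x]].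

Definition has_capacity f (c : \bar R) : Prop :=
  cap_lower f = c /\ cap_upper f = c.

Definition cap_upper_set E : \bar R := cap_upper (fun x => (\1_E x)%:E).

Definition quasi_everywhere (P : X -> Prop) : Prop :=
  cap_upper_set (~` [set x | P x]) = 0.

Definition cap_equiv f1 f2 : Prop := quasi_everywhere (fun x => f1 x = f2 x).

(* Elements of H0star need not be Borel. On nonnegative functions the library
   integral is the supremum over Borel simple functions below the integrand,
   which is the value of the integral for every function that is integrable
   with respect to the completed measure, as f in H0star is for every nu in
   Eplus. *)
Definition H0star : set (X -> \bar R) :=
  [set f | Fplus f /\
    ereal_inf [set cap_upper (fun x => f x - h x) | h in
                [set h | H0 h /\ forall x, h x <= f x]] = 0].

Definition gauss_functional f (nu : radon R X) : \bar R :=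
  2%:E * \int[nu]_x f x - norm nu ^+ 2.

Definition Eplus_below f : set (radon R X) :=
  [set nu | Eplus nu /\ {ae nu, forall x, potential nu x <= f x}].

Definition maximizers f : set (radon R X) := argmax Eplus (gauss_functional f).

End Kernel.

(* Main.v *)
Require Import Defs.
From HB Require Import structures.
From mathcomp Require Import all_boot all_order all_algebra.
From mathcomp Require Import all_classical all_reals all_analysis.
From mathcomp Require Import measurable_realfun.
From mathcomp Require Import ring lra.

Set Implicit Arguments.
Unset Strict Implicit.
Unset Printing Implicit Defensive.

Import Order.TTheory GRing.Theory Num.Theory.
Import numFieldNormedType.Exports.

Local Open Scope classical_set_scope.
Local Open Scope ring_scope.
Local Open Scope ereal_scope.

Import HBSimple HBNNSimple.

(** The capacity is the support function [c f = sup {int f dnu : |nu| <= 1}], and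
    [nu |-> int f dnu] is vaguely u.s.c. on energy balls because [f] lies between
    a finite u.s.c. [h] of compact support and [h + g] with [c g] small. Energy
    balls are vaguely compact: an ultrafilter of measures defines a positive
    functional on [C_c], hence a Radon measure by Riesz, and the energy is vaguely
    l.s.c. So the supremum is attained at some [nu], and [mu = c(f) nu] solves
    both problems, since [2 int f dnu - |nu|^2 <= 2 c |nu| - |nu|^2 <= c^2].
    Replacing a maximizer [mu] by [mu + t nu] gives [int f dnu <= int G mu dnu] for
    all [nu] of finite energy; applied to restrictions of [nu] to the compact sets
    where [G mu + d <= h], this shows that these sets have capacity zero, whence
    [G mu >= f] q.e.; equality of the integrals then gives [G mu = f] mu-a.e. *)

(** * Compactly supported continuous functions *)

(** [f] need not be Borel, while [int_radd] and [int_rscale] take Borel integrands; [H0star_borel]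
    supplies a Borel minorant of [f] with the same integral against every measure of finite energy.
    Nor need [X] have a countable base, so compactness is used through directed families
    ([compact_directed]), for sets of points and for sets of measures alike. The formula [cap_C0]
    makes sense for every nonnegative function and is shown to give the capacity on [Gplus], [H0]
    and [H0star]; subadditivity is then that of a supremum of integrals. Positivity of [G] on the
    diagonal enters twice: it bounds the mass of compact sets over an energy ball, so that
    ultrafilter limits of integrals are finite, and it makes [mu] null near any point where [G mu]
    vanishes, which is how (b) leads to the carrier [{f > 0}]. The bound in (2) comes from
    integrating [G nu <= f] against [nu]: [|nu|^2 <= int f dnu <= c |nu|], so [|nu| <= c]. *)

Section CompactDirected.
Context {T : topologicalType}.

(** Directedness merges the finitely many indices of a subcover into one; the filter [F] of tails of
    [D] makes this an instance of near-covering. Boundedness, Dini arguments and the exchange of an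
    infimum over functions with a supremum over measures all come from it. *)
Lemma compact_directed (K : set T) (I : Type) (D : set I) (P : I -> set T) :
  compact K -> D !=set0 ->
  (forall i j, D i -> D j ->
    exists k, [/\ D k, P i `<=` P k & P j `<=` P k]) ->
  (forall x, K x -> exists2 i, D i & \forall y \near x, P i y) ->
  exists2 i, D i & K `<=` P i.
Proof.
move=> cK [i0 Di0] dirD covK.
pose F := filter_from D (fun i => [set j | D j /\ P i `<=` P j]).
have FF : Filter F.
  apply: filter_from_filter; first by exists i0.
  move=> i j Di Dj; have [k [Dk ik jk]] := dirD _ _ Di Dj.
  by exists k => // l [Dl kl]; split; split => //; apply: subset_trans kl.
have /compact_near_coveringP/(_ I F (fun i x => P i x) FF) := cK.
case.
  move=> x Kx; have [i Di Pix] := covK _ Kx.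
  exists (P i, [set j | D j /\ P i `<=` P j]) => //=.
    by split => //; exists i.
  by move=> [y j] [/= Piy [_ ij]]; exact: ij.
by move=> i Di Pi; exists i => //; apply: Pi; split.
Qed.

End CompactDirected.

(** Unbundled form of the condition in [Cc], so that functions are combined without repacking
    proofs. *)
Definition isCc (R : realType) (X : topologicalType) (phi : X -> R) : Prop :=
  continuous phi /\ compact (closure [set x | phi x != 0%R]).

Section CcFunctions.
Context {R : realType} {X : topologicalType}.
Implicit Types (phi psi theta : X -> R) (K U : set X).
Local Open Scope ring_scope.

Lemma isCc_sub2 phi psi theta : continuous theta -> isCc phi -> isCc psi ->
  (forall x, phi x = 0 -> psi x = 0 -> theta x = 0) -> isCc theta.
Proof.
move=> ct [_ cphi] [_ cpsi] h; split => //.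
apply: subclosed_compact (compactU cphi cpsi) _; first exact: closed_closure.
rewrite -closureU; apply: closureS => x /= tx0.
have [p0|] := eqVneq (phi x) 0; last by left.
have [q0|] := eqVneq (psi x) 0; last by right.
by rewrite h // eqxx in tx0.
Qed.

Lemma isCc_sub phi theta : continuous theta -> isCc phi ->
  (forall x, phi x = 0 -> theta x = 0) -> isCc theta.
Proof. by move=> ct cp h; apply: (isCc_sub2 ct cp cp) => x /h. Qed.

Lemma isCc_cst0 : isCc (fun _ : X => 0 : R).
Proof.
split; first by move=> x; exact: cvg_cst.
rewrite [X in closure X](_ : _ = set0) ?closure0; first exact: compact0.
by apply/seteqP; split => x //=; rewrite eqxx.
Qed.

Lemma isCcD phi psi : isCc phi -> isCc psi -> isCc (fun x => phi x + psi x).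
Proof.
move=> p q; apply: (isCc_sub2 _ p q) => [x|x -> ->]; last by rewrite addr0.
by apply: cvgD; [exact: p.1|exact: q.1].
Qed.

Lemma isCcZ a phi : isCc phi -> isCc (fun x => a * phi x).
Proof.
move=> p; apply: (isCc_sub _ p) => [x|x ->]; last by rewrite mulr0.
by apply: cvgM; [exact: cvg_cst|exact: p.1].
Qed.

Lemma isCcN phi : isCc phi -> isCc (fun x => - phi x).
Proof.
by move=> /(@isCcZ (-1)); congr isCc; apply/funext => x; rewrite mulN1r.
Qed.

Lemma isCcB phi psi : isCc phi -> isCc psi -> isCc (fun x => phi x - psi x).
Proof. by move=> p /isCcN; exact: isCcD. Qed.

Lemma isCc_max phi psi : isCc phi -> isCc psi ->
  isCc (fun x => Num.max (phi x) (psi x)).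
Proof.
move=> p q; apply: (isCc_sub2 _ p q) => [x|x -> ->]; last by rewrite maxxx.
by apply: continuous_max; [exact: p.1|exact: q.1].
Qed.

Lemma isCc_min phi psi : isCc phi -> isCc psi ->
  isCc (fun x => Num.min (phi x) (psi x)).
Proof.
move=> p q; apply: (isCc_sub2 _ p q) => [x|x -> ->]; last by rewrite minxx.
by apply: continuous_min; [exact: p.1|exact: q.1].
Qed.

Lemma isCc_min_cst phi (a : R) : 0 <= a -> isCc phi ->
  isCc (fun x => Num.min (phi x) a).
Proof.
move=> a0 p; apply: (isCc_sub _ p) => [x|x ->]; last by rewrite min_l.
by apply: continuous_min; [exact: p.1|exact: cvg_cst].
Qed.

Lemma isCc_cut phi (e : R) : 0 <= e -> isCc phi ->
  isCc (fun x => Num.max (phi x - e) 0).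
Proof.
move=> e0 p; apply: (isCc_sub _ p) => [x|x ->].
  apply: (@continuous_max R X (fun x => phi x - e) (cst 0)); last exact: cvg_cst.
  by apply: cvgB; [exact: p.1|exact: cvg_cst].
by rewrite max_r // sub0r oppr_le0.
Qed.

Lemma isCc_sum n (phi : nat -> X -> R) : (forall i, isCc (phi i)) ->
  isCc (fun x => \sum_(i < n) phi i x).
Proof.
move=> p; elim: n => [|n ih].
  by under eq_fun do rewrite big_ord0; exact: isCc_cst0.
by under eq_fun do rewrite big_ord_recr/=; exact: isCcD.
Qed.

Lemma open_gt_continuous phi a : continuous phi -> open [set x | a < phi x].
Proof.
move=> cphi; have /continuousP/(_ [set y | a < y]) := cphi.
by apply; exact: open_gt.
Qed.

Lemma closed_ge_continuous phi a : continuous phi -> closed [set x | a <= phi x].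
Proof.
move=> cphi; have /continuous_closedP/(_ [set y | a <= y]) := cphi.
by apply; exact: closed_ge.
Qed.

Lemma compact_ge_Cc phi a : 0 < a -> isCc phi -> compact [set x | a <= phi x].
Proof.
move=> a0 p; apply: subclosed_compact p.2 _.
  by apply: closed_ge_continuous; exact: p.1.
by move=> x /= ax; apply: subset_closure => /=; rewrite gt_eqF // (lt_le_trans a0).
Qed.

Lemma isCc_bounded phi : isCc phi -> exists2 M, 0 < M & forall x, `|phi x| <= M.
Proof.
move=> [cp Kp]; have := @compact_directed _ _ _ [set M : R | 0 < M]
   (fun M => [set x | `|phi x| <= M]) Kp.
case.
- by exists 1 => /=.
- move=> i j /= i0 j0; exists (Num.max i j); split => /=.
  + by rewrite lt_max i0.
  + by move=> x /= h; rewrite le_max h.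
  + by move=> x /= h; rewrite le_max h orbT.
- move=> x _; exists (`|phi x| + 1); first by rewrite /= ltr_wpDl.
  have /cvgrPdist_lt/(_ 1 ltr01) := cp x; apply: filterS => y /= pxy.
  rewrite -[phi y](subKr (phi x)) (le_trans (ler_normB _ _)) // lerD2l.
  exact: ltW.
move=> M M0 h; exists M => // x.
have [->|px] := eqVneq (phi x) 0; first by rewrite normr0 ltW.
by apply: h; exact: subset_closure.
Qed.

Hypothesis hX : hausdorff_space X.
Hypothesis lcX : locally_compact [set: X].

(** Complete regularity separates [x] from the complement of the intersection of [U] with the
    interior of a compact neighbourhood [V]; the interior forces the support into [V]. *)
Lemma urysohn_pt x U : open U -> U x ->
  exists phi, [/\ isCc phi, forall y, 0 <= phi y <= 1, phi x = 1 &
                  forall y, ~ U y -> phi y = 0].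
Proof.
move=> oU Ux; have := @lcX x I; rewrite withinET => -[V xV [cV clV]].
pose B := ~` (U `&` V°).
have clB : closed B by apply: open_closedC; apply: openI => //; exact: open_interior.
have nB : ~ B x by apply; split.
have /(@uniform_separatorP _ R)[f [cf f01 f0 f1]] :=
  locally_compact_completely_regular (R := R) lcX hX clB nB.
exists (fun y => 1 - f y); split.
- split; first by move=> y; apply: cvgB; [exact: cvg_cst|exact: cf].
  apply: subclosed_compact cV _; first exact: closed_closure.
  rewrite [X in _ `<=` X](_ : V = closure V); last by rewrite -closure_id.
  apply: closureS => y /= fy; apply: contrapT => nVy.
  have By : B y by move=> [_ /interior_subset].
  by rewrite (f1 (f y)) ?subrr ?eqxx// in fy; exists y.
- by move=> y; have /= := f01 (f y) (ex_intro2 _ _ y I erefl); rewrite in_itv/=; lra.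
- by rewrite (f0 (f x)) ?subr0//; exists x.
- by move=> y nUy; rewrite (f1 (f y)) ?subrr//; exists y => // -[].
Qed.

Lemma urysohn_Cc K U : compact K -> open U -> K `<=` U ->
  exists phi, [/\ isCc phi, forall y, 0 <= phi y <= 1,
                  forall x, K x -> phi x = 1 &
                  forall y, ~ U y -> phi y = 0].
Proof.
move=> cK oU KU.
pose D := [set phi : X -> R | [/\ isCc phi, forall y, 0 <= phi y &
                                  forall y, ~ U y -> phi y = 0]].
have := @compact_directed _ K _ D (fun phi => [set x | 1 <= phi x]) cK.
case.
- by exists (fun=> 0); split => //; exact: isCc_cst0.
- move=> p q [cp p0 pU] [cq q0 qU]; exists (fun x => Num.max (p x) (q x)).
  split; first split.
  + exact: isCc_max.
  + by move=> y; rewrite le_max p0.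
  + by move=> y Uy; rewrite pU// qU// maxxx.
  + by move=> x /=; rewrite le_max => ->.
  + by move=> x /=; rewrite le_max => ->; rewrite orbT.
- move=> x Kx; have [phi [cphi phi01 phix phiU]] := urysohn_pt oU (KU _ Kx).
  (* The factor 2 makes the bump exceed 1 on a whole neighbourhood of [x]; the final truncation at 1
     restores the range. *)
  exists (fun x => 2 * phi x).
    split; first exact: isCcZ.
    + by move=> y; rewrite mulr_ge0 //; have /andP[] := phi01 y.
    + by move=> y /phiU ->; rewrite mulr0.
  have : nbhs x [set y | 2^-1 < phi y].
    apply: open_nbhs_nbhs; split; first exact: open_gt_continuous cphi.1.
    by rewrite /= phix; lra.
  by apply: filterS => y /=; lra.
move=> phi [cphi phi0 phiU] Kphi; exists (fun x => Num.min (phi x) 1); split.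
- exact: isCc_min_cst.
- by move=> y; rewrite le_min phi0 ler01 ge_min lexx orbT.
- by move=> x /Kphi /= /min_r.
- by move=> y /phiU ->; rewrite min_l.
Qed.

End CcFunctions.

(** * The Riesz representation theorem *)

Section PositiveFunctionals.
Context {R : realType} {X : topologicalType}.
Local Open Scope ring_scope.

Definition pos_linear (L : (X -> R) -> R) : Prop :=
  [/\ forall phi psi, isCc phi -> isCc psi ->
        L (fun x => phi x + psi x) = L phi + L psi,
      forall a phi, isCc phi -> L (fun x => a * phi x) = a * L phi &
      forall phi, isCc phi -> (forall x, 0 <= phi x) -> 0 <= L phi].

Variable L : (X -> R) -> R.
Hypothesis posL : pos_linear L.

Lemma pos_linearB phi psi : isCc phi -> isCc psi ->
  L (fun x => phi x - psi x) = L phi - L psi.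
Proof.
move=> cp cq; have [LD LZ _] := posL; rewrite LD; last 2 first.
- by [].
- exact: isCcN.
congr (_ + _); rewrite -mulN1r -LZ//; congr (L _); apply/funext => x.
by rewrite mulN1r.
Qed.

Lemma pos_linear_le phi psi : isCc phi -> isCc psi ->
  (forall x, phi x <= psi x) -> L phi <= L psi.
Proof.
move=> cp cq pq; have [_ _ L0] := posL.
rewrite -subr_ge0 -pos_linearB//; apply: L0; first exact: isCcB.
by move=> x; rewrite subr_ge0.
Qed.

Lemma pos_linear0 : L (fun=> 0) = 0.
Proof.
have [_ LZ _] := posL; have := LZ 0 _ isCc_cst0.
by rewrite [RHS]mul0r => {2}<-; congr L; apply/funext => x; rewrite mul0r.
Qed.

Lemma pos_linear_sum n (phi : nat -> X -> R) : (forall i, isCc (phi i)) ->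
  L (fun x => \sum_(i < n) phi i x) = \sum_(i < n) L (phi i).
Proof.
move=> cp; have [LD _ _] := posL.
elim: n => [|n ih].
  by rewrite big_ord0 -[RHS]pos_linear0; congr L; apply/funext => x; rewrite big_ord0.
rewrite big_ord_recr/= -ih -LD//; last exact: isCc_sum.
by congr L; apply/funext => x; rewrite big_ord_recr.
Qed.

Hypothesis hX : hausdorff_space X.
Hypothesis lcX : locally_compact [set: X].

(** With [chi = 1] on the support, [phi <= max (phi - e) 0 + e chi], so cutting costs at most
    [e * L chi]. For [phi >= 0] the cut function lives on [{phi >= e}], a compact subset of any set
    off which [phi] vanishes. *)
Lemma pos_linear_cut phi t : isCc phi -> t < L phi ->
  exists2 e, 0 < e & t < L (fun x => Num.max (phi x - e) 0).
Proof.
move=> cp tL; have [LD LZ L0] := posL.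
have [chi [cchi chi01 chi1 _]] :=
  @urysohn_Cc R _ hX lcX _ _ cp.2 openT (@subsetT _ _).
have chi0 x : 0 <= chi x by have /andP[] := chi01 x.
have Lchi : 0 <= L chi by apply: L0.
(* The [+ 1] covers the case [L chi = 0]. *)
pose e := (L phi - t) / (L chi + 1) / 2.
have Lchi1 : 0 < L chi + 1 by rewrite ltr_wpDl.
have e0 : 0 < e by rewrite /e !divr_gt0// subr_gt0.
exists e => //.
have ccut := isCc_cut (ltW e0) cp.
have : L phi <= L (fun x => Num.max (phi x - e) 0) + e * L chi.
  rewrite -LZ// -LD//; last exact: isCcZ.
  apply: pos_linear_le => //; first by apply: isCcD => //; exact: isCcZ.
  move=> x; have [px|px] := eqVneq (phi x) 0.
    rewrite px; apply: addr_ge0; last by rewrite mulr_ge0// ltW.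
    by rewrite le_max lexx orbT.
  rewrite chi1 ?mulr1; last exact: subset_closure.
  by rewrite -lerBlDr le_max lexx.
have : e * L chi < L phi - t; last by lra.
have -> : e * L chi = (L phi - t) * (L chi / (L chi + 1) / 2) by rewrite /e; ring.
rewrite -[ltRHS]mulr1 ltr_pM2l ?subr_gt0//.
by rewrite ltr_pdivrMr// ltr_pdivrMr//; lra.
Qed.

End PositiveFunctionals.

Section Dini.
Context {R : realType} {X : topologicalType}.
Local Open Scope ring_scope.

(** Only points with [phi >= e] matter, since the cut vanishes elsewhere and members of [D] are
    nonnegative; these points form a compact set, on which the pointwise bounds merge by
    directedness. *)
Lemma dini_cut (D : set (X -> R)) (phi : X -> R) e : 0 < e -> isCc phi ->
  D !=set0 -> (forall d, D d -> continuous d /\ forall x, 0 <= d x) ->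
  (forall d1 d2, D d1 -> D d2 -> exists2 d, D d &
      forall x, d1 x <= d x /\ d2 x <= d x) ->
  (forall x, e <= phi x -> exists2 d, D d & phi x - e < d x) ->
  exists2 d, D d & forall x, Num.max (phi x - e) 0 <= d x.
Proof.
move=> e0 cp D0 Dc Ddir Dphi.
have [//| | |d Dd Kd] := @compact_directed _ _ _ D
  (fun d => [set x | phi x - e <= d x]) (compact_ge_Cc e0 cp).
- move=> d1 d2 D1 D2; have [d Dd h] := Ddir _ _ D1 D2.
  exists d; split => // x /= /le_trans; apply; [exact: (h x).1|exact: (h x).2].
- move=> x ex; have [d Dd dx] := Dphi x ex; exists d => //.
  have : nbhs x [set y | 0 < d y - (phi y - e)].
    apply: open_nbhs_nbhs; split; last by rewrite /= subr_gt0.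
    apply: open_gt_continuous => y; apply: cvgB; first exact: (Dc _ Dd).1.
    by apply: cvgB; [exact: cp.1|exact: cvg_cst].
  by apply: filterS => y /=; rewrite subr_gt0 => /ltW.
exists d => // x; rewrite ge_max (Dc _ Dd).2 andbT.
have [ex|ex] := leP e (phi x); first exact: Kd.
by rewrite (le_trans _ ((Dc _ Dd).2 x))// subr_le0 ltW.
Qed.

End Dini.

Section RieszOuter.
Context {R : realType} {X : ptopologicalType}.
Variable L : (X -> R) -> R.
Hypothesis posL : pos_linear L.
Hypothesis hX : hausdorff_space X.
Hypothesis lcX : locally_compact [set: X].
Implicit Types (U V E K : set X) (phi psi : X -> R).

(* The condition [phi = 0] off [U] replaces the usual [supp phi] inside [U]:
   cutting to [max (phi - e) 0] recovers the latter, and [pos_linear_cut] says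
   that this costs little. *)
Definition below (U : set X) (phi : X -> R) : Prop :=
  isCc phi /\ forall x, (0 <= phi x <= \1_U x)%R.

Lemma below_ge0 U phi x : below U phi -> (0 <= phi x)%R.
Proof. by move=> [_ /(_ x)/andP[]]. Qed.

Lemma below_le1 U phi x : below U phi -> (phi x <= 1)%R.
Proof.
move=> [_ /(_ x)/andP[_ /le_trans]]; apply.
by rewrite indicE; case: (_ \in _).
Qed.

Lemma below_out U phi x : below U phi -> ~ U x -> phi x = 0%R.
Proof.
move=> [_ /(_ x)/andP[p0]]; rewrite indicE => + Ux.
by rewrite memNset//= => p1; apply/eqP; rewrite eq_le p0 p1.
Qed.

Lemma belowP U phi : isCc phi -> (forall x, (0 <= phi x <= 1)%R) ->
  (forall x, ~ U x -> phi x = 0%R) -> below U phi.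
Proof.
move=> cp p01 pU; split => // x; rewrite indicE.
have [xU|xU] := boolP (x \in U); first exact: p01.
by rewrite pU ?lexx//= => Ux; rewrite mem_set in xU.
Qed.

Lemma below0 U : below U (fun=> 0%R).
Proof.
by apply: belowP => //; [exact: isCc_cst0|move=> x; rewrite lexx ler01].
Qed.

Definition riesz_open (U : set X) : \bar R :=
  ereal_sup [set (L phi)%:E | phi in below U].

(** Defined on every set, not only on Borel ones: this is the form of outer regularity that
    [is_radon] imposes. *)
Definition riesz (E : set X) : \bar R :=
  ereal_inf [set riesz_open U | U in [set U | open U /\ E `<=` U]].

Lemma riesz_open_ub U phi : below U phi -> (L phi)%:E <= riesz_open U.
Proof. by move=> pU; apply: ereal_sup_ubound; exists phi. Qed.

Lemma riesz_open_ge0 U : 0 <= riesz_open U.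
Proof. by have := riesz_open_ub (below0 U); rewrite (pos_linear0 posL). Qed.

Lemma riesz_open_le U V : U `<=` V -> riesz_open U <= riesz_open V.
Proof.
move=> UV; apply: ge_ereal_sup => _ [phi pU <-]; apply: riesz_open_ub.
apply: belowP pU.1 _ _ => [x|x nV]; last by rewrite (below_out pU)// => /UV.
by rewrite (below_ge0 x pU) (below_le1 x pU).
Qed.

Lemma riesz_lb E U : open U -> E `<=` U -> riesz E <= riesz_open U.
Proof. by move=> oU EU; apply: ereal_inf_lbound; exists U. Qed.

Lemma rieszE U : open U -> riesz U = riesz_open U.
Proof.
move=> oU; apply/eqP; rewrite eq_le riesz_lb//=.
by apply: le_ereal_inf_tmp => _ [V [oV UV] <-]; exact: riesz_open_le.
Qed.

Lemma riesz_ge0 E : 0 <= riesz E.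
Proof. by apply: le_ereal_inf_tmp => _ [V _ <-]; exact: riesz_open_ge0. Qed.

Lemma riesz_le A B : A `<=` B -> riesz A <= riesz B.
Proof.
move=> AB; apply: le_ereal_inf_tmp => _ [V [oV BV] <-].
by apply: riesz_lb => //; exact: subset_trans BV.
Qed.

Lemma riesz_set0 : riesz set0 = 0.
Proof.
rewrite rieszE; last exact: open0.
apply/eqP; rewrite eq_le riesz_open_ge0 andbT.
apply: ge_ereal_sup => _ [phi p0 <-].
rewrite (_ : phi = fun=> 0%R) ?(pos_linear0 posL)//.
by apply/funext => x; rewrite (below_out p0).
Qed.

(** After a cut, a function below the union is dominated by a finite sum of functions below the
    [U n]. This is Dini's argument for the family [D] of such sums, and it takes the place of a
    partition of unity. *)
Lemma riesz_open_bigcup (U : (set X)^nat) : (forall n, open (U n)) ->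
  riesz_open (\bigcup_n U n) <= \sum_(n <oo) riesz_open (U n).
Proof.
move=> oU; apply: ge_ereal_sup => _ [phi pU <-].
pose D := [set d : X -> R | exists N (psi : nat -> X -> R),
   (forall n, below (U n) (psi n)) /\ d = fun x => (\sum_(n < N) psi n x)%R].
suff h (e : R) : (0 < e)%R ->
    (L (fun x => Num.max (phi x - e) 0))%:E <= \sum_(n <oo) riesz_open (U n).
  rewrite leNgt; apply/negP => lt.
  have [t st tL] : exists2 t : R, \sum_(n <oo) riesz_open (U n) <= t%:E & (t < L phi)%R.
    move: lt; move: (\sum_(n <oo) _) (nneseries_ge0 (P:=xpredT) (N := 0%N)
      (fun n _ _ => riesz_open_ge0 (U n))) => [r||]//.
    by exists r => //; rewrite -lte_fin.
  have [e e0 te] := pos_linear_cut posL hX lcX pU.1 tL.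
  by have := le_trans (h e e0) st; rewrite lee_fin leNgt te.
move=> e0.
have [| | | |d [N [psi [Upsi ->]]] hd] := @dini_cut R X D phi e e0 pU.1.
- exists (fun=> 0%R), 0%N, (fun _ _ => 0%R); split; first by move=> n; exact: below0.
  by apply/funext => x; rewrite big_ord0.
- move=> _ [N [psi [Upsi ->]]]; split.
    by apply: (isCc_sum _ (fun i => (Upsi i).1)).1.
  by move=> x; apply: sumr_ge0 => i _; exact: below_ge0 (Upsi i).
(* Termwise maxima stay below the [U n], and since all terms are nonnegative the sum over the longer
   range dominates both given sums. *)
- move=> _ _ [N1 [psi1 [U1 ->]]] [N2 [psi2 [U2 ->]]].
  pose psi n x := Num.max (psi1 n x) (psi2 n x).
  exists (fun x => \sum_(n < maxn N1 N2) psi n x)%R.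
    exists (maxn N1 N2), psi; split => // n; apply: belowP.
    + by apply: isCc_max; [exact: (U1 n).1|exact: (U2 n).1].
    + move=> x; rewrite /psi le_max (below_ge0 x (U1 n))/= ge_max.
      by rewrite (below_le1 x (U1 n)) (below_le1 x (U2 n)).
    + by move=> x nU; rewrite /psi (below_out (U1 n))// (below_out (U2 n))// maxxx.
  have mono (N M : nat) (f g : nat -> X -> R) x : (N <= M)%N ->
      (forall n, f n x <= g n x)%R -> (forall n, 0 <= g n x)%R ->
      (\sum_(n < N) f n x <= \sum_(n < M) g n x)%R.
    move=> NM fg g0; apply: (@le_trans _ _ (\sum_(n < N) g n x)%R).
      by apply: ler_sum => i _.
    rewrite -(subnKC NM) big_split_ord/= lerDl; exact: sumr_ge0.
  have psi0 n x : (0 <= psi n x)%R by rewrite le_max (below_ge0 x (U1 n)).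
  move=> x; split; apply: mono => //; rewrite ?leq_maxl ?leq_maxr// => n.
  + by rewrite /psi le_max lexx.
  + by rewrite /psi le_max lexx orbT.
- move=> x ex; have [n _ Unx] : (\bigcup_n U n) x.
    apply: contrapT => nU; move: ex; rewrite (below_out pU nU).
    by move=> /(lt_le_trans e0); rewrite ltxx.
  have [psi [cpsi psi01 psix psiU]] := @urysohn_pt R _ hX lcX _ _ (oU n) Unx.
  pose f k := if k == n then psi else (fun=> 0%R).
  exists (fun x => \sum_(k < n.+1) f k x)%R.
    exists n.+1, f; split => // k; rewrite /f; case: eqP => [->|_]; last exact: below0.
    exact: belowP.
  rewrite big_ord_recr/= {2}/f eqxx psix.
  rewrite ltr_wpDl//; first by apply: sumr_ge0 => i _; rewrite /f ltn_eqF.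
  by rewrite ltrBlDr (le_lt_trans (below_le1 x pU))// ltrDl.
have cpsi n := (Upsi n).1.
apply: (@le_trans _ _ (\sum_(n < N) riesz_open (U n))).
  apply: (@le_trans _ _ (L (fun x => \sum_(n < N) psi n x)%R)%:E).
    rewrite lee_fin; apply: (pos_linear_le posL) => //.
    - exact: isCc_cut (ltW e0) pU.1.
    - exact: isCc_sum.
  rewrite (pos_linear_sum posL)// -sumEFin; apply: lee_sum => i _.
  exact: riesz_open_ub.
rewrite -(big_mkord xpredT (fun n => riesz_open (U n))).
by apply: nneseries_lim_ge => n _ _; exact: riesz_open_ge0.
Qed.

Lemma riesz_sigma_subadditive : sigma_subadditive riesz.
Proof.
move=> F; apply/lee_addgt0Pr => e e0.
have [[n Fn]|fin] := pselect (exists n, riesz (F n) = +oo).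
  rewrite (_ : \sum_(i <oo) riesz (F i) = +oo) ?leey//.
  apply: (@nneseries_pinfty _ _ xpredT n) => // i _; exact: riesz_ge0.
have h n : exists U, [/\ open U, F n `<=` U &
    riesz_open U <= riesz (F n) + (e / (2 ^ n.+1)%:R)%:E].
  have Ffin : riesz (F n) \is a fin_num.
    rewrite ge0_fin_numE ?riesz_ge0// ltey; apply/eqP => Fn.
    by apply: fin; exists n.
  have en0 : (0 < e / (2 ^ n.+1)%:R)%R by rewrite divr_gt0// ltr0n expn_gt0.
  have [_ [U [oU FU] <-] lt] := lb_ereal_inf_adherent en0 Ffin.
  by exists U; split => //; exact: ltW.
have [U hU] := choice h.
apply: (@le_trans _ _ (riesz_open (\bigcup_n U n))).
  apply: riesz_lb; first by apply: bigcup_open => n _; have [] := hU n.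
  by apply: subset_bigcup => n _; have [] := hU n.
apply: le_trans (riesz_open_bigcup _) _; first by move=> n; have [] := hU n.
apply: (le_trans _ (epsilon_trick xpredT (fun n => riesz_ge0 (F n)) (ltW e0))).
by apply: lee_nneseries => n _; [move=> _; exact: riesz_open_ge0|have [] := hU n].
Qed.

HB.instance Definition _ := isOuterMeasure.Build R X riesz
  riesz_set0 riesz_ge0 riesz_le riesz_sigma_subadditive.

(** For [V] open around [E], take [phi] below the part of [V] in [U], nearly optimal, and cut it at
    height [e]. The cut lives on the closed set [{phi >= e}], whose complement in [V] is an open [W]
    containing the part of [V] outside [U]. Adding to the cut any [psi] below [W] gives a function
    below [V], so the two parts add up to at most [riesz_open V]. *)
Lemma riesz_caratheodory_open U : open U -> riesz.-caratheodory U.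
Proof.
move=> oU; apply: le_caratheodory_measurable => E.
apply: le_ereal_inf_tmp => _ [V [oV EV] <-].
apply: (@le_trans _ _ (riesz_open (V `&` U) + riesz (V `&` ~` U))).
  apply: leeD; last by apply: riesz_le; exact: setSI.
  by apply: riesz_lb; [exact: openI|exact: setSI].
have [->|fin] := eqVneq (riesz_open V) +oo; first by rewrite leey.
have Vfin : riesz_open V \is a fin_num by rewrite ge0_fin_numE ?riesz_open_ge0// ltey.
have VCfin : riesz (V `&` ~` U) \is a fin_num.
  rewrite ge0_fin_numE ?riesz_ge0//; apply: le_lt_trans (riesz_lb oV _) _ => //.
  by rewrite ltey.
rewrite -leeBrDr//; apply: ge_ereal_sup => _ [phi pVU <-].
rewrite leeBrDr// -(fineK Vfin) -(fineK VCfin) -EFinD lee_fin.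
rewrite leNgt; apply/negP; rewrite -ltrBlDr => lt.
have [e e0] := pos_linear_cut posL hX lcX pVU.1 lt.
rewrite ltrBlDr -lte_fin EFinD (fineK Vfin) (fineK VCfin) ltNge => /negP; apply.
pose W := V `&` ~` [set x | e <= phi x]%R.
have oW : open W.
  apply: openI => //; apply: closed_openC; exact: closed_ge_continuous pVU.1.1.
apply: (@le_trans _ _ ((L (fun x => Num.max (phi x - e) 0)%R)%:E + riesz_open W)).
  rewrite leeD2l//; apply: riesz_lb => // x [Vx nUx]; split => //=.
  by rewrite (below_out pVU) ?leNgt ?e0// => -[].
have Wfin : riesz_open W \is a fin_num.
  rewrite ge0_fin_numE ?riesz_open_ge0//.
  by apply: le_lt_trans (riesz_open_le _) _; [move=> x [Vx _]; exact: Vx|rewrite ltey].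
rewrite -leeBrDl//; apply: ge_ereal_sup => _ [psi pW <-].
rewrite leeBrDl// -EFinD; have [LD _ _] := posL.
have cc := isCc_cut (ltW e0) pVU.1.
rewrite -LD//; last exact: pW.1.
apply: riesz_open_ub; apply: belowP.
- by apply: isCcD => //; exact: pW.1.
- move=> x; rewrite addr_ge0 ?(below_ge0 x pW) ?le_max ?lexx ?orbT//=.
  have [ex|ex] := leP e (phi x).
    rewrite (below_out pW) ?addr0; last by move=> [_]; exact.
    rewrite ge_max ler01 andbT lerBlDr (le_trans (below_le1 x pVU))// lerDl.
    exact: ltW.
  by rewrite max_r ?subr_le0 ?(ltW ex)// add0r (below_le1 x pW).
- move=> x nV; rewrite (below_out pVU); last by move=> [].
  by rewrite (below_out pW) ?addr0; [rewrite max_r// sub0r oppr_le0 ltW|move=> []].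
Qed.

(** The Caratheodory sets form a sigma-algebra that contains the open sets, hence all Borel sets. *)
Lemma riesz_semi_sigma_additive :
  semi_sigma_additive (riesz : set (borel X) -> \bar R).
Proof.
have sub (A : set (borel X)) : measurable A -> riesz.-caratheodory A.
  apply: (@smallest_sub _ (sigma_algebra setT)).
    exact: (sigma_algebra_measurable (caratheodory_type riesz)).
  by move=> U; exact: riesz_caratheodory_open.
move=> A mA tA mUA; apply: (caratheodory_measure_sigma_additive (mu := riesz)) => //.
- by move=> n; exact: sub.
- exact: sub.
Qed.

Lemma riesz0 : (riesz : set (borel X) -> \bar R) set0 = 0.
Proof. exact: riesz_set0. Qed.

(** An alias that carries the structure of a Borel measure, [riesz] itself carrying that of an outer
    measure. *)
Definition riesz_measure : set (borel X) -> \bar R := riesz.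

HB.instance Definition _ := isMeasure.Build _ (borel X) R riesz_measure
  riesz0 riesz_ge0 riesz_semi_sigma_additive.

Lemma riesz_compact_lty K : compact K -> riesz K < +oo.
Proof.
move=> cK; have [chi [cchi chi01 chi1 _]] :=
  @urysohn_Cc R _ hX lcX _ _ cK openT (@subsetT _ _).
have [_ LZ L0] := posL.
(* On this open neighbourhood of [K] every function with values at most 1 is dominated by
   [2 chi]. *)
apply: (@le_lt_trans _ _ (riesz_open [set x | 2^-1 < chi x]%R)).
  apply: riesz_lb; first exact: open_gt_continuous cchi.1.
  by move=> x /chi1 /= ->; lra.
apply: (@le_lt_trans _ _ (2 * L chi)%:E); last exact: ltry.
apply: ge_ereal_sup => _ [phi pU <-]; rewrite lee_fin -LZ//.
apply: (pos_linear_le posL); [exact: pU.1|exact: isCcZ|move=> x].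
have [h|h] := ltP 2^-1%R (chi x); first by have := below_le1 x pU; lra.
rewrite (below_out pU)//=; last by move=> h'; move: h; rewrite leNgt h'.
by rewrite mulr_ge0//; have /andP[] := chi01 x.
Qed.

Lemma riesz_is_radon : is_radon (riesz_measure : {measure set (borel X) -> \bar R}).
Proof.
split.
- exact: riesz_compact_lty.
- move=> E; congr ereal_inf; apply/seteqP; split => _ [U [oU EU] <-].
    by exists U => //; exact: rieszE.
  by exists U => //; rewrite -rieszE.
- move=> U oU; apply/eqP; rewrite eq_le; apply/andP; split; last first.
    by apply: ge_ereal_sup => _ [K [_ KU] <-]; exact: riesz_le.
  rewrite [leLHS]rieszE//; apply: ge_ereal_sup => _ [phi pU <-].
  rewrite leNgt; apply/negP => lt.
  set s := ereal_sup _ in lt.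
  have s0 : 0 <= s.
    apply: ereal_sup_ubound; exists set0; last exact: riesz_set0.
    by split; [exact: compact0|exact: sub0set].
  have sfin : s \is a fin_num by rewrite ge0_fin_numE// (lt_le_trans lt)// leey.
  move: lt; rewrite -(fineK sfin) lte_fin => lt.
  have [e e0] := pos_linear_cut posL hX lcX pU.1 lt.
  apply/negP; rewrite -leNgt -lee_fin (fineK sfin).
  (* The cut of [phi] is below every open set containing the compact set [{phi >= e}], so this set
     has at least the value of [L] on the cut. *)
  apply: (@le_trans _ _ (riesz [set x | e <= phi x]%R)); last first.
    apply: ereal_sup_ubound; exists [set x | e <= phi x]%R => //; split.
      exact: compact_ge_Cc pU.1.
    move=> x /= ex; apply: contrapT => /(below_out pU) px.
    by move: ex; rewrite px leNgt e0.
  apply: le_ereal_inf_tmp => _ [V [oV KV] <-]; apply: riesz_open_ub.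
  apply: belowP; first exact: isCc_cut (ltW e0) pU.1.
    move=> x; rewrite le_max lexx orbT ge_max ler01 andbT lerBlDr.
    by rewrite (le_trans (below_le1 x pU))// lerDl ltW.
  by move=> x nVx; rewrite max_r// subr_le0; apply/ltW; rewrite ltNge; apply/negP => /KV.
Qed.

Definition riesz_radon : radon R X := Radon riesz_is_radon.

End RieszOuter.

(** * Borel measurability of semicontinuous functions *)

Section BorelSemicontinuity.
Context {R : realType} {X : ptopologicalType}.

Lemma borel_open (U : set X) : open U -> measurable (U : set (borel X)).
Proof. by move=> oU; apply: sub_sigma_algebra. Qed.

Lemma borel_closed (U : set X) : closed U -> measurable (U : set (borel X)).
Proof.
move=> cU; rewrite -[U]setCK; apply: measurableC; apply: borel_open.
exact: closed_openC.
Qed.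

Lemma lsc_measurable (g : X -> \bar R) :
  lower_semicontinuous g -> measurable_fun [set: borel X] g.
Proof.
move=> lg; apply: (measurability _ (ErealGenOInfty.measurableE R)).
move=> /= _ [_ [a ->]] <-; apply: measurableI => //; apply: borel_open.
by rewrite preimage_itvoy; move/lower_semicontinuousP : lg; exact.
Qed.

Lemma continuous_lsc (phi : X -> R) :
  continuous phi -> lower_semicontinuous (fun x => (phi x)%:E).
Proof.
move=> cphi; apply/lower_semicontinuousP => a.
rewrite (_ : [set x | _] = [set x | a < phi x]%R); last first.
  by apply/seteqP; split => x /=; rewrite lte_fin.
exact: open_gt_continuous.
Qed.

Lemma continuous_borel (phi : X -> R) : continuous phi ->
  measurable_fun [set: borel X] phi.
Proof. by move=> /continuous_lsc/lsc_measurable/measurable_EFinP. Qed.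

Lemma usc_measurable (h : X -> \bar R) :
  upper_semicontinuous h -> measurable_fun [set: borel X] h.
Proof.
move=> /lsc_measurable mh.
rewrite (_ : h = (fun x => - - h x)); last by apply/funext => x; rewrite oppeK.
by apply: measurableT_comp mh; exact: oppe_measurable.
Qed.

End BorelSemicontinuity.

Section IntegralMonotone.
Context d (T : measurableType d) {R : realType} (mu : {measure set T -> \bar R}).

(* No measurability is assumed: both integrals are suprema over the simple
   functions below the integrand. *)
Lemma ge0_integral_le (f g : T -> \bar R) :
  (forall x, 0 <= f x) -> (forall x, f x <= g x) ->
  \int[mu]_x f x <= \int[mu]_x g x.
Proof.
move=> f0 fg; have g0 x : 0 <= g x by exact: le_trans (fg x).
rewrite !ge0_integralTE//; apply: ereal_sup_le => /=.
by move=> _ [h hf <-]; exists h => // x; exact: le_trans (fg x).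
Qed.

End IntegralMonotone.

(** * Radon measures as positive functionals *)

Section RadonBasics.
Context {R : realType} {X : ptopologicalType}.
Hypothesis hX : hausdorff_space X.
Hypothesis lcX : locally_compact [set: X].
Implicit Types (nu : radon R X) (phi psi : X -> R) (K U : set X).

Lemma borel_compact K : compact K -> measurable (K : set (borel X)).
Proof. by move=> cK; apply: borel_closed; exact: compact_closed. Qed.

Lemma radon_compact nu K : compact K -> nu K < +oo.
Proof. by have [+ _ _] := radonP nu; exact. Qed.

Lemma radon_outer nu (E : set X) :
  nu E = ereal_inf [set nu U | U in [set U : set X | open U /\ E `<=` U]].
Proof. by have [_ + _] := radonP nu; exact. Qed.

Lemma radon_inner nu U : open U ->
  nu U = ereal_sup [set nu K | K in [set K : set X | compact K /\ K `<=` U]].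
Proof. by have [_ _] := radonP nu; exact. Qed.

Lemma radon_le nu (A B : set X) : A `<=` B -> nu A <= nu B.
Proof.
move=> AB; rewrite (radon_outer nu A) (radon_outer nu B).
apply: le_ereal_inf_tmp => _ [U [oU BU] <-]; apply: ereal_inf_lbound.
by exists U => //; split => //; exact: subset_trans BU.
Qed.

Lemma Cc_integrable nu phi : isCc phi -> nu.-integrable setT (EFin \o phi).
Proof.
move=> cp; have [M M0 pM] := isCc_bounded cp.
set K := closure [set x | phi x != 0%R].
have mK : measurable (K : set (borel X)) by exact: borel_compact cp.2.
apply: (@le_integrable _ (borel X) R nu setT measurableT (EFin \o phi)
  (fun x => (M * \1_K x)%:E)).
- by apply/measurable_EFinP; exact: continuous_borel cp.1.
- move=> x _ /=; rewrite lee_fin normrM (gtr0_norm M0) indicE.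
  have [px|px] := eqVneq (phi x) 0%R; first by rewrite px normr0 mulr_ge0// ltW.
  by rewrite mem_set ?normr1 ?mulr1//; exact: subset_closure.
- under eq_fun do rewrite EFinM.
  apply: integrableZl => //; apply/integrableP; split.
    by apply/measurable_EFinP; exact: measurable_indic.
  under eq_integral do rewrite gee0_abs//.
  by rewrite integral_indic// setIT; exact: radon_compact cp.2.
Qed.

Lemma EFin_int nu phi : isCc phi ->
  (\int[nu]_x phi x)%R%:E = \int[nu]_x (phi x)%:E.
Proof.
by move=> cp; rewrite /Rintegral fineK//; apply: integrable_fin_num => //; exact: Cc_integrable.
Qed.

Lemma int_pos_linear nu : pos_linear (fun phi => \int[nu]_x phi x)%R.
Proof.
split.
- by move=> phi psi cp cq; rewrite RintegralD//; exact: Cc_integrable.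
- by move=> a phi cp; rewrite RintegralZl//; exact: Cc_integrable.
- by move=> phi cp p0; apply: Rintegral_ge0.
Qed.

(* A functional [L] and its representing measure [m] bracket each other on
   the layers of a nonnegative function; both [int_m] and [L] satisfy this. *)
Definition sandwich (L : (X -> R) -> R) (m : set X -> \bar R) : Prop :=
  forall U phi, open U -> isCc phi -> (forall x, 0 <= phi x <= 1)%R ->
    ((forall x, ~ U x -> phi x = 0%R) -> (L phi)%:E <= m U) /\
    ((forall x, U x -> phi x = 1%R) -> m U <= (L phi)%:E).

Lemma sandwich_int nu : sandwich (fun phi => \int[nu]_x phi x)%R nu.
Proof.
move=> U phi oU cp p01; rewrite EFin_int//.
have mU : measurable (U : set (borel X)) by exact: borel_open.
have -> : nu U = \int[nu]_x (\1_U x)%:E by rewrite integral_indic// setIT.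
split => h; apply: ge0_integral_le => x; rewrite ?lee_fin//.
- by have /andP[] := p01 x.
- rewrite indicE; have [xU|xU] := boolP (x \in U); first by have /andP[] := p01 x.
  by rewrite h ?lexx// => Ux; rewrite mem_set in xU.
- rewrite indicE; have [xU|xU] := boolP (x \in U).
    by rewrite h//; exact: set_mem.
  by have /andP[] := p01 x.
Qed.

Lemma sandwich_riesz L : pos_linear L -> sandwich L (riesz_measure L).
Proof.
move=> posL U phi oU cp p01; rewrite /riesz_measure rieszE//; split => h.
  by apply: riesz_open_ub; exact: belowP.
apply: ge_ereal_sup => _ [psi pU <-]; rewrite lee_fin.
apply: (pos_linear_le posL) => //; first exact: pU.1.
move=> x; have [Ux|nUx] := pselect (U x); first by rewrite h// (below_le1 x pU).
by rewrite (below_out pU)//; have /andP[] := p01 x.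
Qed.

(** The horizontal slice of [phi] between heights [j e] and [(j+1) e], rescaled to [[0,1]]: it lies
    between the indicators of [{phi > (j+1) e}] and [{phi > j e}], which is the situation of
    [sandwich]. *)
Definition layer (e : R) (phi : X -> R) (j : nat) (x : X) : R :=
  (e^-1 * Num.min (Num.max (phi x - j%:R * e) 0) e)%R.

Lemma layerE e phi j : (0 < e)%R -> isCc phi ->
  [/\ isCc (layer e phi j), (forall x, 0 <= layer e phi j x <= 1)%R,
      (forall x, ~ (j%:R * e < phi x)%R -> layer e phi j x = 0%R) &
      (forall x, (j.+1%:R * e < phi x)%R -> layer e phi j x = 1%R)].
Proof.
move=> e0 cp; have je : (0 <= j%:R * e)%R by rewrite mulr_ge0// ltW.
split.
- by apply: isCcZ; apply: isCc_min_cst; [exact: ltW|exact: isCc_cut].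
- move=> x; apply/andP; split.
    by rewrite mulr_ge0 ?invr_ge0 ?(ltW e0)// le_min le_max lexx orbT ltW.
  by rewrite /layer mulrC ler_pdivrMr// mul1r ge_min lexx orbT.
- move=> x /negP; rewrite -leNgt => px; rewrite /layer max_r ?subr_le0//.
  by rewrite min_l ?mulr0// ltW.
- move=> x; rewrite -natr1 mulrDl mul1r => px; rewrite /layer min_r.
    by rewrite mulVf// gt_eqF.
  by rewrite le_max lerBrDl ltW.
Qed.

Lemma sum_layer e phi N x : (0 < e)%R -> (0 <= phi x)%R ->
  (\sum_(j < N) e * layer e phi j x)%R = Num.min (phi x) (N%:R * e)%R.
Proof.
move=> e0 p0; elim: N => [|N ih]; first by rewrite big_ord0 mul0r min_r.
rewrite big_ord_recr/= ih /layer mulrA divff ?mul1r ?gt_eqF//.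
rewrite -natr1 mulrDl mul1r.
have [h|h] := leP (phi x) (N%:R * e)%R.
  rewrite max_r ?subr_le0// min_l ?(ltW e0)// addr0 min_l//.
  by rewrite (le_trans h)// lerDl ltW.
rewrite max_l ?subr_ge0 ?(ltW h)//.
by rewrite addr_minr addrC subrK.
Qed.

(* Both values lie between [e * sum_j m(phi > (j+1)e)] and
   [e * sum_j m(phi > je)], and these differ by at most [e * m(phi > 0)]. *)
Lemma sandwich_uniq L1 L2 m phi : pos_linear L1 -> pos_linear L2 ->
  sandwich L1 m -> sandwich L2 m -> isCc phi -> (forall x, 0 <= phi x)%R ->
  L1 phi = L2 phi.
Proof.
move=> p1 p2 s1 s2 cp p0.
have [chi [cchi chi01 chi1 _]] :=
  @urysohn_Cc R _ hX lcX _ _ cp.2 openT (@subsetT _ _).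
have [M M0 pM] := isCc_bounded cp.
have oU (a : R) : open [set x | a < phi x]%R by exact: open_gt_continuous cp.1.
have m0 (a : R) : 0 <= m [set x | a < phi x]%R.
  have [+ _] := s1 _ (fun=> 0%R) (oU a) isCc_cst0 (fun=> ltac:(rewrite lexx ler01; exact)).
  by rewrite (pos_linear0 p1); apply.
have mfin (a : R) : (0 <= a)%R -> m [set x | a < phi x]%R \is a fin_num.
  move=> a0; rewrite ge0_fin_numE//.
  have [_ h] := s1 _ chi (oU a) cchi chi01; apply: le_lt_trans (h _) (ltry _).
  by move=> x /= ax; apply: chi1; apply: subset_closure => /=; rewrite gt_eqF// (le_lt_trans a0).
suff h (e : R) : (0 < e)%R ->
    (`|L1 phi - L2 phi| <= e * fine (m [set x | 0 < phi x]))%R.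
  apply/eqP; rewrite -subr_eq0 -normr_le0.
  set c := fine _ in h; have c0 : (0 <= c)%R by apply: fine_ge0.
  apply/ler_addgt0Pr => e e0; rewrite add0r.
  apply: (le_trans (h (e / (c + 1))%R _)); first by rewrite divr_gt0// ltr_wpDl.
  rewrite mulrAC ler_pdivrMr ?ltr_wpDl// ler_pM2l// lerDl//.
move=> e0; pose F j := fine (m [set x | j%:R * e < phi x]%R).
have F0 j : (0 <= F j)%R by apply: fine_ge0.
have Fbd L j : sandwich L m -> (F j.+1 <= L (layer e phi j) <= F j)%R.
  move=> s; have [cl l01 l0 l1] := layerE j e0 cp.
  have je k : (0 <= k%:R * e)%R by rewrite mulr_ge0// ltW.
  have [+ _] := s _ _ (oU (j%:R * e)%R) cl l01.
  have [_ +] := s _ _ (oU (j.+1%:R * e)%R) cl l01.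
  move=> /(_ l1) + /(_ l0).
  rewrite -(fineK (mfin _ (je j))) -(fineK (mfin _ (je j.+1))) !lee_fin => a b.
  by apply/andP.
pose N := Num.bound (M / e).
have NM : (M <= N%:R * e)%R.
  by rewrite -ler_pdivrMr//; apply/ltW/archi_boundP; rewrite divr_ge0// ltW.
have dec L : pos_linear L -> L phi = (\sum_(j < N) e * L (layer e phi j))%R.
  move=> p; have cl j : isCc (layer e phi j) by have [] := layerE j e0 cp.
  have [_ LZ _] := p.
  under eq_bigr do rewrite -LZ//.
  rewrite -(@pos_linear_sum R X L p N (fun j x => e * layer e phi j x)%R); last first.
    by move=> i; exact: isCcZ.
  congr L; apply/funext => x; rewrite sum_layer// min_l//.
  by apply: le_trans NM; apply: le_trans (pM x); exact: ler_norm.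
rewrite (dec _ p1) (dec _ p2) -sumrB.
under eq_bigr do rewrite -mulrBr.
rewrite -mulr_sumr normrM gtr0_norm// ler_pM2l//.
have -> : fine (m [set x | 0 < phi x]%R) = F 0%N by rewrite /F mul0r.
apply: (@le_trans _ _ (F 0%N - F N)%R); last by rewrite lerBlDr lerDl.
elim: {dec NM} N => [|N ih]; first by rewrite big_ord0 normr0 subrr.
rewrite big_ord_recr/= (le_trans (ler_normD _ _))//.
have := Fbd L1 N s1; have := Fbd L2 N s2.
move: ih; move: (L1 _) (L2 _) `|_ : R|%R => a b n; case: (ler0P (a - b)%R); lra.
Qed.

(** On nonnegative functions, [L] and integration against its Riesz measure are both sandwiched by
    the same set function, so they agree; the general case follows by splitting into positive and
    negative parts. *)
Lemma riesz_representation L : pos_linear L ->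
  exists nu : radon R X, forall phi, isCc phi -> (\int[nu]_x phi x)%R = L phi.
Proof.
move=> posL; exists (riesz_radon posL hX lcX) => phi cp.
set nu := riesz_radon _ _ _; have pnu := int_pos_linear nu.
have eqL psi : isCc psi -> (forall x, 0 <= psi x)%R -> (\int[nu]_x psi x)%R = L psi.
  move=> cq q0; apply: (sandwich_uniq pnu posL (sandwich_int nu) _ cq q0).
  exact: sandwich_riesz.
pose p x := Num.max (phi x) 0%R; pose n x := Num.max (- phi x)%R 0%R.
have cP : isCc p by apply: isCc_max => //; exact: isCc_cst0.
have cN : isCc n by apply: isCc_max; [exact: isCcN|exact: isCc_cst0].
have -> : phi = (fun x => p x - n x)%R.
  apply/funext => x; rewrite /p /n; case: (leP 0%R (phi x)) => h.
    by rewrite max_r ?subr0// oppr_le0.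
  by rewrite max_l ?sub0r ?opprK// oppr_ge0 ltW.
rewrite (pos_linearB posL)//.
transitivity ((\int[nu]_x p x)%R - (\int[nu]_x n x)%R)%R.
  exact: (pos_linearB pnu cP cN).
by rewrite !eqL// => x; rewrite le_max lexx orbT.
Qed.

End RadonBasics.

(** * Integrals of semicontinuous functions *)

Section SemicontinuousIntegrals.
Context {R : realType} {X : ptopologicalType}.
Hypothesis hX : hausdorff_space X.
Hypothesis lcX : locally_compact [set: X].
Implicit Types (nu : radon R X) (phi psi : X -> R) (K U : set X)
  (g h : X -> \bar R).

Definition minor g phi : Prop :=
  isCc phi /\ forall x, (0 <= phi x)%R /\ (phi x)%:E <= g x.

Lemma minor_ge0 g phi x : minor g phi -> (0 <= phi x)%R.
Proof. by move=> [_ /(_ x)[]]. Qed.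

Lemma minor_le g phi x : minor g phi -> (phi x)%:E <= g x.
Proof. by move=> [_ /(_ x)[]]. Qed.

Lemma radon_open_below nu U : open U ->
  nu U = ereal_sup [set \int[nu]_x (phi x)%:E | phi in below U].
Proof.
move=> oU; apply/eqP; rewrite eq_le; apply/andP; split.
  rewrite radon_inner//; apply: ge_ereal_sup => _ [K [cK KU] <-].
  have [phi [cp p01 pK pU]] := @urysohn_Cc R _ hX lcX _ _ cK oU KU.
  apply: (@le_trans _ _ (\int[nu]_x (phi x)%:E)).
    rewrite -[K in leLHS]setIT -integral_indic//; last exact: borel_compact.
    apply: ge0_integral_le => x; rewrite lee_fin// indicE.
    have [xK|_] := boolP (x \in K); first by rewrite pK//; exact: set_mem.
    by have /andP[] := p01 x.
  by apply: ereal_sup_ubound; exists phi => //; exact: belowP.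
apply: ge_ereal_sup => _ [phi pU <-]; rewrite -EFin_int//; last exact: pU.1.
have p01 x : (0 <= phi x <= 1)%R by rewrite (below_ge0 x pU) (below_le1 x pU).
have [+ _] := sandwich_int hX nu oU pU.1 p01; apply.
by move=> x; exact: below_out pU.
Qed.

(** Induction that moves one indicator after another into [phi]: [nu (U j)] is the supremum of the
    integrals of functions [psi] below [U j], and replacing [e * 1_(U j)] by [e * psi] keeps the sum
    below [g]. The general [phi] carries what has been moved. *)
Lemma radon_layers_le nu g (U : nat -> set X) (e : R) N phi :
  (forall x, 0 <= g x) -> (forall j, open (U j)) -> (0 < e)%R -> isCc phi ->
  (forall x, 0 <= phi x)%R ->
  (forall x, (phi x + \sum_(j < N) e * \1_(U j) x)%:E <= g x) ->
  \int[nu]_x (phi x)%:E + \sum_(j < N) e%:E * nu (U j) <=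
  ereal_sup [set \int[nu]_x (psi x)%:E | psi in minor g].
Proof.
move=> g0 oU e0; elim: N phi => [|N ih] phi cp p0 hg.
  rewrite big_ord0 adde0; apply: ereal_sup_ubound; exists phi => //; split => // x.
  by split => //; have := hg x; rewrite big_ord0 addr0.
rewrite big_ord_recr/= addeA; set S := ereal_sup _; set a := (X in X + _).
have aS : a <= S.
  apply: (ih phi) => // x; apply: le_trans (hg x); rewrite lee_fin lerD2l.
  by rewrite big_ord_recr/= lerDl mulr_ge0// ltW.
have a0 : 0 <= a.
  rewrite adde_ge0 ?integral_ge0//; first by move=> x _; rewrite lee_fin.
  by apply: sume_ge0 => i _; rewrite mule_ge0// lee_fin ltW.
have [->|Sfin] := eqVneq S +oo; first by rewrite leey.
have fS : S \is a fin_num by rewrite ge0_fin_numE ?ltey// (le_trans a0).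
have fa : a \is a fin_num by rewrite ge0_fin_numE// (le_lt_trans aS)// ltey.
rewrite -leeBrDl// -lee_pdivlMl// radon_open_below//.
apply: ge_ereal_sup => _ [psi pU <-]; rewrite lee_pdivlMl// leeBrDl//.
have psi0 x : (0 <= psi x)%R := below_ge0 x pU.
have mc f : isCc f -> measurable_fun [set: borel X] (fun x => (f x)%:E).
  by move=> cf; apply/measurable_EFinP; exact: continuous_borel cf.1.
have ce : isCc (fun x => e * psi x)%R by apply: isCcZ; exact: pU.1.
rewrite /a addeAC -ge0_integralZl//; last 3 first.
- exact: mc pU.1.
- by move=> x _; rewrite lee_fin.
- by rewrite lee_fin ltW.
rewrite -ge0_integralD//; last 4 first.
- by move=> x _; rewrite lee_fin.
- exact: mc.
- by move=> x _; rewrite -EFinM lee_fin mulr_ge0// ltW.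
- exact: mc.
apply: (ih (fun x => phi x + e * psi x)%R) => [|x|x].
- exact: isCcD.
- by rewrite addr_ge0// mulr_ge0// ltW.
- apply: le_trans (hg x); rewrite lee_fin big_ord_recr/= -addrA lerD2l.
  rewrite addrC lerD2l ler_pM2l//; have [_ /(_ x)/andP[]] := pU; exact.
Qed.

(** Counting the thresholds [(j+1) e] below [s] and multiplying by [e] undershoots [s] by at most
    [e], as long as [s] does not exceed [(N+1) e]. *)
Lemma layers_ge (s e : R) N : (0 <= s)%R -> (0 < e)%R ->
  (Num.min s (N.+1%:R * e) <=
   \sum_(j < N) e * (j.+1%:R * e < s)%R%:R + e)%R.
Proof.
move=> s0 e0; elim: N => [|N ih]; first by rewrite big_ord0 mul1r add0r ge_min lexx orbT.
rewrite big_ord_recr/= addrAC.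
have [h|h] := ltP (N.+1%:R * e)%R s.
  rewrite mulr1 (@le_trans _ _ (Num.min s (N.+1%:R * e) + e)%R)//; last by rewrite lerD2r.
  rewrite [X in (_ <= X + _)%R]min_r ?(ltW h)// ge_min; apply/orP; right.
  by rewrite -[in leLHS]natr1 mulrDl mul1r.
rewrite mulr0 addr0; apply: le_trans ih; rewrite (min_l h).
by rewrite ge_min lexx.
Qed.

(** The right side is Bourbaki's integral of [g]. A simple function [s <= g], restricted to where
    [g] exceeds [1/(n+1)], is discretized in layers of thickness [e]; these are dominated by layers
    of [g], to which [radon_layers_le] applies. The error [e] is paid only on a set of finite
    measure, and monotone convergence in [n] recovers [s]. *)
Lemma integral_lsc nu g : (forall x, 0 <= g x) -> lower_semicontinuous g ->
  \int[nu]_x g x = ereal_sup [set \int[nu]_x (phi x)%:E | phi in minor g].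
Proof.
move=> g0 lg; apply/eqP; rewrite eq_le; apply/andP; split; last first.
  apply: ge_ereal_sup => _ [phi mp <-]; apply: ge0_integral_le => x.
    by rewrite lee_fin (minor_ge0 x mp).
  exact: minor_le mp.
set S := ereal_sup _.
have oU (a : R) : open [set x | a%:E < g x] by move/lower_semicontinuousP : lg; exact.
have layers (e : R) N : (0 < e)%R ->
    \sum_(j < N) e%:E * nu [set x | (j.+1%:R * e)%:E < g x] <= S.
  move=> e0; have := @radon_layers_le nu g (fun j => [set x | (j.+1%:R * e)%:E < g x])
    e N (fun=> 0%R) g0 (fun j => oU _) e0 isCc_cst0 (fun=> lexx _).
  rewrite integral0 add0e; apply => x; rewrite add0r.
  elim: N => [|N ih]; first by rewrite big_ord0.
  rewrite big_ord_recr/= [X in (_ + e * X)%R]indicE.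
  have [xU|xU] := boolP (_ \in _); last by rewrite mulr0 addr0.
  apply: le_trans (ltW (set_mem xU)); rewrite lee_fin mulr1 -natr1 mulrDl mul1r lerD2r.
  rewrite (@le_trans _ _ (\sum_(j < N) e)%R)//; last first.
    by rewrite big_const_ord iter_addr addr0 mulr_natl.
  by apply: ler_sum => i _; rewrite ler_piMr ?(ltW e0)// indicE; case: (_ \in _).
have S0 : 0 <= S.
  by have := layers 1%R 0%N ltr01; rewrite big_ord0.
have [->|Soo] := eqVneq S +oo; first by rewrite leey.
rewrite ge0_integralTE//; apply: ge_ereal_sup => _ [s /= sg <-].
rewrite -integralT_nnsfun.
have s0 x : (0 <= s x)%R by exact: fun_ge0.
pose A n : set (borel X) := [set x : X | (n.+1%:R^-1)%:E < g x].
have mA n : measurable (A n) by apply: borel_open; exact: oU.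
pose sn n x := (s x)%:E * (\1_(A n) x)%:E.
have msn n : measurable_fun [set: borel X] (sn n).
  apply: emeasurable_funM; apply/measurable_EFinP; first exact: measurable_funPT.
  exact: measurable_indic.
have sn0 n x : 0 <= sn n x by rewrite mule_ge0// lee_fin.
have snE : (fun x => limn (sn^~ x)) = (fun x => (s x)%:E).
  apply/funext => x; apply/cvg_lim => //.
  have [gx|gx] := eqVneq (g x) 0.
    have sx : s x = 0%R.
      by apply/eqP; rewrite eq_le s0 andbT; have := sg x; rewrite gx lee_fin.
    by rewrite sx; under eq_fun do rewrite /sn sx mul0e; exact: cvg_cst.
  have [k kg] : exists k, (k.+1%:R^-1)%:E < g x.
    have : 0 < g x by rewrite lt0e gx g0.
    case: (g x) => [r||//]; last by exists 0%N; exact: ltry.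
    rewrite lte_fin => r0; exists (Num.bound r^-1); rewrite lte_fin.
    rewrite invf_plt ?posrE//; apply: lt_trans (archi_boundP _) _.
      by rewrite invr_ge0 ltW.
    by rewrite ltr_nat.
  apply: cvg_near_cst; exists k => // n /= kn.
  rewrite /sn indicE mem_set ?mule1//=; apply: le_lt_trans kg.
  by rewrite lee_fin lef_pV2 ?posrE// ler_nat.
rewrite (_ : \int[nu]_x (s x)%:E = \int[nu]_x (fun x => limn (sn^~ x)) x); last first.
  by rewrite snE.
rewrite (@monotone_convergence _ (borel X) R nu setT measurableT sn)//; last first.
  move=> x _ m n mn; rewrite /sn lee_pmul ?lee_fin// !indicE ler_nat.
  have [xm|//] := boolP (x \in A m); rewrite mem_set//=.
  apply: le_lt_trans (set_mem xm); rewrite lee_fin lef_pV2 ?posrE// ler_nat//.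
apply: lime_le.
  apply: ereal_nondecreasing_is_cvgn => m n mn; apply: ge0_integral_le => // x.
  rewrite /sn lee_pmul ?lee_fin// !indicE ler_nat.
  have [xm|//] := boolP (x \in A m); rewrite mem_set//=.
  by apply: le_lt_trans (set_mem xm); rewrite lee_fin lef_pV2 ?posrE// ler_nat.
apply: nearW => n.
(* A single layer of height [1/(n+1)] already contributes [nu (A n) / (n+1)] to a sum bounded by the
   finite [S]. *)
have Afin : nu (A n) \is a fin_num.
  rewrite ge0_fin_numE// ltey; apply/eqP => An; move/eqP: Soo; apply.
  apply/eqP; rewrite -leye_eq.
  have := layers (n.+1%:R^-1)%R 1%N; rewrite big_ord1 mul1r An.
  by rewrite mulry gtr0_sg ?invr_gt0// mul1e; apply.
have [M sM] : exists M : R, forall x, (s x <= M)%R.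
  have [M [_ /(_ (M + 1)%R)]] := simple_bounded s.
  rewrite ltrDl ltr01 => /(_ isT) sM; exists (M + 1)%R => x.
  by apply: le_trans (sM x I); exact: ler_norm.
apply/lee_addgt0Pr => eta eta0.
pose a := fine (nu (A n)); have a0 : (0 <= a)%R by apply: fine_ge0.
pose e := (eta / (a + 1))%R; have e0 : (0 < e)%R by rewrite divr_gt0// ltr_wpDl.
pose N := Num.bound (M / e).
pose U j : set (borel X) := [set x : X | (j.+1%:R * e)%:E < g x].
have mU j : measurable (U j) by apply: borel_open; exact: oU.
apply: (@le_trans _ _ (\int[nu]_x (\sum_(j < N) (e * \1_(U j) x)%:E + (e * \1_(A n) x)%:E))).
  apply: ge0_integral_le => // x; rewrite /sn -EFinM sumEFin -EFinD lee_fin.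
  rewrite [X in (s x * X)%R]indicE [X in (_ + e * X)%R]indicE.
  have [_|_] := boolP (x \in A n); last first.
    by rewrite !mulr0 addr0; apply: sumr_ge0 => j _; rewrite mulr_ge0// ltW.
  rewrite !mulr1; apply: (@le_trans _ _ (Num.min (s x) (N.+1%:R * e))%R); last first.
    apply: le_trans (@layers_ge (s x) e N (s0 x) e0) _.
    rewrite lerD2r; apply: ler_sum => j _; rewrite ler_pM2l// ler_nat.
    have [h|//] := ltP (j.+1%:R * e)%R (s x).
    by rewrite mem_set//=; apply: lt_le_trans (sg x); rewrite lte_fin.
  rewrite min_l//; apply: le_trans (sM x) _.
  rewrite -ler_pdivrMr//; apply/ltW; apply: lt_trans (archi_boundP _) _.
    by rewrite divr_ge0 ?(ltW e0)// (le_trans (s0 point))// sM.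
  by rewrite ltr_nat.
have mEi (c : R) (B : set (borel X)) : measurable B ->
    measurable_fun [set: borel X] (fun x => (c * \1_B x)%:E).
  move=> mB; apply/measurable_EFinP.
  by apply: measurable_funM; [exact: measurable_cst|exact: measurable_indic].
rewrite ge0_integralD//; last 4 first.
- by move=> x _; apply: sume_ge0 => j _; rewrite lee_fin mulr_ge0// ltW.
- by apply: emeasurable_sum => j; exact: mEi.
- by move=> x _; rewrite lee_fin mulr_ge0// ltW.
- exact: mEi.
rewrite ge0_integral_sum//; last 2 first.
- by move=> j; exact: mEi.
- by move=> j x _; rewrite lee_fin mulr_ge0// ltW.
have intE B : measurable B -> \int[nu]_x (e * \1_B x)%:E = e%:E * nu B.
  move=> mB; under eq_integral do rewrite EFinM.
  rewrite ge0_integralZl ?lee_fin ?(ltW e0)//; last first.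
    by apply/measurable_EFinP; exact: measurable_indic.
  by rewrite integral_indic// setIT.
rewrite intE// leeD//; last first.
  rewrite -(fineK Afin) -EFinM lee_fin -/a /e mulrAC ler_pdivrMr ?ltr_wpDl//.
  by rewrite ler_pM2l// lerDl.
under eq_bigr do rewrite intE//.
exact: layers.
Qed.

Lemma Cc_EFin_measurable phi : isCc phi ->
  measurable_fun [set: borel X] (fun x => (phi x)%:E).
Proof. by move=> [cp _]; apply/measurable_EFinP; exact: continuous_borel. Qed.

Lemma minor_lt nu g t : (forall x, 0 <= g x) -> lower_semicontinuous g ->
  t%:E < \int[nu]_x g x -> exists2 phi, minor g phi & (t < \int[nu]_x phi x)%R.
Proof.
move=> g0 lg; rewrite integral_lsc// => /ereal_sup_gt[_ [phi mp <-] lt].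
by exists phi => //; rewrite -lte_fin EFin_int//; exact: mp.1.
Qed.

Lemma C0plusP (f : X -> \bar R) : C0plus f <->
  exists2 phi, isCc phi /\ (forall x, 0 <= phi x)%R & f = fun x => (phi x)%:E.
Proof.
split.
  move=> [[f0 lf] [_ fy uf cf]].
  have ff x : f x \is a fin_num by rewrite ge0_fin_numE.
  exists (fine \o f); last by apply/funext => x /=; rewrite fineK.
  split; last by move=> x; exact: fine_ge0.
  split; last first.
    rewrite (_ : [set x | _] = [set x | f x != 0])//.
    by apply/seteqP; split => x /=; rewrite -[f x]fineK// eqe.
  move=> x; apply/cvgrPdist_lt => e e0.
  have [V xV Vf] : exists2 V, nbhs x V & forall y, V y -> (fine (f x) - e)%:E < f y.
    by apply: lf; rewrite -{2}(fineK (ff x)) lte_fin ltrBlDr ltrDl.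
  have [W xW Wf] : exists2 V, nbhs x V & forall y, V y -> (- (fine (f x) + e))%:E < - f y.
    by apply: uf; rewrite -{2}(fineK (ff x)) -EFinN lte_fin ltrN2 ltrDl.
  near=> y; have yV : V y by near: y.
  have yW : W y by near: y.
  have := Wf _ yW; have := Vf _ yV.
  rewrite -(fineK (ff y)) -EFinN !lte_fin => h1 h2.
  by rewrite ltr_norml /=; apply/andP; split; lra.
move=> [phi [cp p0] ->]; have p0' x : 0 <= (phi x)%:E by rewrite lee_fin.
split; first by split => //; exact: continuous_lsc cp.1.
split => //; first by move=> x; exact: ltry.
- apply: (@continuous_lsc R X (fun x => - phi x)%R) => x.
  by apply: cvgN; exact: cp.1.
- rewrite (_ : [set x | _] = [set x | phi x != 0%R]); first exact: cp.2.
  by apply/seteqP; split => x /=; rewrite eqe.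
Unshelve. all: by end_near. Qed.

End SemicontinuousIntegrals.

Section LowerSemicontinuousSum.
Context {R : realType} {X : topologicalType}.

Lemma lscD (f g : X -> \bar R) : lower_semicontinuous f ->
  lower_semicontinuous g -> (forall x, -oo < f x) -> (forall x, -oo < g x) ->
  lower_semicontinuous (fun x => f x + g x).
Proof.
move=> lf lg f0 g0 x a afg.
have [b [c [bf cg abc]]] : exists b c : R, [/\ b%:E < f x, c%:E < g x & (a <= b + c)%R].
  move: (f0 x) (g0 x) afg; case: (f x) => [r||//]; case: (g x) => [s||//] _ _.
  - rewrite -EFinD lte_fin => ars; pose d := ((r + s - a) / 2)%R.
    by exists (r - d)%R, (s - d)%R; rewrite !lte_fin /d; split; lra.
  - by move=> _; exists (r - 1)%R, (a - r + 1)%R; rewrite ltry lte_fin; split => //; lra.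
  - by move=> _; exists (a - s + 1)%R, (s - 1)%R; rewrite ltry lte_fin; split => //; lra.
  - by move=> _; exists a, 0%R; rewrite !ltry addr0.
have [V xV Vf] := lf _ _ bf; have [W xW Wg] := lg _ _ cg.
exists (V `&` W); first exact: filterI.
move=> y [/Vf yV /Wg yW]; rewrite (@le_lt_trans _ _ (b + c)%:E) ?lee_fin//.
by rewrite EFinD lteD.
Qed.

End LowerSemicontinuousSum.

(** * Integrals of u.s.c. functions of compact support *)

Section UpperIntegral.
Context {R : realType} {X : ptopologicalType}.
Hypothesis hX : hausdorff_space X.
Hypothesis lcX : locally_compact [set: X].
Implicit Types (nu : radon R X) (h : X -> \bar R).

Lemma H0_fin h x : H0 h -> h x \is a fin_num.
Proof. by move=> [h0 hy _ _]; rewrite ge0_fin_numE. Qed.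

Lemma H0_ge0 h x : H0 h -> 0 <= h x. Proof. by move=> []. Qed.

Lemma H0_measurable h : H0 h -> measurable_fun [set: borel X] h.
Proof. by move=> [_ _ uh _]; exact: usc_measurable. Qed.

Lemma H0_majorant h : H0 h -> exists phi : X -> R,
  [/\ isCc phi, forall x, (0 <= phi x)%R & forall x, h x <= (phi x)%:E].
Proof.
move=> H; have [h0 hy uh ch] := H.
have [| | |M M0 hM] := @compact_directed _ _ _ [set M : R | 0 < M]%R
    (fun M => [set x | h x <= M%:E]) ch.
- by exists 1%R => /=.
- move=> i j /= i0 j0; exists (Num.max i j); split => /=.
  + by rewrite lt_max i0.
  + by move=> x /= /le_trans; apply; rewrite lee_fin le_max lexx.
  + by move=> x /= /le_trans; apply; rewrite lee_fin le_max lexx orbT.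
- move=> x _; pose M := (fine (h x) + 1)%R.
  exists M; first by rewrite /= ltr_wpDl// fine_ge0.
  have : (- M)%:E < - h x.
    by rewrite -(fineK (H0_fin x H)) -EFinN lte_fin ltrN2 /M ltrDl.
  by move=> /uh[V xV Vh]; apply: filterS xV => y /Vh; rewrite EFinN lteN2 => /ltW.
have [chi [cchi chi01 chi1 _]] :=
  @urysohn_Cc R _ hX lcX _ _ ch openT (@subsetT _ _).
have M0' : (0 <= M)%R by exact: ltW.
exists (fun x => M * chi x)%R; split.
- exact: isCcZ.
- by move=> x; rewrite mulr_ge0//; have /andP[] := chi01 x.
- move=> x; have [->|hx] := eqVneq (h x) 0.
    by rewrite lee_fin mulr_ge0//; have /andP[] := chi01 x.
  by rewrite chi1 ?mulr1; [apply: hM|]; exact: subset_closure.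
Qed.

(** For a compactly supported continuous majorant [phi], the difference [phi - h] is nonnegative and
    l.s.c., so its integral is approached by minorants [psi], and [phi - psi] majorizes [h]. Bounds
    on integrals of [h] thus become bounds on vaguely continuous ones. *)
Lemma H0_int_lt nu h t : H0 h -> \int[nu]_x h x < t%:E ->
  exists phi : X -> R, [/\ isCc phi, forall x, (0 <= phi x)%R,
    forall x, h x <= (phi x)%:E & (\int[nu]_x phi x < t)%R].
Proof.
move=> H ht; have [phi [cp p0 hp]] := H0_majorant H.
pose g x := (phi x)%:E - h x.
have g0 x : 0 <= g x by rewrite /g sube_ge0 ?hp// H0_fin.
have lg : lower_semicontinuous g.
  apply: (@lscD R X (fun x => (phi x)%:E) (fun x => - h x)).
  - exact: continuous_lsc cp.1.
  - by have [_ _ + _] := H.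
  - by move=> x; exact: ltNyr.
  - by move=> x; rewrite -(fineK (H0_fin x H)) -EFinN ltNyr.
have int_phi : \int[nu]_x (phi x)%:E = \int[nu]_x h x + \int[nu]_x g x.
  rewrite -ge0_integralD//; last 3 first.
  - by move=> x _; exact: H0_ge0.
  - exact: H0_measurable.
  - exact: lsc_measurable.
  by apply: eq_integral => x _; rewrite /g addeC subeK// H0_fin.
have : (\int[nu]_x phi x - t)%:E < \int[nu]_x g x.
  rewrite EFinB EFin_int// lteBlDr// int_phi addeC lteD2lE//.
  have : \int[nu]_x g x <= \int[nu]_x (phi x)%:E.
    by rewrite int_phi leeDr// integral_ge0// => x _; exact: H0_ge0.
  rewrite -EFin_int// => /le_lt_trans/(_ (ltry _)).
  by rewrite -ge0_fin_numE// integral_ge0.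
move=> /(minor_lt hX lcX g0 lg)[psi mpsi lt].
have cq := mpsi.1.
have hq x : h x <= (phi x - psi x)%:E.
  rewrite EFinB leeBrDr//; have := minor_le x mpsi.
  by rewrite /g leeBrDr ?H0_fin// addeC.
exists (fun x => phi x - psi x)%R; split => //.
- exact: isCcB.
- by move=> x; rewrite -lee_fin (le_trans _ (hq x))// H0_ge0.
- have -> : (\int[nu]_x (phi x - psi x) = \int[nu]_x phi x - \int[nu]_x psi x)%R.
    exact: (pos_linearB (int_pos_linear hX nu) cp cq).
  by move: lt; lra.
Qed.

End UpperIntegral.

(** * Operations on Radon measures *)

Section MeasureMonotone.
Context d (T : measurableType d) {R : realType}.

Lemma ge0_le_measure_integral (m1 m2 : {measure set T -> \bar R}) (f : T -> \bar R) :
  (forall A, measurable A -> m1 A <= m2 A) -> (forall x, 0 <= f x) ->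
  \int[m1]_x f x <= \int[m2]_x f x.
Proof.
move=> m12 f0; rewrite !ge0_integralTE//; apply: ge_ereal_sup => _ [s sf <-].
apply: le_trans (le_measure_sintegral m12 s) _.
by apply: ereal_sup_ubound; exists s.
Qed.

End MeasureMonotone.

Section RadonOperations.
Context {R : realType} {X : ptopologicalType}.
Hypothesis hX : hausdorff_space X.
Hypothesis lcX : locally_compact [set: X].
Implicit Types (nu mu : radon R X).

(** Both regularity conditions are pulled back to [nu] by dividing by [r], which sets the case
    [r = 0] apart. *)
Lemma mscale_radon nu (r : {nonneg R}) : is_radon (mscale r nu).
Proof.
have mE A : (mscale r nu : {measure set (borel X) -> \bar R}) A = r%:num%:E * nu A by [].
have le (A B : set X) : A `<=` B -> mscale r nu A <= mscale r nu B.
  by move=> AB; rewrite /mscale/= lee_wpmul2l ?lee_fin// radon_le.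
have [r0|] := eqVneq (r%:num)%R 0%R.
  have z A : (mscale r nu : {measure set (borel X) -> \bar R}) A = 0.
    by rewrite mE r0 mul0e.
  split.
  - by move=> K _; rewrite z.
  - move=> E; rewrite z; apply/eqP; rewrite eq_le; apply/andP; split.
      by apply: le_ereal_inf_tmp => _ [U _ <-]; rewrite z.
    by apply: ereal_inf_lbound; exists setT; rewrite ?z//; split => //; exact: openT.
  - move=> U _; rewrite z; apply/eqP; rewrite eq_le; apply/andP; split.
      by apply: ereal_sup_ubound; exists set0; rewrite ?z//; split => //; exact: compact0.
    by apply: ge_ereal_sup => _ [V _ <-]; rewrite z.
move=> rn0; have r0 : (0 < r%:num)%R by rewrite lt0r rn0/=.
split.
- move=> K cK; rewrite mE.
  have fK : nu K \is a fin_num by rewrite ge0_fin_numE// radon_compact.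
  by rewrite -(fineK fK) -EFinM ltry.
- move=> E; apply/eqP; rewrite eq_le; apply/andP; split.
    by apply: le_ereal_inf_tmp => _ [U [_ EU] <-]; exact: le.
  rewrite mE -lee_pdivrMl//= [leRHS]radon_outer.
  apply: le_ereal_inf_tmp => _ [U UE <-]; rewrite lee_pdivrMl//.
  by apply: ereal_inf_lbound; exists U.
- move=> U oU; apply/eqP; rewrite eq_le; apply/andP; split; last first.
    by apply: ge_ereal_sup => _ [K [_ KU] <-]; exact: le.
  rewrite mE -lee_pdivlMl// [leLHS]radon_inner//.
  apply: ge_ereal_sup => _ [K KU <-]; rewrite lee_pdivlMl//.
  by apply: ereal_sup_ubound; exists K.
Qed.

Definition rscale nu (r : {nonneg R}) : radon R X := Radon (mscale_radon nu r).

(** Approximating open sets for [mu] and [nu] are intersected, approximating compact sets are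
    united. *)
Lemma measure_add_radon mu nu : is_radon (measure_add mu nu).
Proof.
pose m : {measure set (borel X) -> \bar R} := measure_add mu nu.
rewrite -/m.
have mE A : m A = mu A + nu A by exact: measure_addE.
have le (A B : set X) : A `<=` B -> m A <= m B.
  by move=> AB; rewrite !mE leeD// radon_le.
split.
- by move=> K cK; rewrite mE lte_add_pinfty// radon_compact.
- move=> E; apply/eqP; rewrite eq_le; apply/andP; split.
    by apply: le_ereal_inf_tmp => _ [U [_ EU] <-]; exact: le.
  rewrite mE.
  have [->|fm] := eqVneq (mu E) +oo; first by rewrite addye ?leey// gt_eqF// (lt_le_trans _ (measure_ge0 _ _)).
  have [->|fn] := eqVneq (nu E) +oo; first by rewrite addey ?leey// gt_eqF// (lt_le_trans _ (measure_ge0 _ _)).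
  apply/lee_addgt0Pr => e e0; have e20 : (0 < e / 2)%R by rewrite divr_gt0.
  have adh (l : radon R X) : l E != +oo ->
      exists U, [/\ open U, E `<=` U & l U <= l E + (e / 2)%:E].
    move=> lE; have : l E < l E + (e / 2)%:E.
      by rewrite lteDl ?lte_fin// ge0_fin_numE// ltey.
    rewrite {1}(radon_outer l) => /ereal_inf_lt[_ [U [oU EU] <-] lt].
    by exists U; split => //; exact: ltW.
  have [U [oU EU hU]] := adh _ fm; have [V [oV EV hV]] := adh _ fn.
  apply: (@le_trans _ _ (m (U `&` V))).
    apply: ereal_inf_lbound; exists (U `&` V) => //; split; first exact: openI.
    by rewrite subsetI.
  rewrite mE [e]splitr EFinD addeACA leeD//.
    by apply: le_trans hU; apply: radon_le; exact: subIsetl.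
  by apply: le_trans hV; apply: radon_le; exact: subIsetr.
- move=> U oU; apply/eqP; rewrite eq_le; apply/andP; split; last first.
    by apply: ge_ereal_sup => _ [K [_ KU] <-]; exact: le.
  rewrite mE (radon_inner mu oU) (radon_inner nu oU).
  set S := ereal_sup [set m K | K in _].
  have S0 : 0 <= S.
    apply: ereal_sup_ubound; exists set0; last exact: measure0.
    by split; [exact: compact0|exact: sub0set].
  have [->|Sy] := eqVneq S +oo; first by rewrite leey.
  have fS : S \is a fin_num by rewrite ge0_fin_numE// ltey.
  have KS (K L : set X) : compact K -> compact L -> K `<=` U -> L `<=` U ->
      mu K + nu L <= S.
    move=> cK cL KU LU; apply: (@le_trans _ _ (m (K `|` L))).
      by rewrite mE; apply: leeD; apply: radon_le => x Kx; first [by left|by right].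
    by apply: ereal_sup_ubound; exists (K `|` L) => //; split; [exact: compactU|rewrite subUset].
  have fK (l : radon R X) K : compact K -> l K \is a fin_num.
    by move=> cK; rewrite ge0_fin_numE// radon_compact.
  set b := ereal_sup [set nu K | K in _].
  have bS K : compact K -> K `<=` U -> b <= S - mu K.
    move=> cK KU; apply: ge_ereal_sup => _ [L [cL LU] <-].
    by rewrite leeBrDr ?fK// addeC; exact: KS.
  have b0 : 0 <= b.
    apply: ereal_sup_ubound; exists set0; last exact: measure0.
    by split; [exact: compact0|exact: sub0set].
  have fb : b \is a fin_num.
    rewrite ge0_fin_numE//; apply: le_lt_trans (bS set0 compact0 (@sub0set _ _)) _.
    by rewrite measure0 sube0 ltey.
  rewrite -leeBrDr//; apply: ge_ereal_sup => _ [K [cK KU] <-].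
  by rewrite leeBrDr// addeC -leeBrDr ?fK// bS.
Qed.

Definition radd mu nu : radon R X := Radon (measure_add_radon mu nu).

(** An outer approximation of [E] is an open set around the part of [E] in [A], joined with the
    complement of [A]. For inner regularity at [U], an open [V] closely around the part of [A]
    outside [U] is removed from [A]; what is left is compact and lies in [U]. *)
Lemma mrestr_radon nu (A : set X) (cA : compact A)
    (mA : measurable (A : set (borel X))) : is_radon (mrestr nu mA).
Proof.
pose m : {measure set (borel X) -> \bar R} := mrestr nu mA.
rewrite -/m.
have mE B : m B = nu (B `&` A) by [].
have le (B C : set X) : B `<=` C -> m B <= m C.
  by move=> BC; rewrite !mE; apply: radon_le; exact: setSI.
have clA := compact_closed hX cA.
have fA (B : set X) : nu (B `&` A) \is a fin_num.
  rewrite ge0_fin_numE//; apply: le_lt_trans (radon_compact nu cA).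
  by apply: radon_le; exact: subIsetr.
have adh (E : set X) (e : R) : (0 < e)%R ->
    exists U, [/\ open U, E `&` A `<=` U & nu U <= nu (E `&` A) + e%:E].
  move=> e0; have : nu (E `&` A) < nu (E `&` A) + e%:E by rewrite lteDl ?lte_fin.
  rewrite {1}(radon_outer nu) => /ereal_inf_lt[_ [U [oU EU] <-] lt].
  by exists U; split => //; exact: ltW.
split.
- by move=> K cK; rewrite mE ltey_eq fA.
- move=> E; apply/eqP; rewrite eq_le; apply/andP; split.
    by apply: le_ereal_inf_tmp => _ [U [_ EU] <-]; exact: le.
  rewrite [leRHS]mE; apply/lee_addgt0Pr => e e0; have [U [oU EU hU]] := adh E e e0.
  apply: le_trans hU; apply: (@le_trans _ _ (m (U `|` ~` A))).
    apply: ereal_inf_lbound; exists (U `|` ~` A) => //; split.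
      by apply: openU => //; exact: closed_openC.
    by move=> x Ex; have [Ax|] := pselect (A x); [left; apply: EU|right].
  rewrite mE setIUl setICl setU0; apply: radon_le; exact: subIsetl.
- move=> U oU; apply/eqP; rewrite eq_le; apply/andP; split; last first.
    by apply: ge_ereal_sup => _ [K [_ KU] <-]; exact: le.
  apply/lee_addgt0Pr => e e0.
  have [V [oV AV hV]] := adh (~` U) e e0.
  have mU := borel_open oU; have mV := borel_open oV.
  pose K := A `&` ~` V.
  have cK : compact K by apply: compact_closedI => //; exact: open_closedC.
  have KU : K `<=` U.
    by move=> x [Ax nVx]; apply: contrapT => nUx; apply: nVx; apply: AV.
  apply: (@le_trans _ _ (m K + e%:E)); last first.
    by rewrite leeD2r//; apply: ereal_sup_ubound; exists K.
  have KA : K `&` A = A `\` V.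
    by rewrite /K setIAC setIid -setDE.
  have e1 : nu A = nu (A `\` V) + nu (A `&` V).
    by apply: measureDI.
  have e2 : nu A = nu (U `&` A) + nu (~` U `&` A).
    by rewrite addeC (setIC U) (setIC (~` U)) -setDE; apply: measureDI.
  have le3 : nu (A `&` V) <= nu (~` U `&` A) + e%:E.
    by apply: le_trans hV; apply: radon_le; exact: subIsetr.
  rewrite !mE KA -(leeD2rE _ _ (fA (~` U))) -e2 e1 -addeA leeD2l//.
  by rewrite addeC.
Qed.

Definition rrestr nu A (cA : compact A) : radon R X :=
  Radon (mrestr_radon nu cA (borel_compact hX cA)).

(** Riesz provides some Radon measure, and scaling it by 0 makes it vanish on every set. *)
Lemma radon_zero : exists nu : radon R X, forall A, nu A = 0.
Proof.
have p0 : @pos_linear R X (fun=> 0%R).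
  by split => // [*|a *]; rewrite ?addr0 ?mulr0.
have [nu _] := riesz_representation hX lcX p0.
by exists (rscale nu (0%:nng)%R) => A; rewrite /= /mscale/= mul0e.
Qed.

End RadonOperations.

(** * Vague topology and energy *)

Section VagueTopology.
Context {R : realType} {X : ptopologicalType}.

Lemma vague_continuous (phi : X -> R) : isCc phi ->
  continuous (fun nu : vague R X => (\int[(nu : radon R X)]_x phi x)%R).
Proof.
move=> cp nu; pose c : Cc R X := exist _ phi cp.
have h1 : (vague_eval mu @[mu --> (nu : vague R X)]) --> vague_eval nu.
  exact: (@initial_continuous (radon R X) _ (@vague_eval R X)).
have h2 : (proj c g @[g --> vague_eval nu]) --> proj c (vague_eval nu).
  have /cvg_sup/(_ c) h := @cvg_id _ (nbhs (vague_eval nu)).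
  apply: cvg_trans (cvg_app _ h) _.
  exact: (@initial_continuous _ _ (fun f : (forall _ : Cc R X, R) => f c)).
exact: (cvg_comp _ _ h1 h2).
Qed.

Lemma cvg_vague (F : set_system (vague R X)) (nu : vague R X) : Filter F ->
  (forall phi : X -> R, isCc phi ->
     (\int[(mu : radon R X)]_x phi x)%R @[mu --> F] -->
       (\int[(nu : radon R X)]_x phi x)%R) ->
  F --> nu.
Proof.
move=> FF h A /= [_ [[B oB <-] Bnu] BA].
suff FB : F (@vague_eval R X @^-1` B) by change (F A); exact: filterS BA FB.
have : @vague_eval R X @ F --> @vague_eval R X nu.
  apply/cvg_sup => c V /= [_ [[W oW <-] Wc] WV].
  have hc : F [set mu : vague R X | W (\int[(mu : radon R X)]_x sval c x)%R].
    exact: (h _ (svalP c) W (open_nbhs_nbhs (conj oW Wc))).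
  by change (F (@vague_eval R X @^-1` V)); apply: filterS hc => mu; exact: WV.
by move=> /(_ B); apply; exact: open_nbhs_nbhs.
Qed.

Lemma ultra_segment (T : Type) (F : set_system T) (u : T -> R) a b :
  UltraFilter F -> F [set t | (a <= u t <= b)%R] ->
  exists l : R, u @ F --> l.
Proof.
move=> UF Fab; have PF : ProperFilter F by exact: ultra_proper.
have Fi : (u @ F) `[a, b]%classic.
  by rewrite (_ : (u @ F) _ = F [set t | (a <= u t <= b)%R]).
have [l [_ cl]] := @segment_compact R a b (u @ F) _ Fi.
exists l => V lV.
have [//|FV] := in_ultra_setVsetC (u @^-1` V) UF.
have [y [nVy Vy]] := cl (~` V) V FV lV.
by [].
Qed.

End VagueTopology.

Section Energy.
Context {R : realType} {X : ptopologicalType}.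
Hypothesis hX : hausdorff_space X.
Hypothesis lcX : locally_compact [set: X].
Variable G : X * X -> \bar R.
Hypothesis kerG : is_kernel G.
Implicit Types (mu nu : radon R X) (phi psi : X -> R) (K U : set X).

Definition energy mu : \bar R := \int[mu]_x potential G mu x.

Lemma kernel_ge0 x y : 0 <= G (x, y).
Proof. by have [+ _ _ _] := kerG; exact. Qed.

Lemma kernel_section_lsc x : lower_semicontinuous (fun y => G (x, y)).
Proof.
have [_ lG _ _] := kerG => y a /lG[V [[A B] /= [xA yB] AB] Va].
exists B => // z Bz; apply: Va; apply: AB; split => //=.
exact: nbhs_singleton.
Qed.

Lemma potential_ge0 mu x : 0 <= potential G mu x.
Proof. by apply: integral_ge0 => y _; exact: kernel_ge0. Qed.

Lemma energy_ge0 mu : 0 <= energy mu.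
Proof. by apply: integral_ge0 => x _; exact: potential_ge0. Qed.

Lemma norm_sqr mu : norm G mu ^+ 2 = energy mu.
Proof. by rewrite sqr_sqrte// energy_ge0. Qed.

Lemma vague_near (nu0 : vague R X) phi s : isCc phi ->
  (s < \int[(nu0 : radon R X)]_x phi x)%R ->
  \forall nu \near nu0, (s < \int[(nu : radon R X)]_x phi x)%R.
Proof.
move=> cp lt; have h := @vague_continuous R X phi cp nu0.
by have := cvgr_gt _ h s lt; apply; exact: nbhs_filter.
Qed.

Lemma minor_lt_cut nu (g : X -> \bar R) t : (forall x, 0 <= g x) ->
  lower_semicontinuous g -> t%:E < \int[nu]_x g x ->
  exists phi e, [/\ minor g phi, (0 < e)%R &
    (t < \int[nu]_x Num.max (phi x - e) 0)%R].
Proof.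
move=> g0 lg /(minor_lt hX lcX g0 lg)[phi mphi lt].
have [e e0 h] := pos_linear_cut (int_pos_linear hX nu) hX lcX mphi.1 lt.
by exists phi, e.
Qed.

Lemma cut_le (g : X -> \bar R) phi (e : R) x : 0 <= g x ->
  ((e <= phi x)%R -> (phi x - e)%:E <= g x) ->
  (Num.max (phi x - e) 0)%:E <= g x.
Proof.
move=> g0 h; have [ex|ex] := leP e (phi x).
  by rewrite max_l ?subr_ge0//; exact: h.
by rewrite max_r// subr_le0 ltW.
Qed.

Lemma near_lt_add phi (x : X) (d : R) : isCc phi -> (0 < d)%R ->
  \forall y \near x, (phi y < phi x + d)%R.
Proof.
move=> [cp _] d0; have /cvgrPdist_lt/(_ d d0) := cp x.
apply: filterS => y /= h.
by rewrite -ltrBlDl; apply: le_lt_trans h; rewrite distrC; exact: ler_norm.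
Qed.

(** Tube lemma over the compact set [{psi >= e}]. Half of the slack [e] pays for the lower
    semicontinuity of [G], the other half for the variation of [psi]. *)
Lemma kernel_cut_near (x0 : X) psi (e : R) : (0 < e)%R ->
  minor (fun y => G (x0, y)) psi ->
  \forall x \near x0,
    [set y | e <= psi y]%R `<=` (fun y => (psi y - e)%:E < G (x, y)).
Proof.
move=> e0 mpsi; have cpsi := mpsi.1.
have cov : near_covering [set y | e <= psi y]%R.
  by apply/compact_near_coveringP; exact: compact_ge_Cc.
apply: cov => y ey; have [_ lG _ _] := kerG.
have e20 : (0 < e / 2)%R by rewrite divr_gt0.
have : (psi y - e / 2)%:E < G (x0, y).
  by apply: lt_le_trans (minor_le y mpsi); rewrite lte_fin ltrBlDr ltrDl.
move=> /lG[V [[A B] /= [xA yB] AB] Va].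
have yB' := filterI yB (near_lt_add y cpsi e20).
exists ([set z | B z /\ (psi z < psi y + e / 2)%R], A) => //=.
  by split; [exact: yB'|exact: xA].
move=> [z x] /= [[Bz hz] Ax]; apply: le_lt_trans (Va (x, z) _).
  by rewrite lee_fin; lra.
exact: AB.
Qed.

(** For [x] near [x0] the kernel section stays above one fixed function of [C_c], whose integral is
    vaguely continuous in [nu]. The joint form serves the energy, where point and measure move
    together. *)
Lemma potential_joint_lsc (x0 : X) (nu0 : vague R X) s :
  s%:E < potential G (nu0 : radon R X) x0 ->
  \forall x \near x0 & nu \near nu0, s%:E < potential G (nu : radon R X) x.
Proof.
move=> /(minor_lt_cut (kernel_ge0 x0) (@kernel_section_lsc x0))[psi [e [mpsi e0 lt]]].
have cpsi := mpsi.1.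
have hA := kernel_cut_near e0 mpsi.
have ccut := isCc_cut (ltW e0) cpsi; have nuB := vague_near ccut lt.
exists ([set x | [set y | e <= psi y]%R `<=` (fun y => (psi y - e)%:E < G (x, y))], [set nu : vague R X |
    (s < \int[(nu : radon R X)]_x Num.max (psi x - e) 0)%R]) => //=.
move=> [x nu] /= [Ax Bnu].
apply: (@lt_le_trans _ _ (\int[(nu : radon R X)]_y (Num.max (psi y - e) 0)%:E)).
  by rewrite -EFin_int// lte_fin.
apply: ge0_integral_le => y; first by rewrite lee_fin le_max lexx orbT.
by apply: (@cut_le (fun y => G (x, y))) => [|ey]; [exact: kernel_ge0|exact/ltW/Ax].
Qed.

Lemma potential_lsc mu : lower_semicontinuous (potential G mu).
Proof.
move=> x a /(@potential_joint_lsc x (mu : vague R X))[[A B] /= [xA muB] AB].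
exists A => // y Ay; apply: (AB (y, mu)); split => //=.
exact: (@nbhs_singleton (vague R X) mu B muB).
Qed.

Lemma potential_measurable mu : measurable_fun [set: borel X] (potential G mu).
Proof. by apply: lsc_measurable; exact: potential_lsc. Qed.

(** The argument for the potential, one level up: joint semicontinuity and compactness of
    [{phi >= e}] keep [G nu] above the cut of one fixed [phi] for all [nu] near [nu0], and the
    integral of that cut is vaguely continuous. *)
Lemma energy_lsc (nu0 : vague R X) t : t%:E < energy (nu0 : radon R X) ->
  \forall nu \near nu0, t%:E < energy (nu : radon R X).
Proof.
move=> /(minor_lt_cut (potential_ge0 _) (@potential_lsc _))[phi [e [mphi e0 lt]]].
have cphi := mphi.1.
have cov : near_covering [set x | e <= phi x]%R.
  by apply/compact_near_coveringP; exact: compact_ge_Cc.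
have e20 : (0 < e / 2)%R by rewrite divr_gt0.
have hA : \forall nu \near nu0, [set x | e <= phi x]%R `<=`
    (fun x => (phi x - e)%:E < potential G (nu : radon R X) x).
  apply: (cov _ (nbhs nu0)
    (fun (nu : vague R X) x => (phi x - e)%:E < potential G (nu : radon R X) x)).
  move=> x ex.
  have : (phi x - e / 2)%:E < potential G (nu0 : radon R X) x.
    by apply: lt_le_trans (minor_le x mphi); rewrite lte_fin ltrBlDr ltrDl.
  move=> /potential_joint_lsc[[A B] /= [xA nuB] AB].
  have xA' := filterI xA (near_lt_add x cphi e20).
  exists ([set z | A z /\ (phi z < phi x + e / 2)%R], B) => //=.
    by split; [exact: xA'|exact: nuB].
  move=> [z nu] /= [[Az hz] Bnu]; apply: le_lt_trans (AB (z, nu) _) => //=.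
  by rewrite lee_fin; lra.
have ccut := isCc_cut (ltW e0) cphi; have := vague_near ccut lt.
apply: filterS2 hA => nu hnu Bnu.
apply: (@lt_le_trans _ _ (\int[(nu : radon R X)]_y (Num.max (phi y - e) 0)%:E)).
  by rewrite -EFin_int// lte_fin.
apply: ge0_integral_le => y; first by rewrite lee_fin le_max lexx orbT.
by apply: (@cut_le (potential G (nu : radon R X))) => [|ey]; [exact: potential_ge0|exact/ltW/hnu].
Qed.

End Energy.

(** * Symmetry of the mutual energy *)

Section DisjointedList.
Context {T : Type} {B : Type}.

(** Successive differences; [D] is the part of the space not yet taken. *)
Fixpoint disjointed (D : set T) (l : seq (set T * B)) : seq (set T * B) :=
  if l is p :: l' then (D `&` p.1, p.2) :: disjointed (D `\` p.1) l' else [::].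

End DisjointedList.

Section MutualEnergy.
Context {R : realType} {X : ptopologicalType}.
Hypothesis hX : hausdorff_space X.
Hypothesis lcX : locally_compact [set: X].
Variable G : X * X -> \bar R.
Hypothesis kerG : is_kernel G.
Implicit Types (mu nu : radon R X) (phi psi : X -> R) (K U : set X)
  (l : seq (set X * (X -> R))).

Definition tensor l (x y : X) : R := (\sum_(p <- l) \1_(p.1) x * p.2 y)%R.

(** To be used with [H] the kernel, [v] integration against [mu], and [u] the function [phi - e] for
    a minorant [phi] of [G mu]: on each open piece, the attached function lies below the kernel
    sections while its integral already reaches [u]. *)
Definition good_list (H : X -> X -> \bar R) (u : X -> R) (v : (X -> R) -> R) l :=
  forall p, List.In p l ->
    [/\ open p.1, isCc p.2, forall y, (0 <= p.2 y)%R,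
        forall x y, p.1 x -> (p.2 y)%:E <= H x y &
        forall x, p.1 x -> (u x <= v p.2)%R].

(** Once the pieces are disjoint, at most one term survives at each [x], so the sum inherits the
    upper bound by [H] and the lower bound by [u] from that term. The pieces become Borel instead of
    open. *)
Lemma tensor_disjointed H u v l (D : set X) : measurable (D : set (borel X)) ->
  (forall x y, 0 <= H x y) -> good_list H u v l ->
  [/\ forall p, List.In p (disjointed D l) ->
        [/\ measurable (p.1 : set (borel X)), isCc p.2 & forall y, (0 <= p.2 y)%R],
      forall x y, ~ D x -> tensor (disjointed D l) x y = 0%R,
      forall x, ~ D x -> (\sum_(p <- disjointed D l) \1_(p.1) x * v p.2)%R = 0%R,
      forall x y, (tensor (disjointed D l) x y)%:E <= H x y &
      forall x p, List.In p l -> D x -> p.1 x ->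
        (u x <= \sum_(q <- disjointed D l) \1_(q.1) x * v q.2)%R].
Proof.
move=> + H0; elim: l D => [|[U b] l ih] D mD gl.
  split => //=; rewrite /tensor.
  - by move=> x y _; rewrite big_nil.
  - by move=> x _; rewrite big_nil.
  - by move=> x y; rewrite big_nil.
have [oU cb b0 bH ub] := gl (U, b) (or_introl erefl); rewrite /= in oU cb b0 bH ub.
have mU := borel_open oU.
have gl' : good_list H u v l by move=> p lp; apply: gl; right.
have mDU : measurable (D `\` U : set (borel X)) by exact: measurableD.
have [i1 i2 i3 i4 i5] := ih _ mDU gl'.
split.
- move=> p /= [<-/=|]; last exact: i1.
  by split => //; exact: measurableI.
- move=> x y nD; rewrite /tensor/= big_cons/= indicE memNset ?mul0r ?add0r.
    by apply: i2 => -[].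
  by move=> -[].
- move=> x nD /=; rewrite big_cons/= indicE memNset ?mul0r ?add0r.
    by apply: i3 => -[].
  by move=> -[].
- move=> x y; rewrite /tensor/= big_cons/= indicE.
  have [xDU|xDU] := boolP (x \in _).
    have [Dx Ux] := set_mem xDU.
    by rewrite mul1r -/(tensor _ x y) i2 ?addr0 ?bH// => -[].
  by rewrite mul0r add0r; exact: i4.
- move=> x p /= lp Dx px; rewrite big_cons/=.
  have [Ux|nUx] := pselect (U x).
    by rewrite indicE mem_set// mul1r i3 ?addr0 ?ub// => -[].
  rewrite indicE memNset ?mul0r ?add0r; last by move=> [].
  case: lp => [pE|lp]; first by move: px; rewrite -pE.
  exact: (i5 x p).
Qed.

Definition borel_list l := forall p, List.In p l ->
  [/\ measurable (p.1 : set (borel X)), isCc p.2 & forall y, (0 <= p.2 y)%R].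

Lemma borel_list_cons p l : borel_list (p :: l) ->
  [/\ measurable (p.1 : set (borel X)), isCc p.2, forall y, (0 <= p.2 y)%R &
      borel_list l].
Proof.
move=> h; have [mp cp p0] := h p (or_introl erefl); split => //.
by move=> q lq; apply: h; right.
Qed.

Lemma tensor_ge0 l x y : borel_list l -> (0 <= tensor l x y)%R.
Proof.
rewrite /tensor; elim: l => [_|p l ih /borel_list_cons[_ _ p0 hl]].
  by rewrite big_nil.
by rewrite big_cons addr_ge0 ?mulr_ge0// ih.
Qed.

Lemma tensor_Cc l x : borel_list l -> isCc (tensor l x).
Proof.
elim: l => [_|p l ih /borel_list_cons[mp cp p0 hl]].
  rewrite (_ : tensor _ _ = fun=> 0%R); first exact: isCc_cst0.
  by apply/funext => y; rewrite /tensor big_nil.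
rewrite (_ : tensor _ _ = fun y => (\1_(p.1) x * p.2 y + tensor l x y)%R).
  by apply: isCcD; [exact: isCcZ|exact: ih].
by apply/funext => y; rewrite /tensor big_cons.
Qed.

Lemma tensor_int mu l x : borel_list l ->
  (\int[mu]_y tensor l x y)%R = (\sum_(p <- l) \1_(p.1) x * \int[mu]_y p.2 y)%R.
Proof.
have [LD LZ _] := int_pos_linear hX mu.
elim: l => [_|p l ih /borel_list_cons[mp cp p0 hl]].
  by rewrite big_nil -[RHS](pos_linear0 (int_pos_linear hX mu)); congr Rintegral;
    apply/funext => y; rewrite /tensor big_nil.
rewrite big_cons -ih// -LZ// -LD; [|exact: isCcZ|exact: tensor_Cc].
by congr Rintegral; apply/funext => y; rewrite /tensor big_cons.
Qed.

Lemma indic_sum_ge0 l (v : (X -> R) -> R) x :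
  (forall p, List.In p l -> (0 <= v p.2)%R) ->
  (0 <= \sum_(p <- l) \1_(p.1) x * v p.2)%R.
Proof.
elim: l => [|p l ih] v0; first by rewrite big_nil.
rewrite big_cons addr_ge0 ?mulr_ge0 ?v0//; first by left.
by apply: ih => q lq; apply: v0; right.
Qed.

Lemma mass_sum_ge0 nu l y : borel_list l ->
  0 <= \sum_(p <- l) nu p.1 * (p.2 y)%:E.
Proof.
elim: l => [|p l ih]; first by rewrite big_nil.
move=> /borel_list_cons[_ _ p0 hl].
by rewrite big_cons adde_ge0 ?mule_ge0 ?lee_fin// ih.
Qed.

Lemma int_indic_sum nu l (v : (X -> R) -> R) : borel_list l ->
  (forall p, List.In p l -> (0 <= v p.2)%R) ->
  measurable_fun [set: borel X] (fun x => (\sum_(p <- l) \1_(p.1) x * v p.2)%R%:E) /\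
  \int[nu]_x (\sum_(p <- l) \1_(p.1) x * v p.2)%R%:E =
  \sum_(p <- l) nu p.1 * (v p.2)%:E.
Proof.
elim: l => [_ _|p l ih /borel_list_cons[mp cp p0 hl] v0].
  split; first by under eq_fun do rewrite big_nil; exact: measurable_cst.
  by rewrite big_nil; under eq_integral do rewrite big_nil; rewrite integral0.
have vp0 : (0 <= v p.2)%R by apply: v0; left.
have v0' q : List.In q l -> (0 <= v q.2)%R by move=> ql; apply: v0; right.
have [m1 i1] := ih hl v0'.
have mI : measurable_fun [set: borel X] (fun x => (\1_(p.1) x)%:E : \bar R).
  by apply/measurable_EFinP; exact: measurable_indic.
have E : (fun x => (\sum_(q <- p :: l) \1_(q.1) x * v q.2)%R%:E) =
    (fun x => (\1_(p.1) x)%:E * (v p.2)%:E + (\sum_(q <- l) \1_(q.1) x * v q.2)%R%:E).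
  by apply/funext => x; rewrite big_cons EFinD EFinM.
have mM : measurable_fun [set: borel X] (fun x => (\1_(p.1) x)%:E * (v p.2)%:E).
  by apply: emeasurable_funM => //; exact: measurable_cst.
rewrite E; split; first exact: emeasurable_funD.
rewrite ge0_integralD//; last 2 first.
- by move=> x _; rewrite -EFinM lee_fin mulr_ge0.
- by move=> x _; rewrite lee_fin indic_sum_ge0.
rewrite i1 big_cons ge0_integralZr//.
by rewrite integral_indic// setIT.
Qed.

Lemma int_mass_sum nu mu l : borel_list l ->
  measurable_fun [set: borel X] (fun y => \sum_(p <- l) nu p.1 * (p.2 y)%:E) /\
  \int[mu]_y (\sum_(p <- l) nu p.1 * (p.2 y)%:E) =
  \sum_(p <- l) nu p.1 * (\int[mu]_y p.2 y)%R%:E.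
Proof.
elim: l => [_|p l ih /borel_list_cons[mp cp p0 hl]].
  split; first by under eq_fun do rewrite big_nil; exact: measurable_cst.
  by rewrite big_nil; under eq_integral do rewrite big_nil; rewrite integral0.
have [m1 i1] := ih hl.
have E : (fun y => \sum_(q <- p :: l) nu q.1 * (q.2 y)%:E) =
    (fun y => nu p.1 * (p.2 y)%:E + \sum_(q <- l) nu q.1 * (q.2 y)%:E).
  by apply/funext => x; rewrite big_cons.
have mP := Cc_EFin_measurable cp.
have mM : measurable_fun [set: borel X] (fun y => nu p.1 * (p.2 y)%:E).
  by apply: emeasurable_funM => //; exact: measurable_cst.
rewrite E; split; first exact: emeasurable_funD.
rewrite ge0_integralD//; last 2 first.
- by move=> x _; rewrite mule_ge0// lee_fin.
- by move=> x _; exact: mass_sum_ge0.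
rewrite i1 big_cons EFin_int// ge0_integralZl//.
by move=> x _; rewrite lee_fin.
Qed.

Lemma tensor_fubini mu nu l : borel_list l ->
  \int[nu]_x (\sum_(p <- l) \1_(p.1) x * \int[mu]_y p.2 y)%R%:E =
  \int[mu]_y \int[nu]_x (tensor l x y)%:E.
Proof.
move=> hl.
have v0 p : List.In p l -> (0 <= \int[mu]_y p.2 y)%R.
  by move=> lp; apply: Rintegral_ge0 => y _; have [_ _] := hl p lp.
have [_ ->] := @int_indic_sum nu l (fun b => \int[mu]_y b y)%R hl v0.
have [_ <-] := int_mass_sum nu mu hl.
apply: eq_integral => y _.
have w0 p : List.In p l -> (0 <= p.2 y)%R by move=> /hl[].
by have [_ <-] := @int_indic_sum nu l (fun b => b y) hl w0.
Qed.

(* Product Borel sigma-algebras are too small for an l.s.c. kernel on a space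
   without a countable base, so Fubini is reached by approximating [G] from
   below by finite sums of [1_A(x) b(y)], to which it applies trivially. *)
Lemma mutual_energy_le mu nu :
  \int[nu]_x potential G mu x <= \int[mu]_x potential G nu x.
Proof.
rewrite leNgt; apply/negP => lt.
have [t t1 t2] : exists2 t : R, \int[mu]_x potential G nu x <= t%:E &
    t%:E < \int[nu]_x potential G mu x.
  have : 0 <= \int[mu]_x potential G nu x.
    by apply: integral_ge0 => x _; exact: potential_ge0.
  move: lt; case: (\int[mu]_x potential G nu x) => [r lt _|+ _|//]; first by exists r.
  by rewrite ltNge leey.
have [phi [e [mphi e0 tphi]]] :=
  minor_lt_cut hX lcX (potential_ge0 kerG mu) (@potential_lsc _ _ hX lcX _ kerG mu) t2.
have e20 : (0 < e / 2)%R by rewrite divr_gt0.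
pose H x y := G (x, y); pose u x := (phi x - e)%R.
pose v b := (\int[mu]_y b y)%R.
have Hpos x y : 0 <= H x y by exact: kernel_ge0.
have [| | |l gl Kl] := @compact_directed X _ _ (good_list H u v)
    (fun l => [set x | exists2 p, List.In p l & p.1 x])
    (compact_ge_Cc e0 mphi.1).
- by exists [::].
- move=> l1 l2 g1 g2; exists (l1 ++ l2); split.
  + by move=> p /(@List.in_app_or _ l1 l2)[/g1|/g2].
  + by move=> x [p p1 px]; exists p => //; apply: List.in_or_app; left.
  + by move=> x [p p2 px]; exists p => //; apply: List.in_or_app; right.
- move=> x0 ex0.
  have : (phi x0 - e / 2)%:E < potential G mu x0.
    by apply: lt_le_trans (minor_le x0 mphi); rewrite lte_fin ltrBlDr ltrDl.
  move=> /(minor_lt_cut hX lcX (kernel_ge0 kerG x0)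
    (@kernel_section_lsc _ _ _ kerG x0))[psi [d [mpsi d0 lt0]]].
  pose b y := Num.max (psi y - d)%R 0%R.
  have hA : \forall x \near x0,
      [set y | d <= psi y]%R `<=` (fun y => (psi y - d)%:E < G (x, y)).
    exact: kernel_cut_near d0 mpsi.
  have := @filterI _ _ (nbhs_filter x0) _ _ hA (near_lt_add x0 mphi.1 e20).
  rewrite nbhsE /= => -[U [oU Ux0] UA].
  exists [:: (U, b)]; last first.
    by apply: filterS (open_nbhs_nbhs (conj oU Ux0)) => y Uy; exists (U, b) => //; left.
  move=> p [<-|[]]; split => //=.
  + by apply: isCc_cut; [exact: ltW|exact: mpsi.1].
  + by move=> y; rewrite le_max lexx orbT.
  + move=> x y /UA[Ax _]; apply: (@cut_le _ _ (fun y => G (x, y))); first exact: kernel_ge0.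
    by move=> dy; exact/ltW/Ax.
  + move=> x /UA[_ /= hx]; rewrite /u /v; apply/ltW.
    by apply: le_lt_trans lt0; lra.
have [dl _ _ dH du] := @tensor_disjointed H u v l setT measurableT Hpos gl.
move: tphi; apply/negP; rewrite -leNgt -lee_fin.
apply: le_trans t1.
have ccut := isCc_cut (ltW e0) mphi.1.
rewrite EFin_int//.
apply: (@le_trans _ _ (\int[nu]_x (\sum_(p <- disjointed setT l) \1_(p.1) x * v p.2)%R%:E)).
  apply: ge0_integral_le => x; first by rewrite lee_fin le_max lexx orbT.
  apply: (@cut_le _ _ (fun x => (\sum_(p <- disjointed setT l) \1_(p.1) x * v p.2)%R%:E)).
    rewrite lee_fin /v -tensor_int//; apply: Rintegral_ge0 => y _.
    exact: tensor_ge0.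
  by move=> ex; rewrite lee_fin; have [p lp px] := Kl x ex; exact: (du x p lp I px).
rewrite tensor_fubini//; apply: ge0_integral_le => y.
  by apply: integral_ge0 => x _; rewrite lee_fin tensor_ge0.
rewrite /potential; apply: ge0_integral_le => x.
  by rewrite lee_fin tensor_ge0.
by have [_ _ Gsym _] := kerG; rewrite Gsym; exact: dH.
Qed.

Lemma mutual_energyC mu nu :
  \int[nu]_x potential G mu x = \int[mu]_x potential G nu x.
Proof. by apply/eqP; rewrite eq_le !mutual_energy_le. Qed.

End MutualEnergy.

(** * Vague compactness of energy balls *)

Section EnergyCompactness.
Context {R : realType} {X : ptopologicalType}.
Hypothesis hX : hausdorff_space X.
Hypothesis lcX : locally_compact [set: X].
Variable G : X * X -> \bar R.
Hypothesis kerG : is_kernel G.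
Implicit Types (mu nu : radon R X) (phi psi : X -> R) (K U : set X).

Let G0 := kernel_ge0 kerG.
Let pot0 := potential_ge0 kerG.
Let mpot := potential_measurable hX lcX kerG.

Lemma kernel_section_measurable x : measurable_fun [set: borel X] (fun y => G (x, y)).
Proof. by apply: lsc_measurable; exact: kernel_section_lsc. Qed.

Lemma int_radd mu nu (f : X -> \bar R) : (forall x, 0 <= f x) ->
  measurable_fun [set: borel X] f ->
  \int[radd mu nu]_x f x = \int[mu]_x f x + \int[nu]_x f x.
Proof. by move=> f0 mf; apply: ge0_integral_measure_add. Qed.

Lemma int_rscale nu (r : {nonneg R}) (f : X -> \bar R) : (forall x, 0 <= f x) ->
  measurable_fun [set: borel X] f ->
  \int[rscale nu r]_x f x = r%:num%:E * \int[nu]_x f x.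
Proof. by move=> f0 mf; apply: ge0_integral_mscale. Qed.

Lemma potential_radd mu nu x :
  potential G (radd mu nu) x = potential G mu x + potential G nu x.
Proof. by rewrite /potential int_radd//; exact: kernel_section_measurable. Qed.

Lemma potential_rscale nu r x :
  potential G (rscale nu r) x = r%:num%:E * potential G nu x.
Proof. by rewrite /potential int_rscale//; exact: kernel_section_measurable. Qed.

Lemma energy_radd mu nu : energy G (radd mu nu) =
  energy G mu + energy G nu + 2%:E * \int[nu]_x potential G mu x.
Proof.
have i0 (m : radon R X) f : (forall x, 0 <= f x) -> 0 <= \int[m]_x f x.
  by move=> f0; apply: integral_ge0.
rewrite /energy; under eq_integral do rewrite potential_radd.
rewrite int_radd//; last 2 first.
- by move=> x; rewrite adde_ge0.
- exact: emeasurable_funD.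
have D (m : radon R X) : \int[m]_x (potential G mu x + potential G nu x) =
    \int[m]_x potential G mu x + \int[m]_x potential G nu x.
  by rewrite ge0_integralD.
rewrite !D (mutual_energyC hX lcX kerG nu mu).
have -> : 2%:E * \int[nu]_x potential G mu x =
    \int[nu]_x potential G mu x + \int[nu]_x potential G mu x.
  by rewrite -[2%:E]/((1 + 1)%:E) EFinD ge0_muleDl ?lee_fin// mul1e.
move: (\int[mu]_x potential G mu x) (\int[nu]_x potential G mu x)
  (\int[nu]_x potential G nu x) => a b d.
by rewrite -!addeA; congr (_ + _); rewrite addeA addeC.
Qed.

Lemma energy_rscale nu r :
  energy G (rscale nu r) = (r%:num ^+ 2)%:E * energy G nu.
Proof.
rewrite /energy; under eq_integral do rewrite potential_rscale.
rewrite int_rscale//; last 2 first.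
- by move=> x; rewrite mule_ge0// lee_fin.
- by apply: emeasurable_funM => //; exact: measurable_cst.
by rewrite ge0_integralZl// ?lee_fin// muleA -EFinM -expr2.
Qed.

Lemma energy_zero nu : (forall A, nu A = 0) -> energy G nu = 0.
Proof.
move=> nu0; rewrite /energy (@eq_measure_integral _ _ _ _ mzero).
  exact: integral_measure_zero.
by move=> A _ _; rewrite nu0.
Qed.

(** By lower semicontinuity at the diagonal point, [G > e > 0] on [U] times [U], whence
    [e * nu(U)^2] is at most the energy. *)
Lemma mass_near (r : R) x : exists U C, [/\ open U, U x &
  forall nu, energy G nu <= r%:E -> nu U <= C%:E].
Proof.
have [_ lG _ Gx] := kerG.
have [e e0 eG] : exists2 e : R, (0 < e)%R & e%:E < G (x, x).
  move: (Gx x); case: (G (x, x)) => [s||//]; last by exists 1%R; rewrite ?ltry.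
  by rewrite lte_fin => s0; exists (s / 2)%R; rewrite ?lte_fin; lra.
have [V [[A B] /= [xA xB] AB] VG] := lG _ _ eG.
have := @filterI _ _ (nbhs_filter x) _ _ xA xB.
rewrite nbhsE /= => -[U [oU Ux] UAB].
(* Since [C >= 1], [e C^2 >= e C = e + |r| > r], so mass above [C] contradicts the energy bound. *)
pose C := (1 + `|r| / e)%R.
have C1 : (1 <= C)%R by rewrite lerDl divr_ge0// ltW.
exists U, C; split => // nu hE; rewrite leNgt; apply/negP => ltC.
have mU : measurable (U : set (borel X)) by exact: borel_open.
have m1 : measurable_fun [set: borel X] (fun y => (\1_U y)%:E : \bar R).
  by apply/measurable_EFinP; exact: measurable_indic.
have intU (c : \bar R) : 0 <= c -> \int[nu]_y (c * (\1_U y)%:E) = c * nu U.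
  by move=> c0; rewrite ge0_integralZl// integral_indic// setIT.
have potU y : U y -> e%:E * nu U <= potential G nu y.
  move=> Uy; rewrite -intU ?lee_fin ?(ltW e0)// /potential.
  apply: ge0_integral_le => z.
    by rewrite mule_ge0// lee_fin ltW.
  rewrite indicE; have [zU|_] := boolP (z \in U); last by rewrite mule0.
  rewrite mule1; apply/ltW/VG/AB; split => /=; first exact: (UAB _ Uy).1.
  by have /UAB[] := set_mem zU.
have : e%:E * nu U * nu U <= r%:E.
  apply: le_trans hE; rewrite -intU ?mule_ge0 ?lee_fin ?(ltW e0)//.
  apply: ge0_integral_le => y; first by rewrite !mule_ge0// lee_fin ltW.
  rewrite indicE; have [yU|_] := boolP (y \in U); last by rewrite mule0 pot0.
  by rewrite mule1 potU//; exact: set_mem.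
have C0 : (0 <= C)%R by exact: le_trans C1.
apply/negP; rewrite -ltNge; apply: (@lt_le_trans _ _ (e * C * C)%:E).
  rewrite lte_fin; apply: (@lt_le_trans _ _ (e * C)%R).
    rewrite /C mulrDr mulr1 mulrC divfK ?gt_eqF//.
    by rewrite (le_lt_trans (ler_norm r))// ltrDr.
  by rewrite ler_peMr// mulr_ge0// ltW.
rewrite !EFinM; apply: lee_pmul; rewrite ?mule_ge0 ?lee_fin ?(ltW e0)//.
  by apply: lee_wpmul2l; [rewrite lee_fin ltW|exact: ltW].
exact: ltW.
Qed.

Lemma mass_compact (r : R) K : compact K ->
  exists C, forall nu, energy G nu <= r%:E -> nu K <= C%:E.
Proof.
move=> cK; pose D := [set U : set X | open U /\
  exists C, forall nu, energy G nu <= r%:E -> nu U <= C%:E].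
have [| | |U [oU [C hC]] KU] := @compact_directed X K _ D id cK.
- exists set0; split; first exact: open0.
  by exists 0%R => nu _; rewrite measure0.
- move=> U V [oU [C hC]] [oV [C' hC']]; exists (U `|` V); split.
  + split; first exact: openU.
    exists (C + C')%R => nu En; rewrite EFinD.
    apply: (@le_trans _ _ (nu U + nu V)); first by apply: measureU2; exact: borel_open.
    by apply: leeD; [exact: hC|exact: hC'].
  + by move=> x; left.
  + by move=> x; right.
- move=> x _; have [U [C [oU Ux hC]]] := mass_near r x.
  by exists U; [split => //; exists C|exact: open_nbhs_nbhs].
exists C => nu En; apply: le_trans (hC nu En); exact: radon_le.
Qed.

Lemma int_Cc_bounded (r : R) phi : isCc phi ->
  exists M : R, forall nu, energy G nu <= r%:E ->
    (- M <= \int[nu]_x phi x <= M)%R.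
Proof.
move=> cp; have [M M0 pM] := isCc_bounded cp.
have [chi [cchi chi01 chi1 _]] :=
  @urysohn_Cc R _ hX lcX _ _ cp.2 openT (@subsetT _ _).
have [C hC] := mass_compact r cchi.2.
have chi0 x : (0 <= chi x)%R by have /andP[] := chi01 x.
exists (M * C)%R => nu En.
have posI := int_pos_linear hX nu; have [_ LZ _] := posI.
have chiC : (\int[nu]_x chi x <= C)%R.
  rewrite -lee_fin EFin_int//; apply: le_trans (hC nu En).
  rewrite -[X in nu X]setIT -integral_indic//; last exact: borel_compact cchi.2.
  apply: ge0_integral_le => x; rewrite lee_fin// indicE.
  have [cx|cx] := eqVneq (chi x) 0%R; first by rewrite cx.
  by rewrite mem_set; [have /andP[] := chi01 x|exact: subset_closure].
have phi_chi x : (- M * chi x <= phi x <= M * chi x)%R.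
  have [px|px] := eqVneq (phi x) 0%R.
    by rewrite px mulNr oppr_le0 !mulr_ge0// ltW.
  rewrite chi1 ?mulr1; last exact: subset_closure.
  by rewrite -ler_norml.
have MC : (\int[nu]_x (M * chi x) <= M * C)%R.
  have -> : (\int[nu]_x (M * chi x) = M * \int[nu]_x chi x)%R by exact: LZ.
  by rewrite ler_pM2l.
apply/andP; split.
  have : (\int[nu]_x (- M * chi x) <= \int[nu]_x phi x)%R.
    apply: (pos_linear_le posI) => //; first exact: isCcZ.
    by move=> x; have /andP[] := phi_chi x.
  apply: le_trans.
  have -> : (\int[nu]_x (- M * chi x) = - M * \int[nu]_x chi x)%R by exact: LZ.
  by rewrite mulNr lerN2 ler_pM2l.
apply: le_trans MC; apply: (pos_linear_le posI) => //; first exact: isCcZ.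
by move=> x; have /andP[] := phi_chi x.
Qed.

Lemma energy_ball_compact (r : R) :
  compact ([set nu | energy G nu <= r%:E] : set (vague R X)).
Proof.
rewrite compact_ultra => F UF FE; have PF : ProperFilter F by exact: ultra_proper.
have ex phi : exists l : R, isCc phi ->
    (fun nu : vague R X => (\int[(nu : radon R X)]_x phi x)%R) @ F --> l.
  have [cp|ncp] := pselect (isCc phi); last by exists 0%R.
  have [M hM] := int_Cc_bounded r cp.
  have [|l hl] := @ultra_segment R _ F
    (fun nu : vague R X => (\int[(nu : radon R X)]_x phi x)%R) (- M)%R M UF.
    by apply: filterS FE => nu; exact: hM.
  by exists l.
have [L hL] := choice ex.
have uniq (u : vague R X -> R) (a b : R) : u @ F --> a -> u @ F --> b -> a = b.
  by move=> ua ub; rewrite -(cvg_lim _ ua)// -(cvg_lim _ ub).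
have posL : pos_linear L.
  split.
  - move=> phi psi cp cq; apply: (uniq _ _ _ (hL _ (isCcD cp cq))).
    rewrite (_ : (fun nu : vague R X => _) = (fun nu : vague R X =>
      (\int[(nu : radon R X)]_x phi x + \int[(nu : radon R X)]_x psi x)%R)).
      by apply: cvgD; exact: hL.
    apply/funext => nu; have [LD _ _] := int_pos_linear hX (nu : radon R X).
    exact: LD.
  - move=> a phi cp; apply: (uniq _ _ _ (hL _ (isCcZ a cp))).
    rewrite (_ : (fun nu : vague R X => _) = (fun nu : vague R X =>
      (a * \int[(nu : radon R X)]_x phi x)%R)).
      by apply: cvgM; [exact: cvg_cst|exact: hL].
    apply/funext => nu; have [_ LZ _] := int_pos_linear hX (nu : radon R X).
    exact: LZ.
  - move=> phi cp p0; rewrite -(cvg_lim _ (hL _ cp))//.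
    apply: limr_ge; first by apply: cvgP (hL _ cp).
    by apply: nearW => nu; apply: Rintegral_ge0.
have [nu hnu] := riesz_representation hX lcX posL.
have cvnu : F --> (nu : vague R X).
  by apply: cvg_vague => phi cp; rewrite hnu//; exact: hL.
exists nu; split => //=; rewrite leNgt; apply/negP => lt.
have := cvnu _ (energy_lsc hX lcX kerG (nu0 := nu) lt) => Flt.
have [m [/= h1 h2]] := filter_ex (@filterI _ F _ _ _ FE Flt).
by move: h2; rewrite ltNge h1.
Qed.

End EnergyCompactness.

(** * Capacity *)

Section Capacity.
Context {R : realType} {X : ptopologicalType}.
Hypothesis hX : hausdorff_space X.
Hypothesis lcX : locally_compact [set: X].
Variable G : X * X -> \bar R.
Hypothesis kerG : is_kernel G.
Implicit Types (mu nu : radon R X) (f g h : X -> \bar R) (phi psi : X -> R).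

Lemma Eplus1P nu : Eplus1 G nu <-> energy G nu <= 1.
Proof.
rewrite /Eplus1 /= /norm -/(energy G nu).
have {1}<- : sqrte (1 : \bar R) = 1 by rewrite /= sqrtr1.
by rewrite lee_sqrt.
Qed.

Lemma EplusP nu : Eplus G nu <-> energy G nu \is a fin_num.
Proof.
rewrite /Eplus /= -(sqrte_fin_num (energy_ge0 kerG nu)) ge0_fin_numE//.
exact: sqrte_ge0.
Qed.

Lemma Eplus1_Eplus : Eplus1 G `<=` Eplus G.
Proof. by move=> nu h; rewrite /Eplus/= (le_lt_trans h)// ltry. Qed.

Lemma C0plus_Cc phi : isCc phi -> (forall x, 0 <= phi x)%R ->
  C0plus (fun x => (phi x)%:E).
Proof. by move=> cp p0; apply/C0plusP; exists phi. Qed.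

Lemma Gplus_measurable g : Gplus g -> measurable_fun [set: borel X] g.
Proof. by move=> [_ lg]; exact: lsc_measurable. Qed.

Lemma GplusD g1 g2 : Gplus g1 -> Gplus g2 -> Gplus (fun x => g1 x + g2 x).
Proof.
move=> [p1 l1] [p2 l2]; split; first by move=> x; rewrite adde_ge0.
by apply: lscD => // x; rewrite (lt_le_trans ltNy0).
Qed.

Lemma GplusZ (a : R) g : (0 < a)%R -> Gplus g -> Gplus (fun x => a%:E * g x).
Proof.
move=> a0 [p l]; split; first by move=> x; rewrite mule_ge0 ?p// lee_fin ltW.
move=> x b; rewrite -lte_pdivrMl// -EFinM => /l[V xV Vg]; exists V => // y Vy.
by rewrite -lte_pdivrMl// -EFinM; exact: Vg.
Qed.

Lemma Gplus_series (g : nat -> X -> \bar R) : (forall n, Gplus (g n)) ->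
  Gplus (fun x => \sum_(n <oo) g n x).
Proof.
move=> Gg; have g0 n x : 0 <= g n x by have [+ _] := Gg n; exact.
split; first by move=> x; apply: nneseries_ge0 => n _ _.
move=> x a lt.
have [N aN] : exists N, a%:E < \sum_(0 <= n < N) g n x.
  apply: contrapT => /forallNP h; move: lt; apply/negP; rewrite -leNgt.
  apply: lime_le; first by apply: is_cvg_nneseries => n _ _.
  by apply: nearW => N; rewrite leNgt; exact/negP.
have [_ lN] : Gplus (fun x => \sum_(0 <= n < N) g n x).
  elim: N {aN} => [|N ih].
    under eq_fun do rewrite big_nil.
    by apply: (C0plus_Cc isCc_cst0 (fun=> lexx _)).1.
  by under eq_fun do rewrite big_nat_recr//=; exact: GplusD.
have [V xV VN] := lN _ _ aN; exists V => // y Vy.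
apply: lt_le_trans (VN y Vy) _; exact: nneseries_lim_ge.
Qed.

Lemma cap_C0_ub f nu : Eplus1 G nu -> \int[nu]_x f x <= cap_C0 G f.
Proof. by move=> E1; apply: ereal_sup_ubound; exists nu. Qed.

Lemma Eplus1_zero : exists2 nu, Eplus1 G nu & forall A, nu A = 0.
Proof.
have [nu nu0] := @radon_zero R X hX lcX; exists nu => //.
by apply/Eplus1P; rewrite energy_zero.
Qed.

Lemma cap_C0_ge0 f : (forall x, 0 <= f x) -> 0 <= cap_C0 G f.
Proof.
move=> f0; have [nu E1 _] := Eplus1_zero.
by apply: le_trans (cap_C0_ub f E1); apply: integral_ge0.
Qed.

Lemma cap_C0_le f g : (forall x, 0 <= f x) -> (forall x, f x <= g x) ->
  cap_C0 G f <= cap_C0 G g.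
Proof.
move=> f0 fg; apply: ge_ereal_sup => _ [nu E1 <-].
by apply: le_trans (cap_C0_ub g E1); exact: ge0_integral_le.
Qed.

Lemma cap_C0D f g : (forall x, 0 <= f x) -> (forall x, 0 <= g x) ->
  measurable_fun [set: borel X] f -> measurable_fun [set: borel X] g ->
  cap_C0 G (fun x => f x + g x) <= cap_C0 G f + cap_C0 G g.
Proof.
move=> f0 g0 mf mg; apply: ge_ereal_sup => _ [nu E1 <-].
by rewrite ge0_integralD// leeD//; exact: cap_C0_ub.
Qed.

Lemma cap_C0Z (a : R) f : (0 < a)%R -> (forall x, 0 <= f x) ->
  measurable_fun [set: borel X] f ->
  cap_C0 G (fun x => a%:E * f x) <= a%:E * cap_C0 G f.
Proof.
move=> a0 f0 mf; apply: ge_ereal_sup => _ [nu E1 <-].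
rewrite ge0_integralZl ?lee_fin ?(ltW a0)//.
by rewrite lee_wpmul2l ?lee_fin ?(ltW a0)//; exact: cap_C0_ub.
Qed.

(** Integration against each single measure is countably additive on [Gplus]; the supremum turns
    this into countable subadditivity. *)
Lemma cap_C0_series (g : nat -> X -> \bar R) : (forall n, Gplus (g n)) ->
  cap_C0 G (fun x => \sum_(n <oo) g n x) <= \sum_(n <oo) cap_C0 G (g n).
Proof.
move=> Gg; apply: ge_ereal_sup => _ [nu E1 <-].
rewrite integral_nneseries//; last 2 first.
- by move=> n; exact: Gplus_measurable.
- by move=> n x _; have [+ _] := Gg n; exact.
apply: lee_nneseries => n _; last exact: cap_C0_ub.
by move=> _; apply: integral_ge0 => x _; have [+ _] := Gg n; exact.
Qed.

Lemma cap_C0_Cc phi : isCc phi -> cap_C0 G (fun x => (phi x)%:E) < +oo.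
Proof.
move=> cp; have [M hM] := int_Cc_bounded hX lcX kerG 1 cp.
apply: (@le_lt_trans _ _ M%:E); last exact: ltry.
apply: ge_ereal_sup => _ [nu /Eplus1P E1 <-].
by rewrite -EFin_int// lee_fin; have /andP[] := hM nu E1.
Qed.

(** Integrals of l.s.c. functions are suprema over [C_c] minorants, and two suprema commute. *)
Lemma cap_G_E g : Gplus g -> cap_G G g = cap_C0 G g.
Proof.
move=> [g0 lg]; apply/eqP; rewrite eq_le; apply/andP; split.
  by apply: ge_ereal_sup => _ [f [[[f0 _] _] fg] <-]; exact: cap_C0_le.
apply: ge_ereal_sup => _ [nu E1 <-]; rewrite (integral_lsc hX lcX)//.
apply: ge_ereal_sup => _ [phi mphi <-].
apply: le_trans (cap_C0_ub (fun x => (phi x)%:E) E1) _.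
apply: ereal_sup_ubound; exists (fun x => (phi x)%:E) => //; split.
  by apply: C0plus_Cc; [exact: mphi.1|move=> x; exact: minor_ge0 mphi].
by move=> x; exact: minor_le mphi.
Qed.

Lemma energy_ball_vague : compact (Eplus1 G : set (vague R X)).
Proof.
rewrite (_ : Eplus1 G = [set nu | energy G nu <= 1%:E]).
  exact: energy_ball_compact.
by apply/seteqP; split => nu /Eplus1P.
Qed.

(** A minimax statement: the infimum over continuous majorants and the supremum over measures are
    exchanged. Each measure of the unit ball has a majorant [phi] of [h] with integral below [c],
    and the same [phi] serves nearby measures; majorants are directed under minimum and the ball is
    vaguely compact, so one [phi] serves all. *)
Lemma cap_H0_E h : H0 h -> cap_H0 G h = cap_C0 G h.
Proof.
move=> H; have h0 x := H0_ge0 x H.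
apply/eqP; rewrite eq_le; apply/andP; split; last first.
  by apply: le_ereal_inf_tmp => _ [f [_ hf] <-]; exact: cap_C0_le.
have [->|fin] := eqVneq (cap_C0 G h) +oo; first by rewrite leey.
have fc : cap_C0 G h \is a fin_num by rewrite ge0_fin_numE ?cap_C0_ge0// ltey.
apply/lee_addgt0Pr => e e0; pose c := (fine (cap_C0 G h) + e)%R.
have cE : cap_C0 G h + e%:E = c%:E by rewrite EFinD fineK.
pose D := [set phi | [/\ isCc phi, forall x, (0 <= phi x)%R &
                        forall x, h x <= (phi x)%:E]].
have [phi0 [cp0 p0 hp0]] := H0_majorant hX lcX H.
have [| | |phi [cp pp hp] E1phi] := @compact_directed (vague R X) _ _ D
  (fun phi => [set nu : vague R X | \int[(nu : radon R X)]_x phi x <= c]%R)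
  energy_ball_vague.
- by exists phi0.
- move=> p q [cp pp hp] [cq qq hq]; exists (fun x => Num.min (p x) (q x)).
  have cpq := isCc_min cp cq; split.
  + split => // x; first by rewrite le_min pp qq.
    by case: (leP (p x) (q x)).
  + move=> nu; apply: le_trans.
    apply: (pos_linear_le (int_pos_linear hX (nu : radon R X))) => // x.
    by rewrite ge_min lexx.
  + move=> nu; apply: le_trans.
    apply: (pos_linear_le (int_pos_linear hX (nu : radon R X))) => // x.
    by rewrite ge_min lexx orbT.
- move=> nu E1; have : \int[(nu : radon R X)]_x h x < c%:E.
    by rewrite -cE (le_lt_trans (cap_C0_ub h E1))// lteDl ?lte_fin.
  move=> /(H0_int_lt hX lcX H)[phi [cp pp hp lt]]; exists phi; first by split.
  have cphi := @vague_continuous R X phi cp nu.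
  have := cvgr_lt _ cphi c lt => /(_ (nbhs_filter _)).
  by apply: filterS => mu /ltW.
apply: (@le_trans _ _ (cap_C0 G (fun x => (phi x)%:E))).
  apply: ereal_inf_lbound; exists (fun x => (phi x)%:E) => //; split => //.
  exact: C0plus_Cc.
rewrite cE; apply: ge_ereal_sup => _ [nu E1 <-].
by rewrite -EFin_int// lee_fin; exact: E1phi.
Qed.

Lemma cap_upperE f : cap_upper G f =
  ereal_inf [set cap_C0 G g | g in [set g | Gplus g /\ forall x, f x <= g x]].
Proof.
congr ereal_inf; apply/seteqP; split => _ [g [Gg fg] <-]; exists g => //.
  by rewrite cap_G_E.
by rewrite cap_G_E.
Qed.

Lemma cap_upper_lb f g : Gplus g -> (forall x, f x <= g x) ->
  cap_upper G f <= cap_C0 G g.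
Proof. by move=> Gg fg; rewrite cap_upperE; apply: ereal_inf_lbound; exists g. Qed.

Lemma cap_upper_lt f c : cap_upper G f < c ->
  exists g, [/\ Gplus g, forall x, f x <= g x & cap_C0 G g < c].
Proof. by rewrite cap_upperE => /ereal_inf_lt[_ [g [Gg fg] <-] lt]; exists g. Qed.

Lemma cap_upper_ge f : (forall x, 0 <= f x) -> cap_C0 G f <= cap_upper G f.
Proof.
move=> f0; rewrite cap_upperE; apply: le_ereal_inf_tmp => _ [g [_ fg] <-].
exact: cap_C0_le.
Qed.

Lemma cap_lower_le f : (forall x, 0 <= f x) -> cap_lower G f <= cap_C0 G f.
Proof.
move=> f0; apply: ge_ereal_sup => _ [h [H hf] <-]; rewrite cap_H0_E//.
by apply: cap_C0_le => // x; exact: H0_ge0.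
Qed.

Lemma cap_lower_ub f h : H0 h -> (forall x, h x <= f x) ->
  cap_C0 G h <= cap_lower G f.
Proof.
by move=> H hf; rewrite -cap_H0_E//; apply: ereal_sup_ubound; exists h.
Qed.

(* Scaling [nu] into the unit ball by any [m > 0] above [n]; the slack covers the
   measures of zero energy. *)
Lemma int_le_cap g nu (c n : R) : Gplus g -> (0 <= c)%R -> (0 <= n)%R ->
  cap_C0 G g <= c%:E -> energy G nu <= (n ^+ 2)%:E ->
  \int[nu]_x g x <= (c * n)%:E.
Proof.
move=> Gg c0 n0 gc En; have [g0 _] := Gg.
suff h (m : R) : (0 < m)%R -> (n <= m)%R -> \int[nu]_x g x <= (c * m)%:E.
  apply/lee_addgt0Pr => e e0.
  have c1 : (0 < c + 1)%R by rewrite ltr_wpDl.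
  apply: le_trans (h (n + e / (c + 1))%R _ _) _.
  - by rewrite ltr_wpDl// divr_gt0.
  - by rewrite lerDl divr_ge0// ltW.
  - rewrite -EFinD lee_fin mulrDr lerD2l mulrA ler_pdivrMr//.
    by rewrite mulrC ler_pM2l// lerDl.
move=> m0 nm; have mi0 : (0 <= m^-1)%R by rewrite invr_ge0 ltW.
pose r : {nonneg R} := NngNum mi0.
have E1 : Eplus1 G (rscale nu r).
  apply/Eplus1P; rewrite (energy_rscale hX lcX kerG).
  apply: (@le_trans _ _ ((m^-1 ^+ 2)%:E * (n ^+ 2)%:E)).
    by rewrite lee_wpmul2l// lee_fin sqr_ge0.
  rewrite -EFinM lee_fin -exprMn expr_le1// ?mulr_ge0//.
  by rewrite mulrC ler_pdivrMr// mul1r.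
have := le_trans (cap_C0_ub g E1) gc.
rewrite int_rscale//; last exact: Gplus_measurable.
by rewrite /= lee_pdivrMl// -EFinM mulrC.
Qed.

Lemma energy_bound nu : Eplus G nu ->
  exists2 n : R, (0 <= n)%R & energy G nu = (n ^+ 2)%:E.
Proof.
move=> /EplusP fE; exists (Num.sqrt (fine (energy G nu))); first exact: sqrtr_ge0.
by rewrite sqr_sqrtr ?fineK// fine_ge0// energy_ge0.
Qed.

End Capacity.

(** * Null sets of measures and of the capacity *)

Section AlmostEverywhere.
Context d (T : measurableType d) {R : realType} (mu : {measure set T -> \bar R}).

(** Stated without measurability, so as to apply to [f]: each simple function below [f1] is cut off
    on a measurable null set containing the exceptional points, and is then below [f2]. *)
Lemma ge0_ae_le_integral (f1 f2 : T -> \bar R) :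
  (forall x, 0 <= f1 x) -> (forall x, 0 <= f2 x) ->
  {ae mu, forall x, f1 x <= f2 x} -> \int[mu]_x f1 x <= \int[mu]_x f2 x.
Proof.
move=> f10 f20 [N [mN N0 hN]].
rewrite [leLHS]ge0_integralTE//; apply: ge_ereal_sup => _ [s /= sf <-].
rewrite -integralT_nnsfun.
have ms : measurable_fun setT (fun x => (s x)%:E).
  by apply/measurable_EFinP; exact: measurable_funPT.
have s0 x : 0 <= (s x)%:E by rewrite lee_fin; exact: fun_ge0.
rewrite (ge0_negligible_integral mN measurableT ms _ N0)//.
rewrite integral_mkcond; apply: ge0_integral_le => x.
  by rewrite patchE; case: ifP.
rewrite patchE; case: ifP => // /set_mem[_ Nx].
apply: le_trans (sf x) _; apply: contrapT => nle; apply: Nx; exact: hN.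
Qed.

End AlmostEverywhere.

Section NullSets.
Context {R : realType} {X : ptopologicalType}.
Hypothesis hX : hausdorff_space X.
Hypothesis lcX : locally_compact [set: X].
Variable G : X * X -> \bar R.
Hypothesis kerG : is_kernel G.
Implicit Types (mu nu : radon R X) (f g h : X -> \bar R) (N : set X).

(** [nu N] is the outer measure of an arbitrary set, so open sets of measure tending to 0 contain
    [N]; their countable intersection is a Borel null set. *)
Lemma radon_negligible nu N : nu N = 0 -> nu.-negligible N.
Proof.
move=> N0.
have ex (k : nat) : exists U : set X, [/\ open U, N `<=` U & nu U <= (k.+1%:R^-1)%:E].
  have : ereal_inf [set nu U | U in [set U : set X | open U /\ N `<=` U]] < (k.+1%:R^-1)%:E.
    by rewrite -radon_outer N0 lte_fin invr_gt0.
  move=> /ereal_inf_lt[_ [U [oU NU] <-] lt].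
  by exists U; split => //; exact: ltW.
have [U hU] := choice ex.
exists (\bigcap_k U k); split.
- apply: bigcap_measurableType => k _; apply: borel_open; by have [] := hU k.
- apply/eqP; rewrite eq_le measure_ge0 andbT; apply/lee_addgt0Pr => e e0.
  rewrite add0e; apply: (@le_trans _ _ ((Num.bound e^-1).+1%:R^-1)%:E).
    have [_ _] := hU (Num.bound e^-1); apply: le_trans.
    by apply: radon_le => x; apply.
  rewrite lee_fin invf_ple ?posrE//; apply/ltW; apply: lt_trans (archi_boundP _) _.
    by rewrite invr_ge0 ltW.
  by rewrite ltr_nat.
- by move=> x Nx k _; have [_ NU _] := hU k; exact: NU.
Qed.

Lemma markov_open nu g (a : R) : (0 < a)%R -> Gplus g ->
  nu [set x | a%:E < g x] <= a^-1%:E * \int[nu]_x g x.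
Proof.
move=> a0 [g0 lg].
have oU : open [set x | a%:E < g x] by move/lower_semicontinuousP : lg; exact.
have mU : measurable ([set x | a%:E < g x] : set (borel X)) by apply: borel_open.
rewrite lee_pdivlMl// -[X in nu X]setIT -integral_indic//.
rewrite -ge0_integralZl//; last 2 first.
- by apply/measurable_EFinP; exact: measurable_indic.
- by rewrite lee_fin ltW.
apply: ge0_integral_le => x; first by rewrite mule_ge0// lee_fin ltW.
rewrite indicE; have [xU|_] := boolP (x \in _); last by rewrite mule0 g0.
by rewrite mule1; exact: ltW (set_mem xU).
Qed.

Lemma indic_le (N : set X) (x : X) (y : \bar R) : 0 <= y -> (N x -> 1 <= y) ->
  (\1_N x)%:E <= y.
Proof.
move=> y0 h; rewrite indicE; have [xN|_] := boolP (x \in N); last exact: y0.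
by apply: h; exact: set_mem.
Qed.

Lemma cap_null_mass nu N : cap_upper_set G N = 0 -> Eplus G nu -> nu N = 0.
Proof.
move=> N0 /(energy_bound kerG)[n n0 En].
apply/eqP; rewrite eq_le measure_ge0 andbT; apply/lee_addgt0Pr => e e0.
rewrite add0e; pose d := (e / (2 * (n + 1)))%R.
have n1 : (0 < n + 1)%R by rewrite ltr_wpDl.
have d0 : (0 < d)%R by rewrite divr_gt0// mulr_gt0.
have : cap_upper G (fun x => (\1_N x)%:E) < d%:E by rewrite [ltLHS]N0 lte_fin.
move=> /(cap_upper_lt hX lcX)[g [Gg Ng gd]].
(* [g >= 1] on [N], while the Markov bound is for strict superlevel sets, hence the threshold 1/2
   and the factor 2 in [d]. *)
apply: (@le_trans _ _ (nu [set x | (2^-1)%:E < g x])).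
  apply: radon_le => x Nx /=; apply: (@lt_le_trans _ _ (\1_N x)%:E); last exact: Ng.
  by rewrite indicE mem_set// lte_fin /=; lra.
have half : (0 < 2^-1 :> R)%R by [].
apply: le_trans (markov_open nu half Gg) _.
rewrite invrK; apply: (@le_trans _ _ (2%:E * (d * n)%:E)).
  rewrite lee_wpmul2l ?lee_fin//.
  by apply: (int_le_cap hX lcX kerG Gg (ltW d0) n0 (ltW gd)); rewrite En.
rewrite -EFinM lee_fin /d.
have -> : (2 * (e / (2 * (n + 1)) * n) = e * (n / (n + 1)))%R.
  by field; rewrite gt_eqF.
by rewrite ler_piMr ?(ltW e0)// ler_pdivrMr// mul1r lerDl.
Qed.

Lemma cap_null_ae nu (P : X -> Prop) : quasi_everywhere G P -> Eplus G nu ->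
  {ae nu, forall x, P x}.
Proof. by move=> qP Enu; apply: radon_negligible; exact: cap_null_mass. Qed.

(** The sum of majorants of capacity [e / 2^(k+1)] is an l.s.c. majorant of [1_N] of capacity at
    most [e]. *)
Lemma cap_upper_set_bigcup (E : nat -> set X) N : N `<=` \bigcup_k E k ->
  (forall k (e : R), (0 < e)%R -> exists g,
    [/\ Gplus g, forall x, E k x -> 1 <= g x & cap_C0 G g <= e%:E]) ->
  cap_upper_set G N = 0.
Proof.
move=> NE hE; apply/eqP; rewrite eq_le; apply/andP; split; last first.
  apply: (@le_trans _ _ (cap_C0 G (fun x => (\1_N x)%:E))); last first.
    by apply: cap_upper_ge => // x; rewrite lee_fin.
  by apply: (cap_C0_ge0 hX lcX) => x; rewrite lee_fin.
apply/lee_addgt0Pr => e e0; rewrite add0e.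
have ex k : exists g, [/\ Gplus g, forall x, E k x -> 1 <= g x &
    cap_C0 G g <= (e / (2 ^ k.+1)%:R)%:E].
  by apply: hE; rewrite divr_gt0// ltr0n expn_gt0.
have [g hg] := choice ex.
have Gg k : Gplus (g k) by have [] := hg k.
have g0 k x : 0 <= g k x by have [+ _] := Gg k; exact.
rewrite /cap_upper_set; apply: le_trans (cap_upper_lb hX lcX G (Gplus_series Gg) _) _.
  move=> x; apply: indic_le; first by apply: nneseries_ge0 => n _ _.
  move=> /NE[k _ Ekx]; have [_ /(_ x Ekx) gk _] := hg k; apply: le_trans gk _.
  apply: le_trans (@nneseries_lim_ge _ (g^~ x) xpredT 0 k.+1 _); last by move=> n _ _.
  by rewrite big_nat_recr//= leeDr// sume_ge0.
apply: le_trans (cap_C0_series G Gg) _.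
apply: le_trans (epsilon_trick0 xpredT (ltW e0)).
apply: lee_nneseries => k _; last by have [] := hg k.
by move=> _; apply: (cap_C0_ge0 hX lcX).
Qed.

End NullSets.

(** * Functions of [H0star] *)

Section ApproximableFunctions.
Context {R : realType} {X : ptopologicalType}.
Hypothesis hX : hausdorff_space X.
Hypothesis lcX : locally_compact [set: X].
Variable G : X * X -> \bar R.
Hypothesis kerG : is_kernel G.
Implicit Types (mu nu : radon R X) (g h : X -> \bar R).
Variable f : X -> \bar R.
Hypothesis hf : H0star G f.

Lemma H0star_ge0 x : 0 <= f x.
Proof. by have [+ _] := hf; exact. Qed.

Lemma H0star_approx (e : R) : (0 < e)%R -> exists h g,
  [/\ H0 h, forall x, h x <= f x, Gplus g, forall x, f x <= h x + g x &
      cap_C0 G g <= e%:E].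
Proof.
move=> e0; have [_ inf0] := hf.
have : ereal_inf [set cap_upper G (fun x => f x - h x) | h in
    [set h | H0 h /\ forall x, h x <= f x]] < e%:E by rewrite inf0 lte_fin.
move=> /ereal_inf_lt[_ [h [H hlef] <-]] /(cap_upper_lt hX lcX)[g [Gg fhg lt]].
exists h, g; split => //; last exact: ltW.
by move=> x; have := fhg x; rewrite leeBlDl// H0_fin.
Qed.

Lemma int_approx nu (e n : R) h g : (0 < e)%R -> (0 <= n)%R -> H0 h ->
  Gplus g -> (forall x, f x <= h x + g x) -> cap_C0 G g <= e%:E ->
  energy G nu <= (n ^+ 2)%:E ->
  \int[nu]_x f x <= \int[nu]_x h x + (e * n)%:E.
Proof.
move=> e0 n0 H Gg fhg ge En; have h0 x := H0_ge0 x H; have [g0 _] := Gg.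
apply: (@le_trans _ _ (\int[nu]_x (h x + g x))).
  by apply: ge0_integral_le => // x; exact: H0star_ge0.
rewrite ge0_integralD//; [|exact: H0_measurable|exact: Gplus_measurable].
by rewrite leeD2l//; apply: (int_le_cap hX lcX kerG Gg (ltW e0) n0).
Qed.

Lemma H0_int_fin nu h : H0 h -> \int[nu]_x h x \is a fin_num.
Proof.
move=> H; have h0 x := H0_ge0 x H; have [phi [cp p0 hp]] := H0_majorant hX lcX H.
rewrite ge0_fin_numE; last exact: integral_ge0.
apply: (@le_lt_trans _ _ (\int[nu]_x (phi x)%:E)); first exact: ge0_integral_le.
by rewrite -EFin_int// ltry.
Qed.

Lemma H0star_int_fin nu : Eplus G nu -> \int[nu]_x f x \is a fin_num.
Proof.
move=> /(energy_bound kerG)[n n0 En].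
have [h [g [H hlef Gg fhg ge]]] := H0star_approx ltr01.
rewrite ge0_fin_numE; last by apply: integral_ge0 => x _; exact: H0star_ge0.
apply: le_lt_trans (int_approx ltr01 n0 H Gg fhg ge _) _; first by rewrite En.
by rewrite -(fineK (H0_int_fin nu H)) -EFinD ltry.
Qed.

(** [F] is the supremum of a sequence of [H0] minorants whose defects have capacity at most
    [1/(k+1)]; these defects contribute at most [n/(k+1)] to an integral against a measure of energy
    norm [n]. [F] stands in for [f] wherever measurability is required. *)
Lemma H0star_borel : exists F : X -> \bar R,
  [/\ measurable_fun [set: borel X] F, forall x, 0 <= F x, forall x, F x <= f x &
      forall nu, Eplus G nu -> \int[nu]_x F x = \int[nu]_x f x].
Proof.
have ex k : exists hg : (X -> \bar R) * (X -> \bar R),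
  [/\ H0 hg.1, forall x, hg.1 x <= f x, Gplus hg.2, forall x, f x <= hg.1 x + hg.2 x &
      cap_C0 G hg.2 <= (k.+1%:R^-1)%:E].
  have k0 : (0 < k.+1%:R^-1 :> R)%R by rewrite invr_gt0.
  by have [h [g ?]] := H0star_approx k0; exists (h, g).
have [hg hhg] := choice ex.
pose F x := esups (fun k => (hg k).1 x) 0%N.
have hF k x : (hg k).1 x <= F x.
  by apply: ereal_sup_ubound; exists k.
have F0 x : 0 <= F x.
  by apply: le_trans (hF 0%N x); apply: H0_ge0; have [] := hhg 0%N.
have Ff x : F x <= f x.
  by apply: ge_ereal_sup => _ [k _ <-]; have [_ + _ _ _] := hhg k; exact.
exists F; split => //.
  by apply: measurable_fun_esups => k; apply: H0_measurable; have [] := hhg k.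
move=> nu /(energy_bound kerG)[n n0 En].
apply/eqP; rewrite eq_le; apply/andP; split; first exact: ge0_integral_le.
apply/lee_addgt0Pr => e e0.
have n1 : (0 < n + 1)%R by rewrite ltr_wpDl.
pose k := Num.bound ((n + 1) / e).
have [H hlef Gg fhg ge] := hhg k.
have k0 : (0 < k.+1%:R^-1 :> R)%R by rewrite invr_gt0.
apply: le_trans (int_approx k0 n0 H Gg fhg ge _) _; first by rewrite En.
apply: leeD; first by apply: ge0_integral_le => // x; exact: H0_ge0.
rewrite lee_fin mulrC ler_pdivrMr// mulrC -ler_pdivrMr//.
apply: (@le_trans _ _ ((n + 1) / e)%R).
  by rewrite ler_pM2r ?invr_gt0// lerDl.
apply/ltW; apply: lt_trans (archi_boundP _) _; first by rewrite divr_ge0// ltW.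
by rewrite ltr_nat.
Qed.

Lemma H0star_usc (nu0 : vague R X) (n t : R) : (0 <= n)%R ->
  energy G (nu0 : radon R X) <= (n ^+ 2)%:E ->
  \int[(nu0 : radon R X)]_x f x < t%:E ->
  \forall nu \near nu0, energy G (nu : radon R X) <= (n ^+ 2)%:E ->
    \int[(nu : radon R X)]_x f x < t%:E.
Proof.
move=> n0 En lt.
have E0 : Eplus G (nu0 : radon R X).
  by apply/(EplusP kerG); rewrite ge0_fin_numE ?energy_ge0// (le_lt_trans En)// ltry.
have fin := H0star_int_fin E0.
pose a := fine (\int[(nu0 : radon R X)]_x f x).
have at_ : (a < t)%R by rewrite -lte_fin fineK.
(* On the ball of radius [n] the remainder then costs less than half of the gap [t - a]; the other
   half is left for [h]. *)
pose e := ((t - a) / 2 / (n + 1))%R.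
have n1 : (0 < n + 1)%R by rewrite ltr_wpDl.
have e0 : (0 < e)%R by rewrite !divr_gt0// subr_gt0.
have en : (e * n < (t - a) / 2)%R.
  rewrite /e mulrAC ltr_pdivrMr// ltr_pM2l ?divr_gt0 ?subr_gt0//.
  by rewrite ltrDl.
have [h [g [H hlef Gg fhg ge]]] := H0star_approx e0.
have : \int[(nu0 : radon R X)]_x h x < ((t + a) / 2)%:E.
  apply: (@le_lt_trans _ _ (\int[(nu0 : radon R X)]_x f x)).
    by apply: ge0_integral_le => // x; exact: H0_ge0.
  by rewrite -(fineK fin) lte_fin -/a; lra.
move=> /(H0_int_lt hX lcX H)[phi [cp pp hp lt']].
have cphi := @vague_continuous R X phi cp nu0.
have := cvgr_lt _ cphi ((t + a) / 2)%R lt' => /(_ (nbhs_filter _)).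
apply: filterS => nu plt Enu.
apply: le_lt_trans (int_approx e0 n0 H Gg fhg ge Enu) _.
apply: (@le_lt_trans _ _ ((\int[(nu : radon R X)]_x phi x)%R%:E + (e * n)%:E)).
  by rewrite leeD2r// EFin_int//; apply: ge0_integral_le => // x; exact: H0_ge0.
by rewrite -EFinD lte_fin; lra.
Qed.

Lemma H0star_cap_lty : cap_C0 G f < +oo.
Proof.
have [h [g [H hlef Gg fhg ge]]] := H0star_approx ltr01.
have [phi [cp p0 hp]] := H0_majorant hX lcX H.
have [g0 _] := Gg; have h0 x := H0_ge0 x H.
apply: (@le_lt_trans _ _ (cap_C0 G (fun x => (phi x)%:E + g x))).
  apply: cap_C0_le => [x|x]; first exact: H0star_ge0.
  by apply: le_trans (fhg x) _; rewrite leeD2r.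
have p0' x : 0 <= (phi x)%:E by rewrite lee_fin.
apply: le_lt_trans (cap_C0D G p0' g0 (Cc_EFin_measurable cp) (Gplus_measurable Gg)) _.
rewrite lte_add_pinfty//; first exact: (cap_C0_Cc hX lcX kerG).
by rewrite (le_lt_trans ge)// ltry.
Qed.

(** From below, [h] loses at most [e] in every integral over the unit ball. From above, a nearly
    optimal continuous majorant [phi] of [h], which exists by [cap_H0_E], gives the l.s.c. majorant
    [phi + g] of [f]. *)
Lemma H0star_has_capacity : has_capacity G f (cap_C0 G f).
Proof.
have f0 := H0star_ge0; split; apply/eqP; rewrite eq_le; apply/andP; split.
- exact: (cap_lower_le hX lcX kerG).
- apply/lee_addgt0Pr => e e0; have [h [g [H hlef Gg fhg ge]]] := H0star_approx e0.
  apply: ge_ereal_sup => _ [nu E1 <-].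
  have n1 : energy G nu <= (1 ^+ 2)%:E by rewrite expr1n; apply/Eplus1P.
  apply: le_trans (int_approx e0 ler01 H Gg fhg ge n1) _; rewrite mulr1 leeD2r//.
  by apply: le_trans (cap_C0_ub h E1) _; exact: (cap_lower_ub hX lcX kerG).
- apply/lee_addgt0Pr => e e0; have e20 : (0 < e / 2)%R by rewrite divr_gt0.
  have [h [g [H hlef Gg fhg ge]]] := H0star_approx e20.
  have h0 x := H0_ge0 x H; have [g0 _] := Gg.
  have hcf : cap_C0 G h <= cap_C0 G f by exact: cap_C0_le.
  have : cap_H0 G h < cap_C0 G f + (e / 2)%:E.
    rewrite (cap_H0_E hX lcX kerG)//; apply: le_lt_trans hcf _.
    rewrite lteDl ?lte_fin// ge0_fin_numE ?H0star_cap_lty//.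
    exact: (cap_C0_ge0 hX lcX).
  move=> /ereal_inf_lt[_ [phi [C0p hp] <-] lt].
  have Gphi := C0p.1.
  apply: le_trans (cap_upper_lb hX lcX G (GplusD Gphi Gg) _) _.
    by move=> x; apply: le_trans (fhg x) _; rewrite leeD2r.
  apply: le_trans (cap_C0D G Gphi.1 g0 (Gplus_measurable Gphi) (Gplus_measurable Gg)) _.
  by rewrite [e in leRHS]splitr EFinD addeA leeD// ltW.
- exact: (cap_upper_ge hX lcX).
Qed.

Lemma H0star_int_le nu (n : R) : (0 <= n)%R -> energy G nu <= (n ^+ 2)%:E ->
  \int[nu]_x f x <= (fine (cap_C0 G f) * n)%:E.
Proof.
move=> n0 En; have f0 := H0star_ge0.
have c0 := cap_C0_ge0 hX lcX G f0.
have fc : cap_C0 G f \is a fin_num by rewrite ge0_fin_numE ?H0star_cap_lty.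
have [_ cu] := H0star_has_capacity.
have n1 : (0 < n + 1)%R by rewrite ltr_wpDl.
apply/lee_addgt0Pr => e e0; pose d := (e / (n + 1))%R.
have d0 : (0 < d)%R by rewrite divr_gt0.
have : cap_upper G f < cap_C0 G f + d%:E by rewrite cu lteDl ?lte_fin.
move=> /(cap_upper_lt hX lcX)[g [Gg fg lt]].
apply: (@le_trans _ _ (\int[nu]_x g x)); first exact: ge0_integral_le.
have cd0 : (0 <= fine (cap_C0 G f) + d)%R by rewrite addr_ge0 ?fine_ge0// ltW.
have gcd : cap_C0 G g <= (fine (cap_C0 G f) + d)%:E by rewrite EFinD fineK// ltW.
apply: le_trans (int_le_cap hX lcX kerG Gg cd0 n0 gcd En) _.
rewrite -EFinD lee_fin mulrDl lerD2l /d mulrAC ler_pdivrMr//.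
by rewrite ler_pM2l// lerDl.
Qed.

(** If every measure of the unit ball gave less than the supremum, vague compactness would give one
    bound [a] below it for all of them. The covering sets are conditional on energy at most 1,
    because semicontinuity of the integral holds only within energy balls. *)
Lemma cap_attained : exists2 nu, Eplus1 G nu & \int[nu]_x f x = cap_C0 G f.
Proof.
apply: contrapT => nex.
have lt nu : Eplus1 G nu -> \int[nu]_x f x < cap_C0 G f.
  move=> E1; rewrite lt_neqAle cap_C0_ub// andbT; apply/eqP => eq.
  by apply: nex; exists nu.
have c0 := cap_C0_ge0 hX lcX G H0star_ge0.
have [| | |a /= ac E1a] := @compact_directed (vague R X) _ _
  [set a : R | a%:E < cap_C0 G f]
  (fun a => [set nu : vague R X | energy G (nu : radon R X) <= 1 ->
     \int[(nu : radon R X)]_x f x <= a%:E])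
  (energy_ball_vague hX lcX kerG).
- by exists (-1)%R => /=; apply: lt_le_trans c0; rewrite lte_fin ltrN10.
- move=> a b /= ac bc; exists (Num.max a b); split => /=.
  + by case: (leP a b).
  + by move=> nu /= h /h /le_trans; apply; rewrite lee_fin le_max lexx.
  + by move=> nu /= h /h /le_trans; apply; rewrite lee_fin le_max lexx orbT.
- move=> nu E1; have fin := H0star_int_fin (Eplus1_Eplus E1).
  have := lt _ E1; rewrite -(fineK fin).
  have fc : cap_C0 G f \is a fin_num by rewrite ge0_fin_numE ?H0star_cap_lty.
  rewrite -(fineK fc) lte_fin => ltr.
  pose a := ((fine (\int[(nu : radon R X)]_x f x) + fine (cap_C0 G f)) / 2)%R.
  exists a; first by rewrite /= -(fineK fc) lte_fin /a; lra.
  have En : energy G (nu : radon R X) <= (1 ^+ 2)%:E.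
    by rewrite expr1n; apply/Eplus1P.
  have : \int[(nu : radon R X)]_x f x < a%:E.
    by rewrite -(fineK fin) lte_fin /a; lra.
  move=> /(H0star_usc ler01 En); apply: filterS => mu h Em.
  by apply: ltW; apply: h; rewrite expr1n.
have : cap_C0 G f <= a%:E.
  apply: ge_ereal_sup => _ [nu E1 <-]; apply: E1a => //; exact/Eplus1P.
by rewrite leNgt ac.
Qed.

End ApproximableFunctions.

(** * The Gauss variational problem *)

Section GaussVariation.
Context {R : realType} {X : ptopologicalType}.
Hypothesis hX : hausdorff_space X.
Hypothesis lcX : locally_compact [set: X].
Variable G : X * X -> \bar R.
Hypothesis kerG : is_kernel G.
Implicit Types (mu nu : radon R X) (g h : X -> \bar R).
Variable f : X -> \bar R.
Hypothesis hf : H0star G f.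

Let f0 : forall x, 0 <= f x := H0star_ge0 hf.
Let pot0 := potential_ge0 kerG.
Let mpot := potential_measurable hX lcX kerG.
Let c := fine (cap_C0 G f).

Lemma fine_cap_ge0 : (0 <= c)%R.
Proof. by apply: fine_ge0; exact: cap_C0_ge0. Qed.

Lemma fine_capK : c%:E = cap_C0 G f.
Proof.
rewrite fineK// ge0_fin_numE; first exact: (H0star_cap_lty hX lcX kerG hf).
exact: cap_C0_ge0.
Qed.

Lemma Eplus_real nu : Eplus G nu -> exists n a : R,
  [/\ (0 <= n)%R, energy G nu = (n ^+ 2)%:E, \int[nu]_x f x = a%:E &
      (a <= c * n)%R].
Proof.
move=> Enu; have [n n0 En] := energy_bound kerG Enu.
have fin := H0star_int_fin hX lcX kerG hf Enu.
exists n, (fine (\int[nu]_x f x)); split => //; first by rewrite fineK.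
rewrite -lee_fin fineK//; apply: (H0star_int_le hX lcX kerG hf) => //.
by rewrite En.
Qed.

Lemma gauss_real nu (n a : R) : energy G nu = (n ^+ 2)%:E ->
  \int[nu]_x f x = a%:E -> gauss_functional G f nu = (2 * a - n ^+ 2)%:E.
Proof. by move=> En Ea; rewrite /gauss_functional norm_sqr// En Ea. Qed.

Lemma gauss_le nu : Eplus G nu -> gauss_functional G f nu <= (c ^+ 2)%:E.
Proof.
move=> /Eplus_real[n [a [n0 En Ea an]]]; rewrite (gauss_real En Ea) lee_fin.
by have := sqr_ge0 (c - n)%R; nra.
Qed.

(* Maximality rephrased by two conditions that are stable under vague limits. *)
Definition extremal nu : Prop :=
  energy G nu <= (c ^+ 2)%:E /\ (c ^+ 2)%:E <= \int[nu]_x f x.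

Lemma energy_Eplus nu (r : R) : energy G nu <= r%:E -> Eplus G nu.
Proof.
move=> h; apply/(EplusP kerG); rewrite ge0_fin_numE ?energy_ge0//.
by rewrite (le_lt_trans h)// ltry.
Qed.

(** With [n] the energy norm, [int f dnu <= c n] turns the two inequalities into [n <= c] and
    [c^2 <= c n], which force [n = c]; for [c = 0] the first suffices. *)
Lemma extremal_exact nu : extremal nu ->
  [/\ Eplus G nu, energy G nu = (c ^+ 2)%:E & \int[nu]_x f x = (c ^+ 2)%:E].
Proof.
move=> [h1 h2]; have Enu := energy_Eplus h1; split => //.
  have [n [a [n0 En Ea an]]] := Eplus_real Enu; move: h1 h2.
  rewrite En Ea !lee_fin => h1 h2; congr (_%:E).
  have c0 := fine_cap_ge0.
  have nc : (n <= c)%R by rewrite -(@ler_pXn2r _ 2)// ?nnegrE.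
  by nra.
have [n [a [n0 En Ea an]]] := Eplus_real Enu; move: h1 h2.
rewrite En Ea !lee_fin => h1 h2; congr (_%:E).
have c0 := fine_cap_ge0.
have nc : (n <= c)%R by rewrite -(@ler_pXn2r _ 2)// ?nnegrE.
by nra.
Qed.

Lemma extremal_gauss nu : extremal nu -> gauss_functional G f nu = (c ^+ 2)%:E.
Proof.
move=> /extremal_exact[_ En Ea]; rewrite (gauss_real En Ea); congr (_%:E).
by rewrite expr2; lra.
Qed.

Lemma extremal_exists : exists nu, extremal nu.
Proof.
have [nu E1 Ea] := cap_attained hX lcX kerG hf.
exists (rscale nu (NngNum fine_cap_ge0)); split.
  rewrite (energy_rscale hX lcX kerG)/= -[leRHS]mule1 lee_wpmul2l ?lee_fin ?sqr_ge0//.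
  exact/Eplus1P.
have [F [mF F0 Ff intF]] := H0star_borel hX lcX kerG hf.
rewrite -intF; last first.
  apply: (@energy_Eplus _ (c ^+ 2)%R).
  rewrite (energy_rscale hX lcX kerG)/= -[leRHS]mule1 lee_wpmul2l ?lee_fin ?sqr_ge0//.
  exact/Eplus1P.
rewrite int_rscale//= intF; last exact: Eplus1_Eplus.
by rewrite Ea -fine_capK -EFinM -expr2.
Qed.

Lemma maximizersP nu : maximizers G f nu <-> extremal nu.
Proof.
split; last first.
  move=> ex; have [Enu _ _] := extremal_exact ex; split => // s Es.
  by rewrite (extremal_gauss ex) gauss_le.
move=> [Enu max]; have [mu ex] := extremal_exists.
have [Emu _ _] := extremal_exact ex.
have := max _ Emu; rewrite (extremal_gauss ex).
have [n [a [n0 En Ea an]]] := Eplus_real Enu.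
rewrite (gauss_real En Ea) lee_fin => h.
have c0 := fine_cap_ge0.
(* Comparison with an extremal measure gives [c^2 <= 2 a - n^2], and [a <= c n]; together,
   [(c - n)^2 <= 0]. *)
have nc : n = c.
  have : ((c - n) ^+ 2 <= 0)%R by nra.
  by rewrite le_eqVlt ltNge sqr_ge0 orbF sqrf_eq0 subr_eq0 => /eqP.
by rewrite /extremal En Ea nc !lee_fin; split => //; rewrite nc in h; nra.
Qed.

Lemma maximizers_compact : compact (maximizers G f : set (vague R X)).
Proof.
rewrite compact_ultra => F UF FM; have PF : ProperFilter F by exact: ultra_proper.
have FE : F [set nu : vague R X | energy G (nu : radon R X) <= (c ^+ 2)%:E].
  by apply: filterS FM => nu /maximizersP[].
have := @energy_ball_compact R X hX lcX G kerG (c ^+ 2)%R; rewrite compact_ultra.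
move=> /(_ F UF FE)[nu [/= Enu Fnu]]; exists nu; split => //.
apply/maximizersP; split => //; rewrite leNgt; apply/negP => lt.
have near := H0star_usc hX lcX kerG hf (nu0 := nu) fine_cap_ge0 Enu lt.
have Fnear := Fnu _ near.
have [m [/maximizersP[h1 h2] h3]] := filter_ex (@filterI _ F _ _ _ FM Fnear).
by have := h3 h1; rewrite ltNge h2.
Qed.

Lemma variation mu nu : maximizers G f mu -> Eplus G nu ->
  \int[nu]_x f x <= \int[nu]_x potential G mu x.
Proof.
move=> Mmu Enu; have [Emu En Ea] := extremal_exact ((maximizersP mu).1 Mmu).
have [k [b [k0 Ek Eb _]]] := Eplus_real Enu.
have m0 : 0 <= \int[nu]_x potential G mu x by apply: integral_ge0.
have [->|my] := eqVneq (\int[nu]_x potential G mu x) +oo; first by rewrite leey.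
have fm : \int[nu]_x potential G mu x \is a fin_num by rewrite ge0_fin_numE// ltey.
pose m := fine (\int[nu]_x potential G mu x).
have mE : \int[nu]_x potential G mu x = m%:E by rewrite fineK.
(* [int_radd] and [int_rscale] are applied to the Borel function [F], which has the same integrals
   as [f]. *)
have [F [mF F0 Ff intF]] := H0star_borel hX lcX kerG hf.
(* The functional at [mu + t nu] is at most [c^2], its value at [mu]; the terms free of [t] cancel,
   and division by [t] leaves a remainder that vanishes with [t]. *)
have step (t : R) : (0 < t)%R -> (2 * b <= 2 * m + t * k ^+ 2)%R.
  move=> t0; pose r : {nonneg R} := NngNum (ltW t0).
  have Elam : energy G (radd mu (rscale nu r)) =
      (c ^+ 2 + t ^+ 2 * k ^+ 2 + 2 * (t * m))%:E.
    rewrite (energy_radd hX lcX kerG) (energy_rscale hX lcX kerG) int_rscale//.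
    by rewrite En Ek mE.
  have Elam' : Eplus G (radd mu (rscale nu r)).
    by apply/(EplusP kerG); rewrite Elam.
  have Er : Eplus G (rscale nu r).
    by apply/(EplusP kerG); rewrite (energy_rscale hX lcX kerG) Ek.
  have Ilam : \int[radd mu (rscale nu r)]_x f x = (c ^+ 2 + t * b)%:E.
    by rewrite -intF// int_radd// int_rscale// !intF// Ea Eb.
  have := gauss_le Elam'; rewrite /gauss_functional norm_sqr// Elam Ilam.
  rewrite -EFinM -EFinB lee_fin => h.
  have : (t * (2 * b) <= t * (2 * m + t * k ^+ 2))%R by nra.
  by rewrite ler_pM2l.
rewrite mE Eb lee_fin.
suff : (2 * b <= 2 * m)%R by lra.
apply/ler_addgt0Pr => e e0.
have k1 : (0 < k ^+ 2 + 1)%R by rewrite ltr_wpDl// sqr_ge0.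
apply: le_trans (step (e / (k ^+ 2 + 1))%R _) _; first by rewrite divr_gt0.
rewrite lerD2l mulrAC ler_pdivrMr// ler_pM2l// lerDl//.
Qed.

(** With [lam] the restriction of [nu] to [A], [int G mu dlam + d nu(A) <= int h dlam <= int f dlam
    <= int G mu dlam]. The integral of [G mu] is bounded by that of [h], hence finite, and
    cancels. *)
Lemma compact_mass0 mu nu h (A : set X) (d : R) (cA : compact A) :
  maximizers G f mu -> Eplus G nu -> (0 < d)%R -> H0 h ->
  (forall x, h x <= f x) ->
  (forall x, A x -> potential G mu x + d%:E <= h x) -> nu A = 0.
Proof.
move=> Mmu Enu d0 H hlef hA.
pose lam := rrestr hX nu cA.
have lamE B : lam B = nu (B `&` A) by [].
have mA : measurable (A : set (borel X)) by exact: borel_compact.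
have lam_le B : measurable B -> lam B <= nu B.
  by move=> _; rewrite lamE; apply: radon_le; exact: subIsetl.
have h0 x := H0_ge0 x H.
have Elam : Eplus G lam.
  apply/(EplusP kerG); move/(EplusP kerG) : Enu.
  rewrite !ge0_fin_numE ?energy_ge0//; apply: le_lt_trans.
  apply: (@le_trans _ _ (\int[lam]_x potential G nu x)).
    apply: ge0_integral_le => // x; apply: ge0_le_measure_integral => // y.
    exact: kernel_ge0.
  exact: ge0_le_measure_integral.
have lamC : lam (~` A) = 0 by rewrite lamE setICl measure0.
have m1 : measurable_fun [set: borel X] (fun x => d%:E * (\1_A x)%:E).
  apply: emeasurable_funM; first exact: measurable_cst.
  by apply/measurable_EFinP; exact: measurable_indic.
have i0 x : 0 <= d%:E * (\1_A x)%:E :> \bar R by rewrite mule_ge0// lee_fin ltW.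
have int1 : \int[lam]_x (potential G mu x + d%:E * (\1_A x)%:E) <= \int[lam]_x h x.
  apply: ge0_ae_le_integral => //; first by move=> x; rewrite adde_ge0.
  exists (~` A); split => //; first exact: measurableC.
  move=> x /= nle Ax; apply: nle; rewrite indicE mem_set// mule1; exact: hA.
have int2 : \int[lam]_x h x <= \int[lam]_x potential G mu x.
  by apply: le_trans (variation Mmu Elam); exact: ge0_integral_le.
have fpot : \int[lam]_x potential G mu x \is a fin_num.
  rewrite ge0_fin_numE; last exact: integral_ge0.
  apply: (@le_lt_trans _ _ (\int[lam]_x h x)).
    apply: le_trans int1; apply: ge0_integral_le => // x; exact: leeDl.
  by rewrite -ge0_fin_numE ?(H0_int_fin hX lcX)//; exact: integral_ge0.
have := le_trans int1 int2; rewrite ge0_integralD// ge0_integralZl//; last 2 first.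
- by apply/measurable_EFinP; exact: measurable_indic.
- by rewrite lee_fin ltW.
rewrite integral_indic// setIT -leeBrDl// subee// pmule_rle0 ?lte_fin//.
rewrite lamE setIid => A0; apply/eqP; rewrite eq_le A0; exact: measure_ge0.
Qed.

End GaussVariation.

(** * Properties of the maximizing measures *)

Section Extremals.
Context {R : realType} {X : ptopologicalType}.
Hypothesis hX : hausdorff_space X.
Hypothesis lcX : locally_compact [set: X].
Variable G : X * X -> \bar R.
Hypothesis kerG : is_kernel G.
Implicit Types (mu nu : radon R X) (g h : X -> \bar R).
Variable f : X -> \bar R.
Hypothesis hf : H0star G f.

Let f0 : forall x, 0 <= f x := H0star_ge0 hf.
Let pot0 := potential_ge0 kerG.
Let mpot := potential_measurable hX lcX kerG.
Let c := fine (cap_C0 G f).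

Lemma H0_indic (A : set X) : compact A -> H0 (fun x => (\1_A x)%:E : \bar R).
Proof.
move=> cA; have clA := compact_closed hX cA; split.
- by move=> x; rewrite lee_fin.
- by move=> x; exact: ltry.
- move=> x a; rewrite indicE; have [xA|xA] := boolP (x \in A) => lt.
    exists setT; first exact: filterT.
    move=> y _; apply: lt_le_trans lt _; rewrite -!EFinN lee_fin lerN2 indicE.
    by case: (_ \in _).
  exists (~` A).
    by apply: open_nbhs_nbhs; split; [exact: closed_openC|move/mem_set; apply/negP].
  by move=> y nAy; rewrite indicE memNset.
- rewrite (_ : [set x | _] = A); first by rewrite -(closure_id A).1.
  apply/seteqP; split => x /=; rewrite indicE eqe.
    by have [/set_mem//|_] := boolP (x \in A); rewrite eqxx.
  by move=> Ax; rewrite mem_set ?oner_eq0.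
Qed.

Lemma inv_succ_lt (d : R) : (0 < d)%R -> exists k : nat, (k.+1%:R^-1 < d)%R.
Proof.
move=> d0; exists (Num.bound d^-1); rewrite invf_plt ?posrE//.
apply: lt_trans (archi_boundP _) _; first by rewrite invr_ge0 ltW.
by rewrite ltr_nat.
Qed.

Lemma lt_inv_succ (a b : \bar R) : 0 <= a -> a < b ->
  exists k : nat, a + (k.+1%:R^-1)%:E < b.
Proof.
case: a => [a a0|_|//]; last by rewrite ltNge leey.
case: b => [b|_|//]; last by exists 0%N; rewrite -EFinD ltry.
rewrite lte_fin => ab; have [|k hk] := @inv_succ_lt (b - a)%R; first by rewrite subr_gt0.
by exists k; rewrite -EFinD lte_fin -ltrBrDl.
Qed.

(** Where [f > G mu + d], either [g >= d/2], and [(2/d) g] is a majorant of small capacity, or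
    [h >= G mu + d/2]. The second set [A] is closed since [G mu - h] is l.s.c., and compact since
    [h > 0] on it. *)
Lemma potential_ge_qe mu : maximizers G f mu ->
  quasi_everywhere G (fun x => f x <= potential G mu x).
Proof.
move=> Mmu.
apply: (@cap_upper_set_bigcup _ _ hX lcX G
  (fun k => [set x | potential G mu x + (k.+1%:R^-1)%:E < f x])).
  move=> x /= /negP; rewrite -ltNge => /(lt_inv_succ (pot0 _ _))[k hk].
  by exists k.
move=> k e e0; pose d : R := (k.+1%:R^-1)%R; have d0 : (0 < d)%R by rewrite invr_gt0.
have d20 : (0 < d / 2)%R by rewrite divr_gt0.
(* With this bound on the capacity of [g], the multiple [(2/d) g] has capacity at most [e/2]. *)
have ed0 : (0 < e * d / 4)%R by rewrite !mulr_gt0.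
have [h [g [H hlef Gg fhg ge]]] := H0star_approx hX lcX hf ed0.
have h0 x := H0_ge0 x H; have [g0 _] := Gg; have [_ _ uh ch] := H.
pose A := [set x | potential G mu x + (d / 2)%:E <= h x].
have clA : closed A.
  rewrite (_ : A = ~` [set x | (- (d / 2))%:E < potential G mu x + - h x]).
    have lw : lower_semicontinuous (fun x => potential G mu x + - h x).
      apply: lscD => //.
      - by apply: potential_lsc.
      - by move=> x; rewrite (lt_le_trans ltNy0).
      - by move=> x; rewrite -(fineK (H0_fin x H)) -EFinN ltNyr.
    by apply: open_closedC; move/lower_semicontinuousP : lw; exact.
  apply/seteqP; split => x /=.
    move=> hA; apply/negP; rewrite -leNgt leeBlDr ?H0_fin//.
    by rewrite EFinN addeC leeBrDr.
  move=> /negP; rewrite -leNgt leeBlDr ?H0_fin// EFinN addeC leeBrDr//.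
have cA : compact A.
  apply: subclosed_compact ch _ => // x /= hA; apply: subset_closure => /=.
  rewrite gt_eqF//; apply: lt_le_trans hA.
  by rewrite (@lt_le_trans _ _ (d / 2)%:E) ?lte_fin// leeDr.
(* Every measure of the unit ball vanishes on [A], and [cap_H0_E] converts this into a continuous
   majorant of [1_A] of small capacity: the passage from null for all measures to null for the outer
   capacity. *)
have capA : cap_H0 G (fun x => (\1_A x)%:E) < (e / 2)%:E.
  rewrite (cap_H0_E hX lcX kerG (H0_indic cA)).
  apply: (@le_lt_trans _ _ 0); last by rewrite lte_fin divr_gt0.
  apply: ge_ereal_sup => _ [nu E1 <-].
  have mA : measurable (A : set (borel X)) by exact: borel_compact.
  rewrite integral_indic// setIT.
  by rewrite (compact_mass0 hX lcX kerG hf cA Mmu (Eplus1_Eplus E1) d20 H hlef).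
have [_ [phi [C0p Aphi] <-] lt] := ereal_inf_lt capA.
have Gphi := C0p.1; have [phi0 _] := Gphi.
have dinv0 : (0 < 2 / d)%R by rewrite divr_gt0.
have GZ := GplusZ dinv0 Gg; have [gz0 _] := GZ.
exists (fun x => (2 / d)%:E * g x + phi x); split.
- exact: GplusD.
- move=> x hx; have [dg|gd] := leP (d / 2)%:E (g x).
    apply: (@le_trans _ _ ((2 / d)%:E * g x)); last by rewrite leeDl.
    apply: (@le_trans _ _ ((2 / d)%:E * (d / 2)%:E)).
      by rewrite -EFinM lee_fin mulrA divfK ?gt_eqF// divff.
    by rewrite lee_wpmul2l// lee_fin ltW.
  have Ax : A x.
    have gf : g x \is a fin_num by rewrite ge0_fin_numE// (lt_trans gd)// ltry.
    rewrite /A/= -(leeD2rE _ _ gf); apply: le_trans (fhg x); apply: le_trans (ltW hx).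
    rewrite -addeA leeD2l// -(fineK gf) -EFinD lee_fin.
    by move: gd; rewrite -{1}(fineK gf) lte_fin -/d; lra.
  apply: (@le_trans _ _ (phi x)); last by rewrite leeDr.
  by apply: le_trans (Aphi x); rewrite indicE mem_set.
- apply: le_trans (cap_C0D G gz0 phi0 (Gplus_measurable GZ) (Gplus_measurable Gphi)) _.
  rewrite [e]splitr EFinD; apply: leeD; last exact: ltW.
  apply: le_trans (cap_C0Z G dinv0 g0 (Gplus_measurable Gg)) _.
  apply: (@le_trans _ _ ((2 / d)%:E * (e * d / 4)%:E)).
    by rewrite lee_wpmul2l// lee_fin ltW.
  rewrite -EFinM lee_fin.
  have -> // : (2 / d * (e * d / 4) = e / 2)%R.
  by field; rewrite gt_eqF.
Qed.

(** [F <= f <= G mu] almost everywhere, and [F] and [G mu] have the same finite integral [c^2]. The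
    sets [B k] where [G mu] exceeds [F] by [1/(k+1)] are Borel, which is why [F] replaces [f], and
    they are null; off them [G mu <= F]. *)
Lemma potential_eq_ae mu : maximizers G f mu ->
  {ae mu, forall x, potential G mu x = f x}.
Proof.
move=> Mmu; have ex := (maximizersP hX lcX kerG hf mu).1 Mmu.
have [Emu En Ea] := extremal_exact hX lcX kerG hf ex.
have [F [mF F0 Ff intF]] := H0star_borel hX lcX kerG hf.
have aef := cap_null_ae hX lcX kerG (potential_ge_qe Mmu) Emu.
pose B k : set (borel X) := [set x | F x + (k.+1%:R^-1)%:E <= potential G mu x].
have mB k : measurable (B k).
  have mFk : measurable_fun [set: borel X] (fun x => F x + (k.+1%:R^-1)%:E).
    by apply: emeasurable_funD => //; exact: measurable_cst.
  by rewrite -[B k]setTI; exact: (measurable_lee measurableT mFk (mpot mu)).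
have B0 k : mu (B k) = 0.
  pose d : R := (k.+1%:R^-1)%R; have d0 : (0 < d)%R by rewrite invr_gt0.
  have m1 : measurable_fun [set: borel X] (fun x => (\1_(B k) x)%:E : \bar R).
    by apply/measurable_EFinP; exact: measurable_indic.
  have m2 : measurable_fun [set: borel X] (fun x => d%:E * (\1_(B k) x)%:E).
    by apply: emeasurable_funM => //; exact: measurable_cst.
  have i0 x : 0 <= d%:E * (\1_(B k) x)%:E :> \bar R.
    by rewrite mule_ge0// lee_fin ltW.
  have : \int[mu]_x (F x + d%:E * (\1_(B k) x)%:E) <= \int[mu]_x potential G mu x.
    apply: ge0_ae_le_integral => //; first by move=> x; rewrite adde_ge0.
    apply: (@filterS _ _ (ae_filter_ringOfSetsType mu) _ _ _ aef) => x fx.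
    rewrite indicE.
    have [xB|_] := boolP (x \in B k); first by rewrite mule1; exact: set_mem.
    by rewrite mule0 adde0 (le_trans (Ff x)).
  rewrite ge0_integralD// ge0_integralZl//; last by rewrite lee_fin ltW.
  rewrite integral_indic// setIT intF// Ea -/(energy G mu) En.
  rewrite -leeBrDl// subee// pmule_rle0 ?lte_fin// => le0.
  by apply/eqP; rewrite eq_le le0 measure_ge0.
have aeB : {ae mu, forall x, ~ (\bigcup_k B k) x}.
  have nB : mu.-negligible (\bigcup_k B k).
    by apply: negligible_bigcup => k; exists (B k); split => //; exact: B0.
  by apply: (negligibleS _ nB) => x /= /contrapT.
apply: (@filterS2 _ _ (ae_filter_ringOfSetsType mu) _ _ _ _ aef aeB) => x fx nB.
apply/eqP; rewrite eq_le fx andbT leNgt; apply/negP => lt; apply: nB.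
have [k hk] := lt_inv_succ (F0 x) (le_lt_trans (Ff x) lt).
by exists k => //; exact: ltW.
Qed.

(** If [G mu] vanishes at [x], then [mu] vanishes on the neighbourhood of [x] where [G(x, .)]
    exceeds a positive constant. Semicontinuity of [G mu] makes the set compact, so finitely many
    such neighbourhoods cover it. *)
Lemma potential_zero_null mu K : compact K ->
  mu (K `&` [set x | potential G mu x <= 0]) = 0.
Proof.
move=> cK; set Z := K `&` _.
have cZ : compact Z.
  apply: compact_closedI => //.
  rewrite (_ : [set x | _] = ~` [set x | 0%:E < potential G mu x]).
    have lw : lower_semicontinuous (potential G mu) by exact: potential_lsc.
    by apply: open_closedC; move/lower_semicontinuousP : lw; exact.
  by apply/seteqP; split => x /=; rewrite leNgt => /negP.
have [| | |U [oU U0] ZU] := @compact_directed X Z _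
  [set U : set X | open U /\ mu U = 0] id cZ.
- by exists set0; split; [exact: open0|exact: measure0].
- move=> U V [oU U0] [oV V0]; exists (U `|` V); split.
  + split; first exact: openU.
    apply/eqP; rewrite eq_le measure_ge0 andbT.
    apply: (@le_trans _ _ (mu U + mu V)); last by rewrite U0 V0 adde0.
    by apply: measureU2; exact: borel_open.
  + by move=> x; left.
  + by move=> x; right.
- move=> x [_ /= px0]; have [_ lG _ Gx] := kerG.
  have [e e0 eG] : exists2 e : R, (0 < e)%R & e%:E < G (x, x).
    move: (Gx x); case: (G (x, x)) => [s||//]; last by exists 1%R; rewrite ?ltry.
    by rewrite lte_fin => s0; exists (s / 2)%R; rewrite ?lte_fin; lra.
  have := kernel_section_lsc kerG eG.
  move=> [V xV VG]; move: xV; rewrite nbhsE /= => -[U [oU Ux] UV].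
  exists U; last exact: open_nbhs_nbhs.
  split => //; have mU : measurable (U : set (borel X)) by exact: borel_open.
  apply/eqP; rewrite eq_le measure_ge0 andbT -(pmule_rle0 _ (x := e%:E)) ?lte_fin//.
  apply: le_trans px0; rewrite /potential -[X in _ * mu X]setIT -integral_indic//.
  rewrite -ge0_integralZl//; last 2 first.
  + by apply/measurable_EFinP; exact: measurable_indic.
  + by rewrite lee_fin ltW.
  apply: ge0_integral_le => y; first by rewrite mule_ge0// lee_fin ltW.
  rewrite indicE; have [yU|_] := boolP (y \in U); last by rewrite mule0 kernel_ge0.
  by rewrite mule1; apply/ltW/VG/UV; exact: set_mem.
apply/eqP; rewrite eq_le measure_ge0 andbT -U0; exact: radon_le.
Qed.

(** Almost everywhere on [{f = 0}] the potential vanishes too, and the zeros of [G mu] are null in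
    each compact set. *)
Lemma maximizer_carried mu : maximizers G f mu -> carried_by mu [set x | 0 < f x].
Proof.
move=> Mmu K cK; have aeq := potential_eq_ae Mmu.
have nul := radon_negligible (potential_zero_null mu cK).
apply: (negligibleS _ (negligibleU aeq nul)) => x [Kx /= nf].
have [peq|pne] := pselect (potential G mu x = f x); last by left.
by right; split => //=; rewrite peq leNgt; exact/negP.
Qed.

(** Integrating [G nu <= f] against [nu] gives [n^2 <= int f dnu <= c n], hence [n <= c], for the
    energy norm [n]. *)
Lemma below_energy nu : Eplus_below G f nu ->
  energy G nu <= (c ^+ 2)%:E /\ \int[nu]_x f x <= (c ^+ 2)%:E.
Proof.
move=> [Enu ae]; have c0 := fine_cap_ge0 hX lcX hf.
have [n [a [n0 En Ea an]]] := Eplus_real hX lcX kerG hf Enu.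
have : energy G nu <= \int[nu]_x f x by exact: ge0_ae_le_integral.
rewrite En Ea !lee_fin => na.
have nc : (n <= c)%R.
  have : (n * n <= c * n)%R by rewrite -expr2 (le_trans na).
  have [->//|nn0] := eqVneq n 0%R.
  by rewrite ler_pM2r// lt0r nn0.
have nc2 : (c * n <= c ^+ 2)%R by rewrite expr2 ler_wpM2l.
split; last exact: le_trans nc2.
by rewrite (le_trans na)// (le_trans an).
Qed.

Lemma maximizer_below mu : maximizers G f mu -> Eplus_below G f mu.
Proof.
move=> Mmu; split; first by have [] := Mmu.
have ae := potential_eq_ae Mmu.
by apply: (@filterS _ _ (ae_filter_ringOfSetsType mu) _ _ _ ae) => x ->.
Qed.

End Extremals.

(** * Invariance under [c^*]-equivalence, and the theorem *)

Lemma H0star_int_qe (R : realType) (X : ptopologicalType)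
    (hX : hausdorff_space X) (lcX : locally_compact [set: X])
    (G : X * X -> \bar R) (kerG : is_kernel G) (f f' : X -> \bar R) nu :
  H0star G f -> H0star G f' -> cap_equiv G f f' -> Eplus G nu ->
  \int[nu]_x f' x = \int[nu]_x f x.
Proof.
move=> /H0star_ge0 f0 /H0star_ge0 f'0 ff' Enu.
have ae := cap_null_ae hX lcX kerG ff' Enu.
apply/eqP; rewrite eq_le; apply/andP; split; apply: ge0_ae_le_integral => //.
  by apply: (@filterS _ _ (ae_filter_ringOfSetsType nu) _ _ _ ae) => x ->.
by apply: (@filterS _ _ (ae_filter_ringOfSetsType nu) _ _ _ ae) => x ->.
Qed.

Theorem theorem2p3 (R : realType) (X : ptopologicalType)
    (G : X * X -> \bar R) (f : X -> \bar R)
    (hausdorffX : hausdorff_space X) (lcX : locally_compact [set: X])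
    (kerG : is_kernel G) (hf : H0star G f) :
  exists2 c : \bar R, has_capacity G f c &
    [/\ maximum [set 2%:E * \int[nu]_x f x - norm G nu ^+ 2 | nu in Eplus G]
          (c ^+ 2) /\ c ^+ 2 < +oo,
        maximum [set \int[nu]_x f x | nu in Eplus_below G f] (c ^+ 2),
        argmax (Eplus_below G f) (fun nu => \int[nu]_x f x) = maximizers G f,
        [/\ maximizers G f !=set0,
            compact (maximizers G f : set (vague R X)),
            maximizers G f `<=` Eplus G
          & forall f' : X -> \bar R, H0star G f' -> cap_equiv G f f' ->
              maximizers G f' = maximizers G f]
      & forall mu : radon R X, maximizers G f mu ->
        [/\ carried_by mu [set x | 0 < f x],
            quasi_everywhere G (fun x => f x <= potential G mu x),
            {ae mu, forall x, potential G mu x = f x}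
          & \int[mu]_x f x = norm G mu ^+ 2 /\ norm G mu ^+ 2 = c ^+ 2]].
Proof.
have hX := hausdorffX.
exists (cap_C0 G f); first exact: H0star_has_capacity.
have -> : cap_C0 G f ^+ 2 = (fine (cap_C0 G f) ^+ 2)%:E.
  by rewrite EFin_expe (fine_capK hX lcX kerG hf).
have MP := maximizersP hX lcX kerG hf.
have [mu0 ex0] := extremal_exists hX lcX kerG hf; have M0 := (MP mu0).2 ex0.
have exact nu := extremal_exact hX lcX kerG hf (nu := nu).
have [E0 _ I0] := exact _ ex0.
split.
- split; last exact: ltry.
  split; first by exists mu0 => //; exact: extremal_gauss.
  by move=> _ [nu Enu <-]; exact: gauss_le.
- split; first by exists mu0 => //; exact: maximizer_below.
  by move=> _ [nu /(below_energy hX lcX kerG hf)[_ h] <-].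
- apply/seteqP; split => nu.
    (* A maximizer of the second problem has integral at least that of [mu0], namely [c^2], and its
       energy is bounded by [below_energy]: these are the two conditions of [extremal]. *)
    move=> [Bnu max]; apply/MP; split.
      by have [] := below_energy hX lcX kerG hf Bnu.
    by rewrite -I0; apply: max; exact: maximizer_below.
  move=> Mnu; split; first exact: maximizer_below.
  move=> s /(below_energy hX lcX kerG hf)[_ h].
  by have [_ _ ->] := exact _ ((MP nu).1 Mnu).
- split.
  + by exists mu0.
  + exact: maximizers_compact.
  + by move=> nu [].
  + move=> f' hf' ff'.
    have J nu : Eplus G nu -> gauss_functional G f' nu = gauss_functional G f nu.
      move=> Enu; rewrite /gauss_functional.
      by rewrite (H0star_int_qe hX lcX kerG hf hf' ff' Enu).
    apply/seteqP; split => nu [Enu max]; split => // s Es.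
      by rewrite -!J//; exact: max.
    by rewrite !J//; exact: max.
- move=> mu Mmu; have [Emu En Ea] := exact _ ((MP mu).1 Mmu).
  split.
  + exact: (maximizer_carried hX lcX kerG hf).
  + exact: (potential_ge_qe hX lcX kerG hf).
  + exact: (potential_eq_ae hX lcX kerG hf).
  + by rewrite norm_sqr// En Ea.
Qed.
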